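(* Let $(d(n))_{n\ge1}$ be a nondecreasing sequence of positive integers with $\lim_{n\to\infty}d(n)=\infty$. Assume that the following two conditions hold. (A1) $\displaystyle \frac{d(n)^2}{\mathbb{E}_0\big(\widehat\lambda_{\min}(d(n))\big)}=o_{\mathbb{P}_0}(\log n)$ as $n\to\infty$. (A2) There exists a constant $M>0$ such that for all $k>0$, $\displaystyle \frac1k\sum_{i=1}^k\mathbb{E}_0\big(Z_i^4\big)<M$, where $Z_i=P_i(X)-Q_i(U)$. Then, under $H_0:\mathcal{L}_Y=\mathcal{L}_V$, the statistic $T_n(S_n)$ converges in distribution, as $n\to\infty$, to a $\chi^2$ random variable with $1$ degree of freedom.
   Context: Model. $X=Y+Z$ and $U=V+W$ are real random variables, where $Y$ and $Z$ are independent, $V$ and $W$ are independent, and $Z$ and $W$ are independent; $Y$ and $V$ may be dependent, so $X$ and $U$ may be paired. All moments of these variables exist and characterize the associated distributions. The moments $z_i=\mathbb{E}(Z^i)$ and $w_i=\mathbb{E}(W^i)$ are known for all $i$. One observes i.i.d. pairs $(X_1,U_1),\dots,(X_n,U_n)$ distributed as $(X,U)$. $\mathcal{L}_Y$ and $\mathcal{L}_V$ denote the distributions of $Y$ and $V$. The null hypothesis is $H_0:\mathcal{L}_Y=\mathcal{L}_V$; $\mathbb{P}_0$ and $\mathbb{E}_0$ denote probability and expectation under $H_0$. Polynomials. $P_i$ and $Q_i$ are the polynomials of degree $i$ obtained by inverting $\mathbb{E}(X^i)=\sum_{j=0}^i\binom{i}{j}\mathbb{E}(Y^j)z_{i-j}$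 and $\mathbb{E}(U^i)=\sum_{j=0}^i\binom{i}{j}\mathbb{E}(V^j)w_{i-j}$, so that $\mathbb{E}(Y^i)=\mathbb{E}(P_i(X))$ and $\mathbb{E}(V^i)=\mathbb{E}(Q_i(U))$. Explicitly, $P_0=Q_0=1$ and, for $i\ge 1$, $P_i(x)=x^i-\sum_{j=0}^{i-1}\binom{i}{j}z_{i-j}P_j(x)$ and $Q_i(x)=x^i-\sum_{j=0}^{i-1}\binom{i}{j}w_{i-j}Q_j(x)$. Test statistic. For $k\ge 1$ let $\mathbf{V}_s(k)=(P_i(X_s)-Q_i(U_s))_{1\le i\le k}\in\mathbb{R}^k$ (column vector), $J_n(k)=\frac{1}{\sqrt n}\sum_{s=1}^n \mathbf{V}_s(k)$, $\widehat\Sigma_n(k)=\frac1n\sum_{s=1}^n \mathbf{V}_s(k)\mathbf{V}_s(k)'$ (where $'$ denotes transposition), and $T_n(k)=J_n(k)'\,\widehat\Sigma_n(k)^{-1}J_n(k)$. It is assumed throughout that the matrices $\widehat\Sigma_n(k)$, $1\le k\le d(n)$, are positive definite (almost surely, for $n$ large enough), so that their inverses exist. $\widehat\lambda_{\min}(k)$ denotes the smallest eigenvalue of $\widehat\Sigma_n(k)$ (it depends on $n$). Data-driven selection. $S_n$ is the smallest element of $\operatorname{argmax}_{1\le k\le d(n)}\big(T_n(k)-k\log n\big)$, and $T_n(S_n)$ is $T_n(k)$ evaluated at $k=S_n$. Notation. $A_n=o_{\mathbb{P}_0}(\log n)$ means that $A_n/\log n\to0$ in probability under $\mathbb{P}_0$.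 *)

(* Defs.v *)
From HB Require Import structures.
From mathcomp Require Import all_boot all_order all_algebra.
From mathcomp Require Import all_classical all_reals all_analysis measurable_realfun.

Set Implicit Arguments.
Unset Strict Implicit.
Unset Printing Implicit Defensive.

Import Order.TTheory GRing.Theory Num.Theory.
Import numFieldNormedType.Exports.

Local Open Scope classical_set_scope.
Local Open Scope ring_scope.

Definition same_law d1 d2 d' (T1 : measurableType d1) (T2 : measurableType d2)
    (E : measurableType d') (R : realType) (P1 : probability T1 R)
    (P2 : probability T2 R) (X1 : T1 -> E) (X2 : T2 -> E) : Prop :=
  forall A : set E, measurable A -> pushforward P1 X1 A = pushforward P2 X2 A.

Definition independent_RV d d1 d2 (T : measurableType d)
    (E1 : measurableType d1) (E2 : measurableType d2) (R : realType)
    (P : probability T R) (X : T -> E1) (Y : T -> E2) : Prop :=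
  forall (A : set E1) (B : set E2), measurable A -> measurable B ->
    P ((X @^-1` A) `&` (Y @^-1` B)) = (P (X @^-1` A) * P (Y @^-1` B))%E.

Definition mutually_independent_RV d d' (T : measurableType d)
    (E : measurableType d') (R : realType) (P : probability T R)
    (X : nat -> T -> E) : Prop :=
  forall (I : seq nat) (A : nat -> set E), uniq I ->
    (forall s, measurable (A s)) ->
    P (\bigcap_(s in [set` I]) (X s @^-1` A s)) =
    (\prod_(s <- I) P (X s @^-1` A s))%E.

Definition has_all_moments d (T : measurableType d) (R : realType)
    (P : probability T R) (X : T -> R) : Prop :=
  forall i : nat, P.-integrable [set: T] (fun t => (X t ^+ i)%:E).

Definition moment_determinate d (T : measurableType d) (R : realType)
    (P : probability T R) (X : T -> R) : Prop :=
  has_all_moments P X /\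
  forall nu : probability (measurableTypeR R) R,
    has_all_moments nu (fun x : R => x) ->
    (forall i : nat, 'E_nu[fun x : R => (x ^+ i)%R] = 'E_P[fun t => (X t ^+ i)%R])%E ->
    forall A : set (measurableTypeR R), measurable A -> nu A = pushforward P X A.

Definition cvg_in_distribution d (T : measurableType d) (R : realType)
    (P : probability T R) (A : nat -> T -> R)
    (nu : probability (measurableTypeR R) R) : Prop :=
  (forall n, measurable_fun [set: T] (A n)) /\
  forall x : R, {for x, continuous (fun y : R => nu `]-oo, y]%classic)} ->
    P [set t | A n t <= x] @[n --> \oo] --> nu `]-oo, x]%classic.

Definition little_oP d (T : measurableType d) (R : realType)
    (P : probability T R) (A : nat -> T -> R) (a : nat -> R) : Prop :=
  forall e : R, 0 < e ->
    P [set t | e <= `|A n t / a n|] @[n --> \oo] --> 0%E.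

(* The chi-square distribution with one degree of freedom is the law of the
   square of a standard normal variable. *)
Definition sqr_fun (R : realType) (x : measurableTypeR R) : measurableTypeR R :=
  (x : R) ^+ 2.

Lemma measurable_sqr_fun (R : realType) :
  measurable_fun [set: measurableTypeR R] (@sqr_fun R).
Proof. exact: measurable_funX. Qed.

HB.instance Definition _ (R : realType) :=
  isMeasurableFun.Build _ _ _ _ (@sqr_fun R) (@measurable_sqr_fun R).

Definition chi2_1 (R : realType) : probability (measurableTypeR R) R :=
  distribution (@normal_prob R 0 1) (@sqr_fun R).

Fixpoint deconv_polys (R : realType) (m : nat -> R) (n : nat) : seq {poly R} :=
  if n is i.+1 then
    let s := deconv_polys m i in
    rcons s ('X^i - \sum_(j < i) ('C(i, j)%:R * m (i - j)%N) *: s`_j)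
  else [::].

(* deconv_poly m i is the polynomial of degree i which, for the moment sequence
   m of an error E independent of Y, satisfies
   E[(deconv_poly m i)(Y + E)] = E[Y ^ i]. *)
Definition deconv_poly (R : realType) (m : nat -> R) (i : nat) : {poly R} :=
  (deconv_polys m i.+1)`_i.

Lemma size_deconv_polys (R : realType) (m : nat -> R) n :
  size (deconv_polys m n) = n.
Proof. by elim: n => //= n IH; rewrite size_rcons IH. Qed.

Lemma deconv_polyE (R : realType) (m : nat -> R) i :
  deconv_poly m i =
  'X^i - \sum_(j < i) ('C(i, j)%:R * m (i - j)%N) *: deconv_poly m j.
Proof.
have nthE n j : (j < n)%N -> (deconv_polys m n)`_j = deconv_poly m j.
  elim: n => // n IH; rewrite ltnS leq_eqVlt => /predU1P[->//|jn].
  by rewrite /= nth_rcons size_deconv_polys jn IH.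
rewrite {1}/deconv_poly /= nth_rcons size_deconv_polys ltnn eqxx.
by congr (_ - _); apply: eq_bigr => j _; rewrite nthE.
Qed.

(* deconv_diff z w i x u is P_i(x) - Q_i(u). *)
Definition deconv_diff (R : realType) (z w : nat -> R) (i : nat) (x u : R) : R :=
  (deconv_poly z i).[x] - (deconv_poly w i).[u].

(* The 0-based coordinate i of the vector carries the index i + 1. *)
Definition diff_vec (R : realType) (z w : nat -> R) (k : nat) (x u : R) :
    'cV[R]_k :=
  \col_(i < k) deconv_diff z w i.+1 x u.

(* In the statistics below, the sample of size n consists of the pairs
   (xs s, us s) for 0 <= s < n. *)
Definition J_stat (R : realType) (z w : nat -> R) (xs us : nat -> R)
    (n k : nat) : 'cV[R]_k :=
  (Num.sqrt n%:R)^-1 *: \sum_(s < n) diff_vec z w k (xs s) (us s).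

Definition Sigma_hat (R : realType) (z w : nat -> R) (xs us : nat -> R)
    (n k : nat) : 'M[R]_k :=
  n%:R^-1 *: \sum_(s < n)
    (diff_vec z w k (xs s) (us s) *m (diff_vec z w k (xs s) (us s))^T).

Definition T_stat (R : realType) (z w : nat -> R) (xs us : nat -> R)
    (n k : nat) : R :=
  ((J_stat z w xs us n k)^T *m invmx (Sigma_hat z w xs us n k)
     *m J_stat z w xs us n k) 0 0.

(* A real symmetric matrix of positive size has a finite nonempty set of real
   eigenvalues, so that the infimum is then a minimum. *)
Definition lambda_min (R : realType) (k : nat) (A : 'M[R]_k) : R :=
  inf [set a : R | eigenvalue A a].

Definition posdefmx (R : realType) (k : nat) (A : 'M[R]_k) : Prop :=
  A^T = A /\ forall v : 'cV[R]_k, v != 0 -> 0 < (v^T *m A *m v) 0 0.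

Definition least_argmax (R : realType) (D : nat) (f : nat -> R) : nat :=
  head 0%N [seq k <- iota 1 D | all (fun j => f j <= f k) (iota 1 D)].

Lemma least_argmaxP (R : realType) (D : nat) (f : nat -> R) : (0 < D)%N ->
  let k := least_argmax D f in
  [/\ (1 <= k <= D)%N, forall j, (1 <= j <= D)%N -> f j <= f k &
      forall j, (1 <= j < k)%N -> f j < f k].
Proof.
move=> D0 k.
pose p i := all (fun j => f j <= f i) (iota 1 D).
have pP i : reflect (forall j, (1 <= j <= D)%N -> f j <= f i) (p i).
  apply: (iffP allP) => h j.
    by move=> jD; apply: h; rewrite mem_iota add1n ltnS jD.
  by rewrite mem_iota add1n ltnS; exact: h.
have hp : has p (iota 1 D).
  have [i _ hi] := @arg_maxP _ _ _ (Ordinal D0) xpredT (fun i => f i.+1) isT.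
  apply/hasP; exists i.+1; first by rewrite mem_iota add1n !ltnS ltn_ord.
  by apply/pP => -[//|j] /= jD; exact: (hi (Ordinal jD)).
have kE : k = nth 0%N (iota 1 D) (find p (iota 1 D)).
  rewrite /k /least_argmax -/p; elim: (iota 1 D) hp => //= a s IH.
  by rewrite -/(p a); case: (p a).
have fD : (find p (iota 1 D) < D)%N by move: hp; rewrite has_find size_iota.
have kfind : k = (find p (iota 1 D)).+1 by rewrite kE nth_iota.
have pk : p k by rewrite kE nth_find.
split; [by rewrite kfind | exact/pP |].
move=> [//|j] /=; rewrite kfind ltnS -kfind => jk.
have jD : (j < D)%N := ltn_trans jk fD.
rewrite lt_neqAle (pP _ pk) // andbT; apply/eqP => fjk.
have /negP : ~~ p j.+1.
  by rewrite -[j.+1]add1n -(@nth_iota 0%N 1 D) // before_find.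
by apply; apply/pP => i iD; rewrite fjk; exact: (pP _ pk).
Qed.

Definition S_stat (R : realType) (z w : nat -> R) (xs us : nat -> R)
    (d : nat -> nat) (n : nat) : nat :=
  least_argmax (d n) (fun k => T_stat z w xs us n k - k%:R * ln n%:R).

(* Main.v *)
(* Under H0 the coordinates P_i(X) - Q_i(U) are centred, because inverting the
   binomial convolution of moments gives E P_i(X) = E Y^i and E Q_i(U) = E V^i.

   Let k = d(n), let L be the smallest eigenvalue of the empirical matrix and
   e = E L.  Since E L |v|^2 <= E (v' Sigma_hat v) = v' Sigma v, the deterministic
   matrix Sigma is bounded below by e.  By (A2) the squared Frobenius distance
   between Sigma_hat and Sigma has mean at most k^2 M / n, while (A1) and k >= 1
   give 1/e = o(log n); hence Sigma_hat >= e/2 with probability tending to 1.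
   (A1) constrains e only if e > 0, which holds for n large because Sigma_hat is
   then positive definite.  On this event every T_n(j) with j <= k is at most
   2 |J_n(k)|^2 / e, and S_n >= 2 forces some T_n(j) >= log n, which has small
   probability by Markov's inequality, E |J_n(k)|^2 <= k (1 + M) and (A1).  So
   S_n = 1 with probability tending to 1, and T_n(1) is the square of a
   self-normalized sum.

   The central limit theorem is obtained by Trotter's operator method: the
   averaging operators f |-> (x |-> E f (x + xi)) of two laws with the same two
   first moments differ by O(E |xi|^3) on functions with a third order Taylor
   expansion, a class stable under averaging, and normal laws are stable under
   convolution. *)

Require Import Defs.
From HB Require Import structures.
From mathcomp Require Import all_boot all_order all_algebra.
From mathcomp Require Import all_classical all_reals all_analysis.
From mathcomp Require Import measurable_realfun ring lra.
Import Order.TTheory GRing.Theory Num.Theory.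
Import numFieldNormedType.Exports.
Local Open Scope classical_set_scope.
Local Open Scope ring_scope.

Set Implicit Arguments.
Unset Strict Implicit.
Unset Printing Implicit Defensive.

(** * Quadratic forms and the smallest eigenvalue *)

Section QuadraticForms.
Variable R : realType.

(** Trotter's comparison speaks of smooth functions, convergence in distribution of half-lines. The
    gap is closed by logistic steps, whose derivatives are bounded because they are polynomials in
    the function itself, and by the Lipschitz continuity of the normal distribution function. The
    normal moments that the comparison needs are read off the moment generating function, by
    matching two expansions in its parameter. The expectation in (A1) can be handled only once the
    smallest eigenvalue is known to be measurable. It is therefore characterised variationally:
    [c <= lambda_min A] means that [A - c] is positive semidefinite, which can be tested on
    countably many vectors. (A1) concerns a deterministic sequence, so each event in it is empty or
    the whole space, and convergence in probability becomes an eventual inequality. With r = k^2 / e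
    <= h log n, the two Markov bounds are at most 4 M r^2 / n and 2 (1 + M) r / log n, so that one
    quantity controls both. *)

Definition bilf k (A : 'M[R]_k) (x y : 'cV[R]_k) : R := (x^T *m A *m y) 0 0.
Definition nrm2 k (x : 'cV[R]_k) : R := (x^T *m x) 0 0.
Definition frob2 m k (A : 'M[R]_(m, k)) : R := \sum_i \sum_j A i j ^+ 2.

Lemma nrm2E k (x : 'cV[R]_k) : nrm2 x = \sum_i x i 0 ^+ 2.
Proof. by rewrite /nrm2 mxE; apply: eq_bigr => i _; rewrite mxE expr2. Qed.

Lemma nrm2_ge0 k (x : 'cV[R]_k) : 0 <= nrm2 x.
Proof. by rewrite nrm2E sumr_ge0 // => i _; rewrite sqr_ge0. Qed.

Lemma nrm2_gt0 k (x : 'cV[R]_k) : x != 0 -> 0 < nrm2 x.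
Proof.
move=> x0; rewrite lt_neqAle nrm2_ge0 andbT eq_sym.
apply: contraNneq x0; rewrite nrm2E => /eqP.
rewrite psumr_eq0 => [/allP h|i _]; last exact: sqr_ge0.
apply/eqP/matrixP => i j; rewrite ord1 mxE.
by have := h i (mem_index_enum _); rewrite /= sqrf_eq0 => /eqP.
Qed.

Lemma frob2_ge0 m k (A : 'M[R]_(m, k)) : 0 <= frob2 A.
Proof. by apply: sumr_ge0 => i _; apply: sumr_ge0 => j _; rewrite sqr_ge0. Qed.

Lemma bilf1 k (x y : 'cV[R]_k) : bilf 1%:M x y = (x^T *m y) 0 0.
Proof. by rewrite /bilf mulmx1. Qed.

Lemma bilfDl k (A : 'M[R]_k) x y u : bilf A (x + y) u = bilf A x u + bilf A y u.
Proof. by rewrite /bilf linearD /= !mulmxDl mxE. Qed.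

Lemma bilfDr k (A : 'M[R]_k) x y u : bilf A u (x + y) = bilf A u x + bilf A u y.
Proof. by rewrite /bilf mulmxDr mxE. Qed.

Lemma bilfZl k (A : 'M[R]_k) a x u : bilf A (a *: x) u = a * bilf A x u.
Proof. by rewrite /bilf linearZ /= -!scalemxAl mxE. Qed.

Lemma bilfZr k (A : 'M[R]_k) a x u : bilf A u (a *: x) = a * bilf A u x.
Proof. by rewrite /bilf -!scalemxAr mxE. Qed.

Lemma bilfBm k (A B : 'M[R]_k) x y : bilf (A - B) x y = bilf A x y - bilf B x y.
Proof. by rewrite /bilf mulmxBr mulmxBl !mxE. Qed.

Lemma bilf_scalar k c (x : 'cV[R]_k) : bilf c%:M x x = c * nrm2 x.
Proof. by rewrite /bilf mul_mx_scalar -scalemxAl mxE. Qed.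

Lemma bilfC k (A : 'M[R]_k) x y : A^T = A -> bilf A x y = bilf A y x.
Proof.
move=> sA; rewrite /bilf; transitivity ((y^T *m A *m x)^T 0 0); last by rewrite mxE.
by rewrite !trmx_mul trmxK sA mulmxA.
Qed.

(** The quadratic is evaluated at its minimiser [- b / c]. When [c = 0] it is affine in [t], and a
    nonzero [b] would give it the value -1 at [- (a + 1) / (2 * b)]. *)
Lemma discr_le (a b c : R) : 0 <= c ->
  (forall t, 0 <= a + 2 * t * b + t ^+ 2 * c) -> b ^+ 2 <= a * c.
Proof.
rewrite le_eqVlt => /predU1P[<-|c0] h.
  rewrite mulr0; have [->|b0] := eqVneq b 0; first by rewrite expr0n.
  have := h (- (a + 1) / (2 * b)).
  by rewrite (_ : _ + _ = - 1) ?oppr_ge0 ?ler10 //; field.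
have := h (- b / c).
rewrite (_ : _ + _ = (a * c - b ^+ 2) / c); last by field; rewrite gt_eqF.
by rewrite pmulr_lge0 ?invr_gt0 // subr_ge0.
Qed.

Lemma bilf_CS k (A : 'M[R]_k) x y : A^T = A -> (forall v, 0 <= bilf A v v) ->
  bilf A x y ^+ 2 <= bilf A x x * bilf A y y.
Proof.
move=> sA psd; apply: discr_le => // t.
have := psd (x + t *: y).
rewrite !(bilfDl, bilfDr, bilfZl, bilfZr) (bilfC y x sA).
by congr (0 <= _); ring.
Qed.

Lemma dotmx_CS k (x y : 'cV[R]_k) : (x^T *m y) 0 0 ^+ 2 <= nrm2 x * nrm2 y.
Proof.
have := @bilf_CS k 1%:M x y (trmx1 _ _); rewrite !bilf1; apply => v.
by rewrite bilf1 nrm2_ge0.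
Qed.

Lemma nrm2_mul_le m k (A : 'M[R]_(m, k)) x : nrm2 (A *m x) <= frob2 A * nrm2 x.
Proof.
rewrite nrm2E /frob2 mulr_suml; apply: ler_sum => i _.
have := dotmx_CS (row i A)^T x; rewrite trmxK nrm2E.
rewrite (_ : (row i A *m x) 0 0 = (A *m x) i 0); last first.
  by rewrite -row_mul mxE.
by move=> /le_trans; apply; under eq_bigr do rewrite !mxE.
Qed.

Lemma bilf_frob k (A : 'M[R]_k) x : `|bilf A x x| <= Num.sqrt (frob2 A) * nrm2 x.
Proof.
rewrite -(ler_pXn2r (ltn0Sn 1)) ?nnegrE ?normr_ge0 ?mulr_ge0 ?sqrtr_ge0 ?nrm2_ge0 //.
rewrite real_normK ?num_real // exprMn sqr_sqrtr ?frob2_ge0 //.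
rewrite /bilf -mulmxA (le_trans (dotmx_CS _ _)) // expr2 mulrCA.
by rewrite ler_wpM2l ?nrm2_ge0 // nrm2_mul_le.
Qed.

(** With y = A x one has |y|^2 = y' A x. Cauchy-Schwarz for the form of A bounds |y|^4 by (y' A
    y)(x' A x), the Frobenius bound applies to the first factor, and |y|^2 cancels. *)
Lemma psd_mul_le k (A : 'M[R]_k) x : A^T = A -> (forall v, 0 <= bilf A v v) ->
  nrm2 (A *m x) <= Num.sqrt (frob2 A) * bilf A x x.
Proof.
move=> sA psd; set y := A *m x.
have yE : nrm2 y = bilf A y x by rewrite /nrm2 /bilf -mulmxA.
have [y0|y0] := eqVneq (nrm2 y) 0.
  by rewrite y0 mulr_ge0 ?sqrtr_ge0.
have {}y0 : 0 < nrm2 y by rewrite lt_neqAle eq_sym y0 nrm2_ge0.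
rewrite -(ler_pM2l y0) -expr2 {1}yE.
apply: (le_trans (bilf_CS _ _ sA psd)); rewrite mulrA ler_wpM2r //.
rewrite mulrC.
exact: le_trans (ler_norm _) (bilf_frob _ _).
Qed.

(** Writing v as A^-1 (A v) gives |v|^2 <= |A^-1|^2 |A v|^2 in Frobenius norm, and [psd_mul_le]
    turns |A v|^2 into a multiple of v' A v. The added 1 in [K + 1] keeps the constant invertible
    even if [K = 0]. *)
Lemma posdef_lower_bound k (A : 'M[R]_k) : A^T = A ->
  (forall v, 0 <= bilf A v v) -> A \in unitmx ->
  exists2 c, 0 < c & forall v, c * nrm2 v <= bilf A v v.
Proof.
move=> sA psd uA.
pose K := frob2 (invmx A) * Num.sqrt (frob2 A).
have K0 : 0 <= K by rewrite mulr_ge0 ?frob2_ge0 ?sqrtr_ge0.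
exists (K + 1)^-1 => [|v]; first by rewrite invr_gt0 ltr_wpDl.
rewrite ler_pdivrMl ?ltr_wpDl // mulrDl mul1r ler_wpDr //.
rewrite -{1}[v](mulKmx uA) (le_trans (nrm2_mul_le _ _)) // /K -mulrA.
by rewrite ler_wpM2l ?frob2_ge0 // psd_mul_le.
Qed.

Lemma nrm2_scale_delta k (i : 'I_k) : nrm2 (delta_mx i 0 : 'cV[R]_k) = 1.
Proof.
rewrite nrm2E (bigD1 i) //= big1 ?addr0 ?mxE ?eqxx ?expr1n // => j ji.
by rewrite mxE (negbTE ji) expr0n.
Qed.

(* The largest c with A - c PSD makes A - c singular, hence is an eigenvalue:
   a positive semidefinite invertible form is bounded below by a multiple of
   the norm. *)
Lemma lambda_minP k (A : 'M[R]_k) c : (0 < k)%N -> A^T = A ->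
  (c <= lambda_min A) <-> (forall v, c * nrm2 v <= bilf A v v).
Proof.
case: k A => // k A _ sA.
pose S := [set b | forall v, b * nrm2 v <= bilf A v v].
have ubS b : S b -> b <= bilf A (delta_mx 0 0) (delta_mx 0 0).
  by move=> /(_ (delta_mx 0 0)); rewrite nrm2_scale_delta mulr1.
have S0 : S !=set0.
  exists (- Num.sqrt (frob2 A)) => v; rewrite mulNr lerNl.
  by rewrite (le_trans _ (bilf_frob _ _)) // -normrN ler_norm.
have supS : has_sup S by split=> //; eexists => b /ubS; apply.
pose m := sup S.
have Sm : S m.
  move=> v; have [->|v0] := eqVneq v 0.
    by rewrite /nrm2 /bilf !(trmx0, mul0mx, mulmx0) mxE mulr0.
  rewrite -ler_pdivlMr ?nrm2_gt0 //; apply: ge_sup => // b Sb.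
  by rewrite ler_pdivlMr ?nrm2_gt0.
have sAm : (A - m%:M)^T = A - m%:M by rewrite linearB /= sA tr_scalar_mx.
have [a ev] : exists2 v : 'rV_k.+1, v *m A = m *: v & v != 0.
  have : A - m%:M \notin unitmx.
    apply/negP => u.
    have [|b b0 bP] := posdef_lower_bound sAm _ u.
      by move=> v; rewrite bilfBm bilf_scalar subr_ge0.
    have : S (m + b).
      move=> v; have := bP v; rewrite bilfBm bilf_scalar mulrDl lerBrDr.
      by rewrite addrC.
    move/(sup_upper_bound supS); rewrite -/m.
    by rewrite gerDl leNgt b0.
  rewrite -row_free_unit -kermx_eq0 => /rowV0Pn[v].
  move=> /sub_kermxP; rewrite mulmxBr mul_mx_scalar => /subr0_eq vA v0.
  by exists v.
move=> a0.
have mE : eigenvalue A m by apply/eigenvalueP; exists a.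
have lbE b : eigenvalue A b -> m <= b.
  move=> /eigenvalueP[v vA v0].
  have vT0 : v^T != 0 by rewrite -(inj_eq trmx_inj) trmxK trmx0.
  have := Sm v^T; rewrite /bilf trmxK vA -scalemxAl mxE.
  rewrite (_ : (v *m v^T) 0 0 = nrm2 v^T); last by rewrite /nrm2 trmxK.
  by rewrite ler_pM2r ?nrm2_gt0.
have -> : lambda_min A = m.
  apply/eqP; rewrite eq_le; apply/andP; split.
    by apply: ge_inf => //; exists m => b /lbE.
  by apply: lb_le_inf => [|b /lbE//]; exists m.
split=> [cm v|Sc]; last exact: sup_upper_bound.
by rewrite (le_trans _ (Sm v)) // ler_wpM2r ?nrm2_ge0.
Qed.

(** Put y = A^-1 x and q = x' A^-1 x. Then q is both x' y and y' A y, so q^2 <= |x|^2 |y|^2 while c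
    |y|^2 <= q; multiplying the first by c and dividing by q gives the bound. *)
Lemma bilf_invmx k (A : 'M[R]_k) c : A^T = A -> 0 < c ->
  (forall v, c * nrm2 v <= bilf A v v) ->
  forall x, 0 <= bilf (invmx A) x x <= nrm2 x / c.
Proof.
move=> sA c0 cA x.
have psd v : 0 <= bilf A v v.
  by rewrite (le_trans _ (cA v)) // mulr_ge0 ?nrm2_ge0 // ltW.
have uA : A \in unitmx.
  rewrite -row_free_unit -kermx_eq0; apply/rowV0P => v /sub_kermxP vA.
  apply/eqP; apply: contraT => v0.
  have vT0 : v^T != 0 by rewrite -(inj_eq trmx_inj) trmxK trmx0.
  have := cA v^T; rewrite /bilf trmxK vA mul0mx mxE leNgt.
  by rewrite mulr_gt0 ?nrm2_gt0.
pose y := invmx A *m x.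
have xE : x = A *m y by rewrite /y mulKVmx.
have qE : bilf (invmx A) x x = (x^T *m y) 0 0 by rewrite /bilf -mulmxA.
have qE' : bilf (invmx A) x x = bilf A y y.
  by rewrite qE xE trmx_mul sA.
rewrite qE' psd /= ler_pdivlMr //.
set q := bilf A y y.
have q2 : q ^+ 2 <= nrm2 x * nrm2 y by rewrite /q -qE' qE dotmx_CS.
have [q0|q0] := eqVneq q 0; first by rewrite q0 mul0r nrm2_ge0.
have {}q0 : 0 < q by rewrite lt_neqAle eq_sym q0 psd.
rewrite -(ler_pM2l q0) mulrA -expr2.
rewrite (le_trans (_ : _ <= nrm2 x * nrm2 y * c)) ?ler_pM2r //.
by rewrite -mulrA [q * _]mulrC ler_wpM2l ?nrm2_ge0 // mulrC cA.
Qed.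

(** The submatrix is Q A Q' with Q Q' = 1, so v is sent to Q' v without change of norm. A lower
    bound at the largest dimension thus serves all smaller ones. *)
Lemma bilf_mxsub k m (A : 'M[R]_k) (f : 'I_m -> 'I_k) c : injective f ->
  (forall v, c * nrm2 v <= bilf A v v) ->
  forall v, c * nrm2 v <= bilf (mxsub f f A) v v.
Proof.
move=> injf cA v; pose Q := rowsub f (1%:M : 'M[R]_k).
have QA : mxsub f f A = Q *m A *m Q^T.
  rewrite /Q mul_rowsub_mx mul1mx; apply/matrixP => i j; rewrite !mxE.
  rewrite (bigD1 (f j)) //= !mxE eqxx mulr1 big1 ?addr0 // => l lj.
  by rewrite !mxE eq_sym (negbTE lj) mulr0.
have QQ : Q *m Q^T = 1%:M.
  apply/matrixP => i j; rewrite mul_rowsub_mx mul1mx !mxE.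
  by rewrite eq_sym (inj_eq injf).
have := cA (Q^T *m v).
rewrite /nrm2 /bilf trmx_mul trmxK QA !mulmxA.
by rewrite -[_ *m Q *m Q^T]mulmxA QQ mulmx1.
Qed.

End QuadraticForms.

(** * Third order Taylor bounds *)

Section Taylor.
Variable R : realType.
Implicit Types f g : R -> R.

Lemma is_derive1D f g (x a b : R) : is_derive x 1 f a -> is_derive x 1 g b ->
  is_derive x 1 (fun t : R => f t + g t) (a + b).
Proof. exact: is_deriveD. Qed.

Lemma is_derive1B f g (x a b : R) : is_derive x 1 f a -> is_derive x 1 g b ->
  is_derive x 1 (fun t : R => f t - g t) (a - b).
Proof. exact: is_deriveB. Qed.

Lemma is_derive1M f g (x a b : R) : is_derive x 1 f a -> is_derive x 1 g b ->
  is_derive x 1 (fun t : R => f t * g t) (a * g x + f x * b).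
Proof.
move=> fa gb; have := is_deriveM fa gb.
by rewrite /GRing.scale /= addrC [g x * a]mulrC.
Qed.

Lemma is_derive1_id (x : R) : is_derive x 1 (fun t : R => t) 1.
Proof. exact: is_derive_id. Qed.

Lemma is_derive1_cst (c x : R) : is_derive x 1 (fun _ : R => c) 0.
Proof. exact: is_derive_cst. Qed.

Lemma is_derive1Z c f (x a : R) : is_derive x 1 f a ->
  is_derive x 1 (fun t : R => c * f t) (c * a).
Proof.
by move=> fa; have := is_derive1M (is_derive1_cst c x) fa; rewrite mul0r add0r.
Qed.

Lemma increment_bound g (dg : R -> R) (C h : R) : (forall x : R, is_derive x 1 g (dg x)) ->
  (forall t, `|t| <= `|h| -> `|dg t| <= C) -> `|g h - g 0| <= C * `|h|.
Proof.
move=> dgP dgC.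
have cg (a b : R) : {within `[a, b], continuous g}.
  apply: continuous_subspaceT => x; apply: differentiable_continuous.
  by apply/derivable1_diffP; case: (dgP x).
have [h0|/ltW h0] := leP 0 h.
  have [c cI ->] := MVT_segment h0 (fun x _ => dgP x) (cg 0 h).
  rewrite subr0 normrM ler_wpM2r // dgC //.
  by move: cI; rewrite in_itv /= => /andP[c0 ch]; rewrite !ger0_norm.
have [c cI] := MVT_segment h0 (fun x _ => dgP x) (cg h 0).
rewrite distrC sub0r => ->; rewrite normrM normrN ler_wpM2r // dgC //.
by move: cI; rewrite in_itv /= => /andP[c0 ch]; rewrite !ler0_norm // lerN2.
Qed.

(** [increment_bound] is applied three times: to [f2], to [f1] minus its tangent, to [f] minus its
    second order expansion. Each application gains a factor |h|; the factor 1/6 of the sharp bound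
    is dropped, as only the order matters. *)
Lemma taylor3_bound f f1 f2 f3 (x h C : R) :
  (forall y : R, is_derive y 1 f (f1 y)) ->
  (forall y : R, is_derive y 1 f1 (f2 y)) ->
  (forall y : R, is_derive y 1 f2 (f3 y)) ->
  (forall t, `|t| <= `|h| -> `|f3 (x + t)| <= C) ->
  `|f (x + h) - f x - f1 x * h - f2 x * h ^+ 2 / 2| <= C * `|h| ^+ 3.
Proof.
move=> d1 d2 d3 C3.
have shiftd g (dg : R -> R) : (forall y : R, is_derive y 1 g (dg y)) ->
    forall t : R, is_derive t 1 (fun t => g (x + t)) (dg (x + t)).
  move=> dgP t; rewrite -[dg _]mulr1.
  have hx := is_derive1D (is_derive1_cst x t) (is_derive1_id t).
  have := is_derive1_comp (dgP (x + t)) hx.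
  by rewrite add0r.
have B2 t : `|t| <= `|h| -> `|f2 (x + t) - f2 x| <= C * `|t|.
  move=> th; have := @increment_bound _ _ C t (shiftd _ _ d3).
  by rewrite addr0; apply=> s st; exact/C3/(le_trans st).
have C0 : 0 <= C by rewrite (le_trans _ (C3 0 _)) // normr0.
have B1 t : `|t| <= `|h| -> `|f1 (x + t) - f1 x - f2 x * t| <= C * `|t| ^+ 2.
  move=> th; have := @increment_bound (fun t => f1 (x + t) - f2 x * t)
    (fun t => f2 (x + t) - f2 x) (C * `|t|) t.
  rewrite addr0 mulr0 subr0 expr2 mulrA addrAC; apply.
    move=> y; apply: is_derive1B (shiftd _ _ d2 y) _.
    by have := is_derive1Z (f2 x) (is_derive1_id y); rewrite mulr1.
  move=> s st; apply: le_trans (B2 s (le_trans st th)) _.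
  by rewrite ler_wpM2l.
have := @increment_bound (fun t => f (x + t) - f1 x * t - f2 x * t ^+ 2 / 2)
    (fun t => f1 (x + t) - f1 x - f2 x * t) (C * `|h| ^+ 2) h.
rewrite addr0 mulr0 subr0 expr0n mulr0 mul0r subr0.
rewrite (_ : f (x + h) - _ - _ - f x = f (x + h) - f x - f1 x * h - f2 x * h ^+ 2 / 2); last by ring.
rewrite -[C * `|h| ^+ 2 * `|h|]mulrA -exprSr; apply.
  move=> y; apply: is_derive1B.
    apply: is_derive1B (shiftd _ _ d1 y) _.
    by have := is_derive1Z (f1 x) (is_derive1_id y); rewrite mulr1.
  have := is_derive1Z (f2 x / 2) (is_derive1M (is_derive1_id y) (is_derive1_id y)).
  rewrite (_ : _ * (_ + _) = f2 x * y); last by field.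
  by congr is_derive; apply/funext => t; ring.
move=> s st; apply: le_trans (B1 s st) _.
by rewrite ler_wpM2l // lerXn2r ?nnegrE.
Qed.

(** This is the decreasing variant, going from 1 to 0, so that its rescalings approximate indicators
    of left half-lines. It satisfies L' = L^2 - L, hence all its derivatives are polynomials in L
    and bounded. *)
Definition logistic (x : R) : R := (1 + expR x)^-1.

Let den_gt0 x : 0 < 1 + expR x :> R.
Proof. by rewrite addr_gt0 ?expR_gt0. Qed.

Lemma logistic_gt0 x : 0 < logistic x.
Proof. by rewrite invr_gt0. Qed.

Lemma logistic_lt1 x : logistic x < 1.
Proof. by rewrite invf_lt1 // ltrDl expR_gt0. Qed.

Lemma logisticN x : logistic (- x) = 1 - logistic x.
Proof.
rewrite /logistic expRN; have e0 := expR_gt0 x.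
by field; rewrite !gt_eqF // ?addr_gt0.
Qed.

Lemma logistic_le x y : x <= y -> logistic y <= logistic x.
Proof. by move=> xy; rewrite lef_pV2 ?posrE // lerD2l ler_expR. Qed.

Lemma logistic_leV x : 0 < x -> logistic x <= x^-1.
Proof.
move=> x0; rewrite lef_pV2 ?posrE //.
by have /ltW := expR_gt1Dx (lt0r_neq0 x0); lra.
Qed.

Lemma is_derive_logistic (x : R) :
  is_derive x 1 logistic (logistic x ^+ 2 - logistic x).
Proof.
have dden : is_derive x 1 (fun x => 1 + expR x) (expR x).
  by have := is_derive1D (is_derive1_cst 1 x) (is_derive_expR x); rewrite add0r.
have := @is_deriveV R (fun y : R => 1 + expR y) _ _ _ (lt0r_neq0 (den_gt0 x)) dden.
rewrite (_ : _ *: _ = logistic x ^+ 2 - logistic x) //.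
by rewrite /logistic /GRing.scale /=; field; rewrite gt_eqF.
Qed.

(** The first three derivatives of [logistic], obtained by differentiating L' = L^2 - L
    repeatedly. *)
Definition logistic1 x := logistic x * logistic x - logistic x.
Definition logistic2 x := (2 * logistic x - 1) * logistic1 x.
Definition logistic3 x :=
  2 * logistic1 x * logistic1 x + (2 * logistic x - 1) * logistic2 x.

Lemma logistic1_bound x : `|logistic1 x| <= 1.
Proof.
have := logistic_gt0 x; have := logistic_lt1 x; rewrite /logistic1.
by rewrite ler_norml; nra.
Qed.

Lemma logistic2_bound x : `|logistic2 x| <= 1.
Proof.
rewrite normrM -[leRHS]mulr1 ler_pM ?logistic1_bound //.
by have := logistic_gt0 x; have := logistic_lt1 x; rewrite ler_norml; lra.
Qed.

Lemma logistic3_bound x : `|logistic3 x| <= 3.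
Proof.
rewrite (le_trans (ler_normD _ _)) // (natrD _ 2 1) lerD //.
  rewrite !normrM ger0_norm // -mulrA ler_piMr //.
  by rewrite mulr_ile1 ?logistic1_bound.
rewrite normrM -[leRHS]mulr1 ler_pM ?logistic2_bound //.
by have := logistic_gt0 x; have := logistic_lt1 x; rewrite ler_norml; lra.
Qed.

Lemma is_derive_logistic1 (x : R) : is_derive x 1 (@logistic1) (logistic2 x).
Proof.
have dl := is_derive_logistic x.
have := is_derive1B (is_derive1M dl dl) dl.
rewrite (_ : _ - _ = logistic2 x) // /logistic2 /logistic1; ring.
Qed.

Lemma is_derive_logistic2 (x : R) : is_derive x 1 (@logistic2) (logistic3 x).
Proof.
have dl := is_derive_logistic x.
have dl2 := is_derive1B (is_derive1Z 2 dl) (is_derive1_cst 1 x).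
have := is_derive1M dl2 (is_derive_logistic1 x).
rewrite (_ : _ + _ = logistic3 x) // /logistic3 /logistic1; ring.
Qed.

Lemma taylor_logistic x h :
  `|logistic (x + h) - logistic x - logistic1 x * h - logistic2 x * h ^+ 2 / 2|
  <= 3 * `|h| ^+ 3.
Proof.
apply: (@taylor3_bound logistic logistic1 logistic2 logistic3 x h 3).
- by move=> y; rewrite /logistic1 -expr2; exact: is_derive_logistic.
- exact: is_derive_logistic1.
- exact: is_derive_logistic2.
- by move=> t _; exact: logistic3_bound.
Qed.

End Taylor.

(** * Averaging operators *)

Section Averaging.
Variable R : realType.
Implicit Types f g : R -> R.

Definition bmeas f :=
  measurable_fun [set: R] f /\ exists B : R, forall x, `|f x| <= B.

Lemma measurable_shift (x : R) : measurable_fun [set: R] (fun y : R => x + y).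
Proof. exact: measurable_funD. Qed.

Lemma bmeas_integrable (mu : probability (measurableTypeR R) R) f : bmeas f ->
  mu.-integrable setT (EFin \o f).
Proof.
move=> [mf [B fB]].
apply: (@le_integrable _ _ _ mu setT measurableT _ (EFin \o cst B)).
- exact/measurable_EFinP.
- by move=> x _ /=; rewrite lee_fin (le_trans (fB x)) // ler_norm.
- exact: finite_measure_integrable_cst.
Qed.

Lemma bmeas_shift f x : bmeas f -> bmeas (fun y => f (x + y)).
Proof.
move=> [mf [B fB]]; split; last by exists B.
exact: (measurableT_comp mf (measurable_shift x)).
Qed.

Definition avg (mu : probability (measurableTypeR R) R) f (x : R) : R := \int[mu]_y f (x + y).

Lemma avg_bound mu f B x : measurable_fun setT f -> (forall y, `|f y| <= B) ->
  `|avg mu f x| <= B.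
Proof.
move=> mf fB; have bf : bmeas f by split=> //; exists B.
have i1 := bmeas_integrable mu (bmeas_shift x bf).
apply: le_trans (le_normr_Rintegral measurableT i1) _.
have := @Rintegral_cst _ _ R mu setT measurableT B.
rewrite /= probability_setT mulr1 => <-.
apply: le_Rintegral => //.
- exact: integrable_abse i1.
- exact: finite_measure_integrable_cst.
Qed.

Lemma integrable_cst_prod d1 d2 (T1 : measurableType d1)
    (T2 : measurableType d2) (mu : probability T1 R) (nu : probability T2 R)
    (B : R) : (mu \x nu)%E.-integrable setT (EFin \o cst B).
Proof.
apply/integrableP; split; first exact/measurable_EFinP.
have prod1 : (mu \x nu)%E [set: T1 * T2] = 1%E.
  by rewrite -setXTT product_measure1E // -[RHS]mule1 -{1}(probability_setT mu) -(probability_setT nu).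
rewrite /= integral_cst //.
change (`|B|%:E * (mu \x nu)%E [set: T1 * T2] < +oo)%E.
by rewrite prod1 mule1 ltry.
Qed.

Lemma bmeas_avg mu f : bmeas f -> bmeas (avg mu f).
Proof.
move=> [mf [B fB]]; split; last by exists B => x; exact: avg_bound.
apply: measurableT_comp => //=.
have mF : measurable_fun setT (fun p : R * R => (f (p.1 + p.2))%:E).
  apply/measurable_EFinP; apply: measurableT_comp => //.
  exact: measurable_funD.
apply: (@measurable_fubini_F _ _ _ _ R mu mu (fun p : R * R => (f (p.1 + p.2))%:E)).
apply: (@le_integrable _ _ _ _ setT measurableT _ (EFin \o cst B)).
- by [].
- by move=> x _ /=; rewrite lee_fin (le_trans (fB _)) // ler_norm.
- exact: integrable_cst_prod.
Qed.

Lemma avgB mu f g x : bmeas f -> bmeas g ->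
  avg mu (fun y => f y - g y) x = avg mu f x - avg mu g x.
Proof.
move=> bf bg; rewrite /avg RintegralB //.
- exact: bmeas_integrable (bmeas_shift x bf).
- exact: bmeas_integrable (bmeas_shift x bg).
Qed.

(** [f1] and [f2] play the part of derivatives, but only the expansion with a uniform constant is
    asked for. Unlike differentiability, this passes through averaging by linearity of the integral,
    and with the same [C]. *)
Definition taylor3 C f := exists f1 f2 : R -> R,
  [/\ bmeas f, bmeas f1, bmeas f2 & forall x h,
    `|f (x + h) - f x - f1 x * h - f2 x * h ^+ 2 / 2| <= C * `|h| ^+ 3].

Lemma taylor3_bmeas C f : taylor3 C f -> bmeas f.
Proof. by case=> [? [? []]]. Qed.

Lemma taylor3_avg mu C f : taylor3 C f -> taylor3 C (avg mu f).
Proof.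
move=> [f1 [f2 [bf b1 b2 fC]]]; exists (avg mu f1), (avg mu f2).
split; try exact: bmeas_avg.
move=> x h.
pose g y := f (y + h) - f y - f1 y * h - f2 y * h ^+ 2 / 2.
have bfh : bmeas (fun y => f (y + h)).
  by under eq_fun do rewrite addrC; exact: bmeas_shift.
have bZ c k : bmeas k -> bmeas (fun y => k y * c).
  move=> [mk [B kB]]; split; first exact: measurable_funM.
  by exists (B * `|c|) => y; rewrite normrM ler_wpM2r.
have bB k l : bmeas k -> bmeas l -> bmeas (fun y => k y - l y).
  move=> [mk [B kB]] [ml [B' lB]]; split; first exact: measurable_funB.
  by exists (B + B') => y; rewrite (le_trans (ler_normB _ _)) // lerD.
have avgZ c k : bmeas k -> avg mu (fun y => k y * c) x = avg mu k x * c.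
  move=> bk; rewrite /avg RintegralZr //.
  exact: bmeas_integrable (bmeas_shift x bk).
have -> : avg mu f (x + h) - avg mu f x - avg mu f1 x * h
    - avg mu f2 x * h ^+ 2 / 2 = avg mu g x.
  rewrite /g avgB; [|by do 2?apply: (bB); try exact: (bZ)|].
  - rewrite avgB; [|exact: bB|exact: bZ].
    rewrite avgB // avgZ //.
    rewrite [in RHS](_ : (fun y => f2 y * h ^+ 2 / 2) = (fun y => f2 y * (h ^+ 2 / 2))); last first.
      by apply/funext => y; rewrite mulrA.
    rewrite avgZ // mulrA; congr (_ - _ - _ - _).
    by rewrite /avg; apply: eq_Rintegral => y _; rewrite addrAC.
  - by under eq_fun do rewrite -mulrA; exact: bZ.
apply: avg_bound => [|y]; last exact: fC.
have [] : bmeas g; last by [].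
rewrite /g; apply: (bB); first by do 2?apply: (bB); try exact: (bZ).
by under eq_fun do rewrite -mulrA; exact: bZ.
Qed.

Definition moments3 (mu : probability (measurableTypeR R) R) (v K : R) :=
  [/\ mu.-integrable setT (EFin \o (fun y : R => y)),
      mu.-integrable setT (EFin \o (fun y : R => y ^+ 2)) &
      mu.-integrable setT (EFin \o (fun y : R => `|y| ^+ 3))] /\
  [/\ \int[mu]_y y = 0, \int[mu]_y (y ^+ 2) = v &
      \int[mu]_y (`|y| ^+ 3) <= K].

(** The expansion is integrated in its increment: the linear term vanishes with the mean, and the
    quadratic one depends on the law through [v] only, so it cancels between two laws of equal
    variance. *)
Lemma avg_taylor (mu : probability (measurableTypeR R) R) C f f1 f2 x v K : 0 <= C ->
  bmeas f ->
  (forall x h,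
    `|f (x + h) - f x - f1 x * h - f2 x * h ^+ 2 / 2| <= C * `|h| ^+ 3) ->
  moments3 mu v K ->
  `|avg mu f x - f x - f2 x * v / 2| <= C * K.
Proof.
move=> C0 bf fC [[i1 i2 i3] [m1 m2 m3]].
have i0 : mu.-integrable setT (EFin \o (fun y : R => f (x + y))).
  exact: bmeas_integrable (bmeas_shift x bf).
have ic : mu.-integrable setT (EFin \o (fun y : R => f x)).
  exact: finite_measure_integrable_cst.
have iZ c g : mu.-integrable setT (EFin \o g) ->
    mu.-integrable setT (EFin \o (fun y : R => c * g y)).
  move=> ig; have := integrableZl measurableT c ig.
  by apply: eq_integrable => // y _ /=; rewrite EFinM.
have iB g g' : mu.-integrable setT (EFin \o g) ->
    mu.-integrable setT (EFin \o g') ->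
    mu.-integrable setT (EFin \o (fun y : R => g y - g' y)).
  move=> ig ig'; have := integrableB measurableT ig ig'.
  by apply: eq_integrable => // y _ /=; rewrite EFinB.
pose g y := f (x + y) - f x - f1 x * y - f2 x / 2 * y ^+ 2.
have ig : mu.-integrable setT (EFin \o g).
  by apply: (iB); [apply: (iB); [exact: iB|exact: iZ]|exact: iZ].
have -> : avg mu f x - f x - f2 x * v / 2 = \int[mu]_y g y.
  rewrite /g RintegralB //; last 2 first.
  - by apply: (iB); [exact: iB|exact: iZ].
  - exact: iZ.
  rewrite RintegralB //; [|exact: iB|exact: iZ].
  rewrite RintegralB // !RintegralZl // m1 m2 mulr0 subr0 mulrAC.
  by rewrite (@Rintegral_cst _ _ R mu setT measurableT) /= probability_setT mulr1.
apply: le_trans (le_normr_Rintegral measurableT ig) _.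
apply: (@le_trans _ _ (C * \int[mu]_y (`|y| ^+ 3))); last exact: ler_wpM2l.
rewrite -RintegralZl //; apply: le_Rintegral => //.
- exact: integrable_abse ig.
- exact: iZ.
- by move=> y _; rewrite /g (mulrAC _ 2^-1); exact: fC.
Qed.

Lemma avg_diff (mu nu : probability (measurableTypeR R) R) C f x v K K' : 0 <= C ->
  taylor3 C f -> moments3 mu v K -> moments3 nu v K' ->
  `|avg mu f x - avg nu f x| <= C * (K + K').
Proof.
move=> C0 [f1 [f2 [bf _ _ fC]]] mmu mnu.
have H1 := avg_taylor x C0 bf fC mmu; have H2 := avg_taylor x C0 bf fC mnu.
rewrite mulrDr; apply: le_trans (lerD H1 H2).
rewrite -[X in _ <= _ + X]normrN; apply: le_trans (ler_normD _ _).
by rewrite le_eqVlt; apply/orP; left; apply/eqP; congr `|_|; ring.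
Qed.

Lemma taylor3_iter mu C n f : taylor3 C f -> taylor3 C (iter n (avg mu) f).
Proof. by move=> tf; elim: n => //= n; exact: taylor3_avg. Qed.

(** Telescoping: write A and B for the two averagings, then A A^n - B B^n = A (A^n - B^n) + (A - B)
    B^n. Averaging does not increase the sup norm, and B^n f stays in the class with constant [C],
    so each step costs [C * (K + K')]. *)
Lemma iter_avg_diff (mu nu : probability (measurableTypeR R) R) C f v K K' n x : 0 <= C ->
  taylor3 C f -> moments3 mu v K -> moments3 nu v K' ->
  `|iter n (avg mu) f x - iter n (avg nu) f x| <= n%:R * (C * (K + K')).
Proof.
move=> C0 tf mmu mnu; elim: n x => [|n IH] x /=.
  by rewrite subrr normr0 mul0r.
set fm := iter n _ f; set fn := iter n (avg nu) f.
have bm : bmeas fm := taylor3_bmeas (taylor3_iter mu n tf).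
have bn : bmeas fn := taylor3_bmeas (taylor3_iter nu n tf).
rewrite -natr1 mulrDl mul1r.
apply: (@le_trans _ _ (`|avg mu fm x - avg mu fn x| + `|avg mu fn x - avg nu fn x|)).
  by apply: le_trans (ler_normD _ _); rewrite addrA subrK.
rewrite lerD //; last exact: avg_diff (taylor3_iter _ _ tf) mmu mnu.
rewrite -avgB //; apply: avg_bound => [|y]; last exact: IH.
by apply: measurable_funB; [case: bm|case: bn].
Qed.

Lemma taylor3_scale C f k b : taylor3 C f ->
  taylor3 (C * `|k| ^+ 3) (fun x => f (k * x + b)).
Proof.
move=> [f1 [f2 [bf b1 b2 fC]]].
exists (fun x => k * f1 (k * x + b)), (fun x => k ^+ 2 * f2 (k * x + b)).
have bs g : bmeas g -> bmeas (fun x => g (k * x + b)).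
  move=> [mg [B gB]]; split; last by exists B.
  by apply: (measurableT_comp mg); apply: measurable_funD.
have bZ c g : bmeas g -> bmeas (fun x => c * g x).
  move=> [mg [B gB]]; split; first exact: measurable_funM.
  by exists (`|c| * B) => y; rewrite normrM ler_wpM2l.
split; [exact: bs|exact/bZ/bs|exact/bZ/bs|move=> x h].
have -> : k * (x + h) + b = k * x + b + k * h by ring.
set y := k * x + b.
have -> : k * f1 y * h = f1 y * (k * h) by ring.
have -> : k ^+ 2 * f2 y * h ^+ 2 = f2 y * (k * h) ^+ 2 by ring.
by rewrite -[C * _ * _]mulrA -exprMn -normrM.
Qed.

Lemma taylor3_logistic : taylor3 3 (@logistic R).
Proof.
exists (@logistic1 R), (@logistic2 R).
have cm g : (forall x : R, exists a, is_derive x 1 g a) ->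
    measurable_fun setT (g : R -> R).
  move=> dg; apply: continuous_measurable_fun => x.
  apply: differentiable_continuous; apply/derivable1_diffP.
  by have [a []] := dg x.
split; last exact: taylor_logistic.
- split; first by apply: cm => x; eexists; exact: is_derive_logistic.
  exists 1 => x; rewrite ger0_norm ?ltW ?logistic_gt0 ?logistic_lt1 //.
- split; first by apply: cm => x; eexists; exact: is_derive_logistic1.
  by exists 1 => x; exact: logistic1_bound.
- split; first by apply: cm => x; eexists; exact: is_derive_logistic2.
  by exists 1 => x; exact: logistic2_bound.
Qed.

End Averaging.

(** * Moments of the normal law *)

Section Normal.
Variable R : realType.
Local Notation mu := (@lebesgue_measure R).

(** Change of variables holds for the Radon-Nikodym derivative, which agrees almost everywhere with
    the density because both have the same integral over every measurable set. *)
Lemma ge0_integral_normal_prob (m s : R) (f : R -> \bar R) :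
  measurable_fun setT f -> (forall x, 0 <= f x)%E ->
  (\int[normal_prob m s]_x f x = \int[mu]_x (f x * (normal_pdf m s x)%:E))%E.
Proof.
move=> mf f0; have dom := @normal_prob_dominates R m s.
rewrite -(Radon_Nikodym_SigmaFinite.change_of_variables dom) //.
pose g := Radon_Nikodym_SigmaFinite.f (normal_prob m s) mu.
have ig : mu.-integrable setT g by exact: Radon_Nikodym_SigmaFinite.f_integrable.
have mp : measurable_fun setT (fun x => (normal_pdf m s x)%:E).
  by apply/measurable_EFinP; exact: measurable_normal_pdf.
apply: ae_eq_integral => //.
- by apply: emeasurable_funM => //; exact: measurable_int ig.
- exact: emeasurable_funM.
- apply: ae_eqe_mul2l; apply: integral_ae_eq => //.
  by move=> E _ mE; rewrite -Radon_Nikodym_SigmaFinite.f_integral.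
Qed.

Lemma normal_pdfE0 (m s x : R) : s != 0 ->
  normal_pdf m s x = normal_peak s * expR (- (x - m) ^+ 2 / (s ^+ 2 *+ 2)).
Proof. by move=> s0; rewrite normal_pdfE. Qed.

(** Completing the square turns expR (h x) times the centred density into the constant on the right
    times the density with mean [s ^+ 2 * h], whose integral is 1. *)
Lemma normal_mgf (s h : R) : s != 0 ->
  (\int[normal_prob 0 s]_x (expR (h * x))%:E = (expR (s ^+ 2 * h ^+ 2 / 2))%:E)%E.
Proof.
move=> s0; rewrite ge0_integral_normal_prob; last first.
- by move=> x; rewrite lee_fin expR_ge0.
- by apply/measurable_EFinP; apply: measurableT_comp => //; exact: measurable_funM.
transitivity (\int[mu]_x ((expR (s ^+ 2 * h ^+ 2 / 2))%:E *
    (normal_pdf (s ^+ 2 * h) s x)%:E))%E.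
  apply: eq_integral => x _; rewrite -!EFinM; congr EFin.
  rewrite !normal_pdfE0 // mulrCA [RHS]mulrCA -!expRD; congr (_ * expR _).
  by field.
rewrite ge0_integralZl ?lee_fin ?expR_ge0 //.
- by rewrite integral_normal_pdf mule1.
- by apply/measurable_EFinP; exact: measurable_normal_pdf.
- by move=> x _; rewrite lee_fin normal_pdf_ge0.
Qed.

Lemma expR_normr_le (x : R) : expR `|x| <= expR x + expR (- x).
Proof. by case: (ger0P x) => _; rewrite ?lerDl ?lerDr expR_ge0. Qed.

(** The inequality 1 + y <= expR y at y = |x| / n.+1, raised to the power n.+1. With exponent 3 the
    constant is 27, which recurs below. *)
Lemma normrX_le_expR (x : R) n : `|x| ^+ n.+1 <= n.+1%:R ^+ n.+1 * expR `|x|.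
Proof.
have -> : expR `|x| = expR (`|x| / n.+1%:R) ^+ n.+1.
  by rewrite -expRM_natl mulrC divfK // pnatr_eq0.
rewrite -exprMn lerXn2r ?nnegrE ?mulr_ge0 ?expR_ge0 //.
rewrite -ler_pdivrMl // mulrC.
by apply: le_trans (expR_ge1Dx _); rewrite lerDr.
Qed.

(** The values at [h] and [- h] separate the even part from the odd one: |p| <= K h and |q| <= K
    h^2, for all small h > 0. This identifies coefficients of two expansions of the same function
    without differentiating it. *)
Lemma little_quadratic (p q K : R) :
  (forall h : R, `|h| <= 1 -> `|h ^+ 2 * p - h * q| <= K * `|h| ^+ 3) ->
  p = 0 /\ q = 0.
Proof.
move=> H.
have K0 : 0 <= K.
  by have := H 1; rewrite normr1 !expr1n mulr1 => /(_ (lexx _)); exact: le_trans.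
have Hp h : 0 < h -> h <= 1 -> `|p| <= K * h /\ `|q| <= K * h.
  move=> h0 h1; have := H h; have := H (- h).
  rewrite normrN (gtr0_norm h0) => /(_ h1) A /(_ h1) B.
  split.
    have h20 : 0 < h ^+ 2 by rewrite exprn_gt0.
    rewrite -(ler_pM2l h20) -{1}(gtr0_norm h20) -normrM.
    rewrite (_ : h ^+ 2 * (K * h) = (K * h ^+ 3 + K * h ^+ 3) / 2); last by field.
    rewrite ler_pdivlMr //; apply: le_trans (lerD A B).
    apply: le_trans (ler_normD _ _); rewrite -[X in _ * X](@gtr0_norm _ 2) // -normrM.
    by rewrite le_eqVlt; apply/orP; left; apply/eqP; congr `|_|; ring.
  rewrite -(ler_pM2l h0) -{1}(gtr0_norm h0) -normrM.
  apply: (@le_trans _ _ ((K * h ^+ 3 + K * h ^+ 3) / 2)).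
    rewrite ler_pdivlMr //; rewrite -normrN in B; apply: le_trans (lerD A B).
    apply: le_trans (ler_normD _ _); rewrite -[X in _ * X](@gtr0_norm _ 2) // -normrM.
    by rewrite le_eqVlt; apply/orP; left; apply/eqP; congr `|_|; ring.
  rewrite (_ : _ / 2 = h * (K * h) * h); last by field.
  by rewrite ler_piMr // !mulr_ge0 // ltW.
have z (c : R) : (forall h : R, 0 < h -> h <= 1 -> `|c| <= K * h) -> c = 0.
  move=> Hc; apply/eqP; rewrite -normr_le0; apply/ler_addgt0Pl => e e0.
  rewrite addr0; pose h := Num.min 1 (e / (K + 1)).
  have K1 : 0 < K + 1 by rewrite ltr_wpDl.
  have h0 : 0 < h by rewrite lt_min ltr01 divr_gt0.
  have h1 : h <= 1 by rewrite ge_min lexx.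
  apply: le_trans (Hc h h0 h1) _.
  apply: (@le_trans _ _ (K * (e / (K + 1)))).
    by rewrite ler_wpM2l // ge_min lexx orbT.
  by rewrite mulrCA ger_pMr // ler_pdivrMr // mul1r lerDl.
by split; apply: z => h h0 h1; case: (Hp h h0 h1).
Qed.

Section Moments.
Variable s : R.
Hypothesis s0 : 0 < s.
Let g := normal_prob 0 s.

Let integrable_exp h : g.-integrable setT (EFin \o (fun x : R => expR (h * x))).
Proof.
apply/integrableP; split.
  apply/measurable_EFinP; apply: measurableT_comp => //; exact: measurable_funM.
under eq_integral do rewrite /= ger0_norm ?expR_ge0 //.
by rewrite normal_mgf ?gt_eqF // ltry.
Qed.

(** This is 2 c times the hyperbolic cosine of [h * x]: an even majorant for powers and exponentials
    of |x| whose normal integral is explicit. *)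
Let cosh c h (x : R) := c * (expR (h * x) + expR (- h * x)).

Let integrable_cosh c h : g.-integrable setT (EFin \o cosh c h).
Proof.
have := integrableZl measurableT c (integrableD measurableT (integrable_exp h) (integrable_exp (- h))).
by apply: eq_integrable => // x _ /=; rewrite EFinM EFinD.
Qed.

Let Rintegral_cosh c h : \int[g]_x cosh c h x = c * (2 * expR (s ^+ 2 * h ^+ 2 / 2)).
Proof.
rewrite RintegralZl //; last first.
  have := integrable_cosh 1 h.
  by apply: eq_integrable => // x _ /=; rewrite /cosh mul1r.
rewrite RintegralD // /Rintegral !normal_mgf ?gt_eqF //= sqrrN.
by rewrite mulr2n mulrDl mul1r.
Qed.

Let integrable_le_cosh (f : R -> R) c h : measurable_fun setT f ->
  (forall x, `|f x| <= cosh c h x) -> g.-integrable setT (EFin \o f).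
Proof.
move=> mf fc; apply: le_integrable (integrable_cosh c h) => //.
  exact/measurable_EFinP.
by move=> x _ /=; rewrite lee_fin (le_trans (fc x)) // ler_norm.
Qed.

Let integrable_normX n : g.-integrable setT (EFin \o (fun x : R => `|x| ^+ n.+1)).
Proof.
apply: (@integrable_le_cosh _ (n.+1%:R ^+ n.+1) 1).
  by apply: measurable_funX; exact: normr_measurable.
move=> x; rewrite normrX normr_id /cosh mulN1r mul1r.
apply: le_trans (normrX_le_expR _ _) _.
by rewrite ler_wpM2l ?exprn_ge0 // expR_normr_le.
Qed.

Let integrable_X n : g.-integrable setT (EFin \o (fun x : R => x ^+ n.+1)).
Proof.
apply: le_integrable (integrable_normX n) => //.
  by apply/measurable_EFinP; exact: measurable_funX.
by move=> x _ /=; rewrite !normrX normr_id.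
Qed.

Let m1 := \int[g]_x x.
Let m2 := \int[g]_x (x ^+ 2).

Let expR_taylor (u : R) :
  `|expR u - 1 - u - u ^+ 2 / 2| <= expR `|u| * `|u| ^+ 3.
Proof.
have := @taylor3_bound R expR expR expR expR 0 u (expR `|u|)
  (@is_derive_expR R) (@is_derive_expR R) (@is_derive_expR R).
rewrite add0r expR0 !mul1r; apply => t tu.
by rewrite add0r ger0_norm ?expR_ge0 // ler_expR (le_trans (ler_norm _)).
Qed.

(** The function E = expR (s^2 h^2 / 2) of h is expanded twice: as the integral of expR (h y), which
    brings in [m1] and [m2], and directly as an exponential. The difference of the two expansions is
    of order |h|^3. *)
Let quadratic_bound : exists K, forall h : R, `|h| <= 1 ->
  `|h ^+ 2 * ((s ^+ 2 - m2) / 2) - h * m1| <= K * `|h| ^+ 3.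
Proof.
(* For |h| <= 1 the remainder expR |h y| |h y|^3 is at most 27 |h|^3 expR (2 |y|), hence at most 27
   |h|^3 (expR (2 y) + expR (- 2 y)), whose integral is [K1 * |h| ^+ 3]. [K2] comes from the
   remainder at u = s^2 h^2 / 2, together with u^2 / 2, powers of |h| above 3 being lowered to 3. *)
pose K1 := 27 * (2 * expR (s ^+ 2 * 2 ^+ 2 / 2)).
pose K2 := expR (s ^+ 2 / 2) * (s ^+ 2 / 2) ^+ 3 + (s ^+ 2 / 2) ^+ 2 / 2.
exists (K1 + K2) => h h1.
have s20 : 0 <= s ^+ 2 / 2 by rewrite divr_ge0 // sqr_ge0.
pose E := expR (s ^+ 2 * h ^+ 2 / 2).
have H1 : `|E - 1 - h * m1 - h ^+ 2 / 2 * m2| <= K1 * `|h| ^+ 3.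
  pose f (y : R) := expR (h * y) - 1 - h * y - h ^+ 2 / 2 * y ^+ 2.
  have ie := integrable_exp h.
  have ic : g.-integrable setT (EFin \o (fun=> 1 : R)).
    exact: finite_measure_integrable_cst.
  have iZ c k : g.-integrable setT (EFin \o k) ->
      g.-integrable setT (EFin \o (fun y : R => c * k y)).
    move=> ig; have := integrableZl measurableT c ig.
    by apply: eq_integrable => // y _ /=; rewrite EFinM.
  have iB k k' : g.-integrable setT (EFin \o k) ->
      g.-integrable setT (EFin \o k') ->
      g.-integrable setT (EFin \o (fun y : R => k y - k' y)).
    move=> ig ig'; have := integrableB measurableT ig ig'.
    by apply: eq_integrable => // y _ /=; rewrite EFinB.
  have i1 : g.-integrable setT (EFin \o (fun y : R => y)) by exact: (integrable_X 0).
  have i2 := integrable_X 1.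
  have if_ : g.-integrable setT (EFin \o f).
    by apply: (iB); [apply: (iB); [exact: iB|exact: iZ]|exact: iZ].
  have -> : E - 1 - h * m1 - h ^+ 2 / 2 * m2 = \int[g]_y f y.
    rewrite /f RintegralB //; last 2 first.
    - by apply: (iB); [exact: iB|exact: iZ].
    - exact: iZ.
    rewrite RintegralB //; [|exact: iB|exact: iZ].
    rewrite RintegralB // !RintegralZl //.
    rewrite (@Rintegral_cst _ _ R g setT measurableT) /= probability_setT mulr1.
    by rewrite {1}/Rintegral normal_mgf ?gt_eqF.
  apply: le_trans (le_normr_Rintegral measurableT if_) _.
  have -> : K1 * `|h| ^+ 3 = \int[g]_y (cosh (27 * `|h| ^+ 3) 2 y).
    by rewrite Rintegral_cosh /K1 mulrAC.
  apply: le_Rintegral => //; first exact: integrable_abse if_.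
  move=> y _.
  have := expR_taylor (h * y); rewrite /f exprMn (mulrAC (h ^+ 2)) => /le_trans; apply.
  have hy : `|h * y| <= `|y| by rewrite normrM ler_piMl.
  rewrite [X in _ * X](_ : _ = `|h| ^+ 3 * `|y| ^+ 3); last by rewrite normrM exprMn.
  rewrite mulrCA /cosh [27 * _]mulrC -[_ * 27 * _]mulrA ler_wpM2l ?exprn_ge0 //.
  apply: (@le_trans _ _ (expR `|y| * (3%:R ^+ 3 * expR `|y|))).
    by rewrite ler_pM ?expR_ge0 ?exprn_ge0 ?ler_expR // normrX_le_expR.
  rewrite mulrCA -expRD (_ : 3%:R ^+ 3 = 27 :> R); last by ring.
  rewrite ler_wpM2l // mulNr; apply: le_trans (expR_normr_le _).
  by rewrite ler_expR normrM ger0_norm // mulr2n mulrDl mul1r.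
have H2 : `|E - 1 - s ^+ 2 * h ^+ 2 / 2| <= K2 * `|h| ^+ 3.
  pose u := s ^+ 2 / 2 * h ^+ 2.
  have uE : s ^+ 2 * h ^+ 2 / 2 = u by rewrite /u mulrAC.
  have u0 : 0 <= u by rewrite mulr_ge0 // sqr_ge0.
  have hn k : (3 <= k)%N -> `|h| ^+ k <= `|h| ^+ 3 by move=> k3; exact: ler_wiXn2l.
  have us : u <= s ^+ 2 / 2 by rewrite ler_piMr // -real_normK ?num_real // exprn_ile1.
  rewrite /E uE (_ : expR u - 1 - u = (expR u - 1 - u - u ^+ 2 / 2) + u ^+ 2 / 2); last by rewrite subrK.
  apply: le_trans (ler_normD _ _) _; rewrite mulrDl lerD //.
    apply: le_trans (expR_taylor u) _; rewrite ger0_norm // -mulrA ler_pM ?expR_ge0 ?exprn_ge0 //.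
      by rewrite ler_expR.
    rewrite /u exprMn ler_wpM2l ?exprn_ge0 //.
    by rewrite -[h ^+ 2]real_normK ?num_real // -exprM hn.
  rewrite ger0_norm ?divr_ge0 ?sqr_ge0 // [leRHS]mulrAC ler_pM2r ?invr_gt0 //.
  rewrite /u exprMn ler_wpM2l ?exprn_ge0 //.
  by rewrite -[h ^+ 2]real_normK ?num_real // -exprM hn.
rewrite [leRHS]mulrDl; apply: le_trans (lerD H1 H2).
rewrite -[X in _ <= _ + X]normrN; apply: le_trans (ler_normD _ _).
by rewrite le_eqVlt; apply/orP; left; apply/eqP; congr `|_|; field.
Qed.

(** Comparing expansions gives mean 0 and variance [s ^+ 2]. For the third moment, |y|^3 = s^3 |y /
    s|^3 <= 27 s^3 (expR (y / s) + expR (- y / s)), and the right side integrates to 27 * 2 * expR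
    (1 / 2) * s^3. The cubic scaling in [s] is what makes the accumulated error of n steps of
    variance 1/n vanish. *)
Lemma normal_moments3 : moments3 g (s ^+ 2) (54 * expR (1 / 2) * s ^+ 3).
Proof.
have [K HK] := quadratic_bound.
have [/eqP M2 M1] := little_quadratic HK.
split; split.
- exact: (integrable_X 0).
- exact: (integrable_X 1).
- exact: (integrable_normX 2).
- exact: M1.
- by move: M2; rewrite mulf_eq0 invr_eq0 pnatr_eq0 orbF subr_eq0 => /eqP.
have -> : 54 * expR (1 / 2) * s ^+ 3 = \int[g]_y (cosh (27 * s ^+ 3) s^-1 y).
  rewrite Rintegral_cosh exprVn mulfV ?expf_neq0 ?gt_eqF //; ring.
apply: le_Rintegral; [by []|exact: (integrable_normX 2)|exact: integrable_cosh|].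
move=> y _.
have -> : `|y| ^+ 3 = s ^+ 3 * `|s^-1 * y| ^+ 3.
  by rewrite -[X in X ^+ 3 * _]gtr0_norm // -exprMn -normrM mulVKf ?gt_eqF.
rewrite /cosh (_ : 27 * s ^+ 3 = s ^+ 3 * 3%:R ^+ 3); last by ring.
rewrite -mulrA ler_wpM2l ?(exprn_ge0 _ (ltW s0)) // mulNr.
apply: le_trans (normrX_le_expR _ _) _.
by rewrite ler_wpM2l ?exprn_ge0 // expR_normr_le.
Qed.

End Moments.

End Normal.

(** * Convolution of normal laws *)

Section Convolution.
Variable R : realType.
Local Notation mu := (@lebesgue_measure R).

(** Substitution along the increasing map x + c, of derivative 1; the substitution formula is the
    reason for asking continuity. *)
Lemma ge0_integral_shift (f : R -> R) (c : R) : continuous f ->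
  (forall x, 0 <= f x) ->
  (\int[mu]_x (f (x + c))%:E = \int[mu]_x (f x)%:E)%E.
Proof.
move=> cf f0; pose F (x : R^o) := x + c.
have F'E : F^`()%classic = cst 1.
  apply/funext => x; rewrite /F derive1E deriveD // derive_id derive_cst addr0 //.
rewrite [RHS](@increasing_ge0_integration_by_substitutionT R F f) //.
- by apply: eq_integral => x _; rewrite F'E /= mulr1.
- by move=> x y xy; rewrite /F ltrD2r.
- by rewrite F'E => ?; exact: cvg_cst.
- by rewrite F'E; exact: is_cvg_cst.
- by rewrite F'E; exact: is_cvg_cst.
- exact: cvg_addrr_Ny.
- exact: cvg_addrr.
Qed.

(* Completing the square in y. *)
Lemma normal_pdf_mul (a b w y : R) : 0 < a -> 0 < b ->
  normal_pdf 0 (Num.sqrt b) (w - y) * normal_pdf 0 (Num.sqrt a) y =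
  normal_pdf 0 (Num.sqrt (a + b)) w *
  normal_pdf (a / (a + b) * w) (Num.sqrt (a * b / (a + b))) y.
Proof.
move=> a0 b0; have ab0 : 0 < a + b by rewrite addr_gt0.
have c0 : 0 < a * b / (a + b) by rewrite divr_gt0 // mulr_gt0.
rewrite !normal_pdfE0 ?gt_eqF ?sqrtr_gt0 //.
rewrite !sqr_sqrtr ?ltW // /normal_peak !sqr_sqrtr ?ltW //.
rewrite mulrACA [RHS]mulrACA -!expRD; congr (_ * expR _); last first.
  by field; rewrite !gt_eqF.
rewrite -!invfM -!sqrtrM; last 2 first.
- by rewrite -mulr_natr !mulr_ge0 ?pi_ge0 // ltW.
- by rewrite -mulr_natr !mulr_ge0 ?pi_ge0 // ltW.
by congr (Num.sqrt _)^-1; field; rewrite gt_eqF.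
Qed.

Lemma EFin_avg (nu : probability (measurableTypeR R) R) (f : R -> R) x :
  bmeas f -> (avg nu f x)%:E = (\int[nu]_y (f (x + y))%:E)%E.
Proof.
move=> bf; rewrite /avg /Rintegral fineK //.
exact: integrable_fin_num (bmeas_integrable nu (bmeas_shift x bf)).
Qed.

Definition has_density (nu : probability (measurableTypeR R) R) (p : R -> R) :=
  [/\ measurable_fun setT p, (forall x, 0 <= p x) &
    forall f : R -> \bar R, measurable_fun setT f -> (forall x, 0 <= f x)%E ->
    (\int[nu]_x f x = \int[mu]_x (f x * (p x)%:E))%E].

(** Both sides are integrals of f(x + w): on the left the substitution w = y + z and Tonelli,
    available because everything is nonnegative, leave the convolution of [pa] and [pb] as the
    weight of w. Continuity of [f] and [pb] serves the substitution. *)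
Lemma avg_convolution (na nb nc : probability (measurableTypeR R) R)
    (pa pb pc f : R -> R) x :
  has_density na pa -> has_density nb pb -> has_density nc pc ->
  continuous pb ->
  (forall w, (\int[mu]_y (pb (w - y) * pa y)%:E = (pc w)%:E)%E) ->
  continuous f -> bmeas f -> (forall y, 0 <= f y) ->
  avg na (avg nb f) x = avg nc f x.
Proof.
move=> [ma pa0 da] [mb pb0 db] [mc pc0 dc] cb pabc cf bf f0.
have bA := bmeas_avg nb bf.
apply/EFin_inj; rewrite (EFin_avg na x bA) (EFin_avg nc x bf).
have [mf _] := bf; have [mA _] := bA.
have mfx (t : R) : measurable_fun setT (fun y => (f (t + y))%:E).
  by apply/measurable_EFinP; exact: (measurableT_comp mf (measurable_shift t)).
have mp (p : R -> R) : measurable_fun setT p ->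
  measurable_fun setT (fun y : R => (p y)%:E) by move=> ?; exact/measurable_EFinP.
rewrite da; last first.
- by move=> y; rewrite lee_fin /avg Rintegral_ge0.
- by apply/measurable_EFinP; exact: (measurableT_comp mA (measurable_shift x)).
rewrite dc //; last by move=> y; rewrite lee_fin.
pose k y w := ((f (x + w))%:E * (pb (w - y) * pa y)%:E)%E.
transitivity (\int[mu]_y \int[mu]_w k y w)%E.
  apply: eq_integral => y _; rewrite (EFin_avg nb (x + y) bf).
  rewrite db //; last by move=> z; rewrite lee_fin.
  rewrite -ge0_integralZr //; last 3 first.
  - by apply: emeasurable_funM; [exact: mfx|exact: mp].
  - by move=> z _; rewrite -EFinM lee_fin mulr_ge0.
  - by rewrite lee_fin.
  have H := @ge0_integral_shift (fun w => f (x + w) * (pb (w - y) * pa y)) y.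
  rewrite /k; under [RHS]eq_integral do rewrite -EFinM.
  rewrite -H.
  - apply: eq_integral => z _; rewrite -!EFinM addrK mulrA; congr (_ * _ * _)%:E.
    by congr f; ring.
  - have cc (g l : R -> R) : continuous g -> continuous l -> continuous (g \o l).
      by move=> cg cl z; exact: (continuous_comp (cl z) (cg _)).
    have cfx : continuous (f \o (fun w : R => x + w)).
      by apply: cc => // z; apply: cvgD; [exact: cvg_cst|exact: cvg_id].
    have cpy : continuous (pb \o (fun w : R => w - y)).
      by apply: cc => // z; apply: cvgB; [exact: cvg_id|exact: cvg_cst].
    move=> w; apply: cvgM; first exact: cfx.
    by apply: cvgM; [exact: cpy|exact: cvg_cst].
  - by move=> w; rewrite !mulr_ge0.
have mk : measurable_fun setT (fun p : R * R => k p.1 p.2).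
  apply: emeasurable_funM; apply/measurable_EFinP.
    by apply: (measurableT_comp mf); exact: measurable_funD.
  apply: measurable_funM.
    by apply: (measurableT_comp mb); exact: measurable_funB.
  exact: (measurableT_comp ma).
have k0 p : (0 <= k p.1 p.2)%E.
  by rewrite /k -EFinM lee_fin !mulr_ge0.
rewrite (@fubini_tonelli _ _ _ _ R mu mu (fun p : R * R => k p.1 p.2)) //.
apply: eq_integral => w _ /=.
rewrite -pabc -ge0_integralZl //.
- apply/measurable_EFinP; apply: measurable_funM => //.
  by apply: (measurableT_comp mb); exact: measurable_funB.
- by move=> y _; rewrite lee_fin mulr_ge0.
- by rewrite lee_fin.
Qed.

Lemma normal_has_density (m s : R) :
  has_density (normal_prob m s) (normal_pdf m s).
Proof.
split; [exact: measurable_normal_pdf|exact: normal_pdf_ge0|].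
move=> f mf f0; exact: ge0_integral_normal_prob.
Qed.

Definition gauss_avg (a : R) : (R -> R) -> R -> R :=
  avg (normal_prob 0 (Num.sqrt a)).

Lemma gauss_avgD (a b : R) (f : R -> R) x : 0 < a -> 0 < b ->
  continuous f -> bmeas f -> (forall y, 0 <= f y) ->
  gauss_avg a (gauss_avg b f) x = gauss_avg (a + b) f x.
Proof.
move=> a0 b0 cf bf f0.
apply: (avg_convolution x (@normal_has_density 0 (Num.sqrt a))
  (@normal_has_density 0 (Num.sqrt b)) (@normal_has_density 0 (Num.sqrt (a + b)))) => //.
  by apply: continuous_normal_pdf; rewrite gt_eqF // sqrtr_gt0.
move=> w; under eq_integral do rewrite normal_pdf_mul // EFinM.
rewrite ge0_integralZl ?integral_normal_pdf ?mule1 // ?lee_fin ?normal_pdf_ge0 //.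
- by apply/measurable_EFinP; exact: measurable_normal_pdf.
- by move=> y _; rewrite lee_fin normal_pdf_ge0.
Qed.

(** The count starts at [n.+1] because [gauss_avgD] adds positive variances. *)
Lemma iter_gauss_avg (a : R) n (f : R -> R) x : 0 < a ->
  continuous f -> bmeas f -> (forall y, 0 <= f y) ->
  iter n.+1 (gauss_avg a) f x = gauss_avg (n.+1%:R * a) f x.
Proof.
move=> a0 cf bf f0; elim: n x => [|n IH] x; first by rewrite mul1r.
have E : iter n.+1 (gauss_avg a) f = gauss_avg (n.+1%:R * a) f.
  by apply/funext => y; exact: IH.
have -> : n.+2%:R * a = a + n.+1%:R * a.
  by rewrite -[n.+2%:R]natr1 mulrDl mul1r addrC.
have na0 : 0 < n.+1%:R * a by rewrite mulr_gt0.
rewrite iterS E; exact: gauss_avgD.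
Qed.

(** The peak of the density is 1 / sqrt (2 pi), which is at most 1. Hence the normal distribution
    function is 1-Lipschitz. *)
Lemma normal_prob_itv_le (c e : R) : c <= e ->
  (normal_prob 0 1 `]c, e]%classic <= (e - c)%:E)%E.
Proof.
move=> ce; rewrite /normal_prob.
apply: (@le_trans _ _ (\int[mu]_(x in `]c, e]) (cst 1 x))%E).
  apply: ge0_le_integral => //=.
  - by move=> x _; rewrite lee_fin normal_pdf_ge0.
  - by apply: measurable_funTS; apply/measurable_EFinP; exact: measurable_normal_pdf.
  - move=> x _; rewrite lee_fin.
    apply: le_trans (normal_pdf_ub 0 x (oner_neq0 _)) _.
    have p1 : 1 <= pi *+ 2 :> R by rewrite -mulr_natr; have := @pi_ge2 R; lra.
    have p0 : 0 < pi *+ 2 :> R by exact: lt_le_trans p1.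
    rewrite /normal_peak expr1n mul1r invf_le1 ?sqrtr_gt0 //.
    by rewrite -[leLHS]sqrtr1 ler_wsqrtr.
rewrite integral_cst //= mul1e lebesgue_measure_itv /= lte_fin.
by case: ltP => // _; rewrite ?lee_fin ?subr_ge0.
Qed.

End Convolution.

(** * Independence and sums *)

Section Laws.
Context d d1 d2 (T : measurableType d) (T1 : measurableType d1)
  (T2 : measurableType d2) (R : realType) (P : probability T R).

Definition law (f : T -> T1) (mf : measurable_fun setT f) : probability T1 R :=
  distribution P (mfun_Sub (mem_set mf)).

Lemma ge0_integral_law f (mf : measurable_fun setT f) (g : T1 -> \bar R) :
  measurable_fun setT g -> (forall x, 0 <= g x)%E ->
  (\int[law mf]_x g x = \int[P]_t g (f t))%E.
Proof. by move=> mg g0; rewrite /law ge0_integral_distribution. Qed.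

Lemma integral_law f (mf : measurable_fun setT f) (g : T1 -> \bar R) :
  measurable_fun setT g -> P.-integrable setT (g \o f) ->
  (\int[law mf]_x g x = \int[P]_t g (f t))%E.
Proof. by move=> mg ig; rewrite /law integral_distribution. Qed.

Lemma integrable_law f (mf : measurable_fun setT f) (g : T1 -> \bar R) :
  measurable_fun setT g -> P.-integrable setT (g \o f) ->
  (law mf).-integrable setT g.
Proof.
move=> mg /integrableP[_ ig]; apply/integrableP; split=> //.
rewrite ge0_integral_law //; exact: measurableT_comp.
Qed.

End Laws.

Section Rectangles.
Context d1 d2 (T1 : measurableType d1) (T2 : measurableType d2) (R : realType).

(** Rectangles are stable under intersection and generate the product sigma-algebra. Neither measure
    is assumed to be a product: below, one of them is a joint law restricted to an event. *)
Lemma measure_rectangle_unique (m1 m2 : {measure set (T1 * T2) -> \bar R}) :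
  (m1 setT < +oo)%E ->
  (forall A B, measurable A -> measurable B -> m1 (A `*` B) = m2 (A `*` B)) ->
  forall C, measurable C -> m1 C = m2 C.
Proof.
move=> fm1 m12 C mC.
pose G : set (set (T1 * T2)) :=
  [set C | exists A, measurable A /\ exists B, measurable B /\ C = A `*` B].
have GI : setI_closed G.
  move=> /= _ _ [X1 [mX1 [X2 [mX2 ->]]]] [Y1 [mY1 [Y2 [mY2 ->]]]].
  rewrite -setXI; exists (X1 `&` Y1); split; first exact: measurableI.
  by exists (X2 `&` Y2); split => //; exact: measurableI.
apply: (measure_unique G (fun=> setT)) => //.
- rewrite measurable_prod_measurableType //; congr (<<s _ >>).
  rewrite predeqE; split => [[A mA [B mB <-]]|[A [mA [B [mB ->]]]]].
    by exists A; split => //; exists B.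
  by exists A => //; exists B.
- by move=> n; exists setT; split=> //; exists setT; split=> //; rewrite setXTT.
- by rewrite bigcup_const.
- by move=> A [A1 [mA1 [A2 [mA2 ->]]]]; exact: m12.
Qed.

End Rectangles.

Section Independence.
Context d d1 d2 (T : measurableType d) (T1 : measurableType d1)
  (T2 : measurableType d2) (R : realType) (P : probability T R).
Variables (f : T -> T1) (g : T -> T2).
Hypotheses (mf : measurable_fun setT f) (mg : measurable_fun setT g).
Hypothesis indep : independent_RV P f g.

Lemma measurable_pair : measurable_fun setT (fun t => (f t, g t)).
Proof. exact/measurable_fun_pairP. Qed.

Lemma indep_law C : measurable C ->
  (law P mf \x law P mg)%E C = law P measurable_pair C.
Proof.
by move=> mC; apply: product_measure_unique.
Qed.

Lemma indep_integral (h : T1 * T2 -> \bar R) : measurable_fun setT h ->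
  P.-integrable setT (fun t => h (f t, g t)) ->
  (\int[P]_t h (f t, g t) = \int[law P mf]_x \int[law P mg]_y h (x, y))%E.
Proof.
move=> mh ih.
have il : (law P mf \x law P mg)%E.-integrable setT h.
  have /integrableP[_ loo] := integrable_law measurable_pair mh ih.
  apply/integrableP; split=> //; apply: le_lt_trans loo.
  rewrite le_eqVlt; apply/orP; left; apply/eqP.
  by apply: eq_measure_integral => C mC _; exact: indep_law.
rewrite integral12_prod_meas1 //.
transitivity (\int[law P measurable_pair]_x h x)%E.
  by rewrite integral_law.
by apply: eq_measure_integral => C mC _; exact/esym/indep_law.
Qed.

End Independence.

Section IndependentProduct.
Context d (T : measurableType d) (R : realType) (P : probability T R).
Variables f g : T -> R.
Hypotheses (mf : measurable_fun setT f) (mg : measurable_fun setT g).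
Hypothesis indep : independent_RV P f g.
Hypotheses (if_ : P.-integrable setT (EFin \o f))
  (ig : P.-integrable setT (EFin \o g)).

Let mprod : measurable_fun setT (fun p : R * R => (p.1 * p.2)%:E).
Proof. by apply/measurable_EFinP; exact: measurable_funM. Qed.

(** Tonelli for |x y| against the product law; integrability of the product must be known before its
    integral can be split by Fubini. *)
Lemma indep_integrable_mul :
  P.-integrable setT (EFin \o (fun t => f t * g t)).
Proof.
have /integrableP[_ foo] := if_; have /integrableP[_ goo] := ig.
apply/integrableP; split; first by apply/measurable_EFinP; exact: measurable_funM.
pose h (p : R * R) := `|(p.1 * p.2)%:E|%E.
have mh : measurable_fun setT h by exact: measurableT_comp.
have h0 p : (0 <= h p)%E by exact: abse_ge0.
have -> : (\int[P]_x `|(EFin \o (fun t => (f t * g t)%R)) x| =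
    \int[law P (measurable_pair mf mg)]_p h p)%E.
  by rewrite ge0_integral_law.
have -> : (\int[law P (measurable_pair mf mg)]_p h p =
    \int[law P mf \x law P mg]_p h p)%E.
  by apply: eq_measure_integral => C mC _; exact/esym/indep_law.
rewrite fubini_tonelli1 // /fubini_F /h /=.
under eq_integral => x _.
  under eq_integral do rewrite normrM EFinM.
  rewrite ge0_integralZl //; last by apply/measurable_EFinP; exact: normr_measurable.
  rewrite (@ge0_integral_law _ _ _ _ _ P g mg (fun y => `|y|%:E)) //; last first.
    by apply/measurable_EFinP; exact: normr_measurable.
  over.
rewrite ge0_integralZr //.
- rewrite (@ge0_integral_law _ _ _ _ _ P f mf (fun y => `|y|%:E)) //; last first.
    by apply/measurable_EFinP; exact: normr_measurable.
  by rewrite lte_mul_pinfty // ?integral_ge0 // ge0_fin_numE // integral_ge0.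
- by apply/measurable_EFinP; exact: normr_measurable.
- exact: integral_ge0.
Qed.

Lemma indep_Rintegral_mul :
  \int[P]_t (f t * g t) = \int[P]_t f t * \int[P]_t g t.
Proof.
have fin h : P.-integrable setT (EFin \o h) ->
    (\int[P]_t (h t)%:E)%E = (\int[P]_t h t)%:E.
  by move=> ih; rewrite /Rintegral fineK // integrable_fin_num.
apply: EFin_inj; rewrite EFinM -!fin //; last exact: indep_integrable_mul.
have := indep_integral mf mg indep mprod indep_integrable_mul; rewrite /= => ->.
have lf : (\int[law P mf]_x x%:E = \int[P]_t (f t)%:E)%E.
  by rewrite integral_law.
have lg : (\int[law P mg]_x x%:E = \int[P]_t (g t)%:E)%E.
  by rewrite integral_law.
have ilf : (law P mf).-integrable setT (@EFin R) by apply: integrable_law.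
have ilg : (law P mg).-integrable setT (@EFin R) by apply: integrable_law.
under eq_integral => x _.
  under eq_integral do rewrite EFinM.
  rewrite integralZl // lg fin //.
  over.
by rewrite integralZr // (fin _ ig); congr (_ * _)%E; exact: lf.
Qed.

End IndependentProduct.

(** * Partial sums of independent variables *)

Section Sums.
Context d (T : measurableType d) (R : realType) (P : probability T R).
Variables (xi : nat -> T -> R).
Hypothesis mxi : forall s, measurable_fun setT (xi s).
Hypothesis indep : mutually_independent_RV P xi.

Let S n t := \sum_(s < n) xi s t.

Lemma measurable_partial_sum n : measurable_fun setT (S n).
Proof. by apply: measurable_sum => s; exact: mxi. Qed.

Let F (I : seq nat) (B : nat -> set R) := \bigcap_(s in [set` I]) (xi s @^-1` B s).

Let measurable_xi s (B : set R) : measurable B -> measurable (xi s @^-1` B).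
Proof. by move=> mB; rewrite -[X in measurable X]setTI; exact: mxi. Qed.

Let F_cons m I B : F (m :: I) B = (xi m @^-1` B m) `&` F I B.
Proof.
apply/seteqP; split=> t /=.
  move=> Ft; split; first by apply: (Ft m); rewrite /= inE eqxx.
  by move=> s /= sI; apply: (Ft s); rewrite /= inE sI orbT.
by move=> [tm Ft] s /=; rewrite inE => /orP[/eqP->//|]; exact: Ft.
Qed.

Let measurable_F I B : (forall s, measurable (B s)) -> measurable (F I B).
Proof.
move=> mB; elim: I => [|m I IH].
  by rewrite /F (_ : [set` [::]] = set0) ?bigcap_set0 //; apply/seteqP; split.
by rewrite F_cons; apply: measurableI => //; exact: measurable_xi.
Qed.

Let PF_cons m I B : uniq (m :: I) -> (forall s, measurable (B s)) ->
  P (F (m :: I) B) = (P (xi m @^-1` B m) * P (F I B))%E.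
Proof.
move=> uI mB; rewrite /F !indep ?big_cons //.
by case/andP: uI.
Qed.

(** Independence of [S m] from [xi m] alone would not survive induction. The statement therefore
    involves any finite family of indices at least m: passing to m.+1 moves [xi m] from the family
    into the sum. *)
Let sum_indep_tail m I B A : uniq I -> (forall s, s \in I -> (m <= s)%N) ->
  (forall s, measurable (B s)) -> measurable A ->
  P ((S m @^-1` A) `&` F I B) = (P (S m @^-1` A) * P (F I B))%E.
Proof.
elim: m I B A => [|m IH] I B A uI Im mB mA.
  have [A0|A0] := pselect (A 0).
    have -> : S 0 @^-1` A = setT.
      by apply/seteqP; split=> // t _; rewrite /S /= big_ord0.
    by rewrite setTI probability_setT mul1e.
  have -> : S 0 @^-1` A = set0.
    by apply/seteqP; split=> // t; rewrite /S /= big_ord0.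
  by rewrite set0I measure0 mul0e.
have mF := measurable_F I mB.
have mpair : measurable_fun setT (fun t => (S m t, xi m t)).
  by apply: measurable_fun_pair => //; exact: measurable_partial_sum.
pose pr t := (S m t, xi m t).
(* Two measures on the plane: the law of (S m, xi m) restricted to the tail event, and the same law
   scaled by the probability of that event. The induction hypothesis makes them agree on rectangles,
   hence on the set of pairs whose sum lies in [A]. *)
pose m0 : {measure set (R * R) -> \bar R} := pushforward (mrestr P mF) pr.
pose m1 := m0 mpair.
have m1E C : m1 C = P (pr @^-1` C `&` F I B) by [].
have PF0 : 0 <= fine (P (F I B)) by rewrite fine_ge0.
pose m2 : {measure set (R * R) -> \bar R} :=
  mscale (NngNum PF0) (law P mpair).
have m2E C : m2 C = (P (F I B) * P (pr @^-1` C))%E.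
  by rewrite /m2 /= /mscale /= fineK // fin_num_measure.
have m12 : forall C, measurable C -> m1 C = m2 C.
  apply: measure_rectangle_unique.
    rewrite m1E preimage_setT setTI; apply: le_lt_trans (ltry 1).
    exact: probability_le1.
  move=> A' B' mA' mB'; rewrite m2E.
  (* Index m gets the second side of the rectangle; as m does not occur in [I], the tail event is
     unchanged. *)
  pose B2 s := if s == m then B' else B s.
  have mB2 s : measurable (B2 s) by rewrite /B2; case: ifP.
  have mI : m \notin I by apply/negP => /Im; rewrite ltnn.
  have FB2 : F I B2 = F I B.
    apply: eq_bigcapr => s /= sI; rewrite /B2; case: eqP => // sm.
    by move: mI; rewrite -sm sI.
  have B2m : B2 m = B' by rewrite /B2 eqxx.
  have u2 : uniq (m :: I) by rewrite /= mI.
  have -> : m1 (A' `*` B') = P ((S m @^-1` A') `&` F (m :: I) B2).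
    by rewrite m1E F_cons B2m FB2 setIA.
  rewrite IH //; last first.
    by move=> s; rewrite inE => /orP[/eqP->//|/Im/ltnW].
  rewrite PF_cons // FB2 B2m.
  have -> : pr @^-1` (A' `*` B') = (S m @^-1` A') `&` F [:: m] B2.
    rewrite F_cons B2m (_ : F [::] B2 = setT) ?setIT //.
    by apply/seteqP; split.
  rewrite IH //; last by move=> s; rewrite inE => /eqP->.
  rewrite PF_cons // (_ : F [::] B2 = setT); last by apply/seteqP; split.
  by rewrite probability_setT mule1 B2m muleA muleC.
have mC : measurable ((fun p : R * R => p.1 + p.2) @^-1` A).
  rewrite -[X in measurable X]setTI; apply: (measurable_funD) => //.
have := m12 _ mC; rewrite m1E m2E muleC.
have -> : S m.+1 @^-1` A = pr @^-1` ((fun p : R * R => p.1 + p.2) @^-1` A).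
  by apply/seteqP; split=> t; rewrite /S /= big_ord_recr.
by [].
Qed.

Lemma partial_sum_indep n : independent_RV P (S n) (xi n).
Proof.
move=> A B mA mB; have := @sum_indep_tail n [:: n] (fun=> B) A isT.
rewrite F_cons (_ : F [::] _ = setT) ?setIT; last by apply/seteqP; split.
by apply=> // s; rewrite inE => /eqP->.
Qed.

Variable mu : probability (measurableTypeR R) R.
Hypothesis lawxi : forall s (A : set (measurableTypeR R)), measurable A ->
  P (xi s @^-1` A) = mu A.

(** The last summand is independent of the others, so Fubini integrates it out first and replaces
    [f] by [avg mu f]; the induction hypothesis applies to this new function. *)
Lemma iid_sum_avg n f x : bmeas f ->
  \int[P]_t f (x + S n t) = iter n (avg mu) f x.
Proof.
elim: n f x => [|n IH] f x bf.
  rewrite /S; under eq_Rintegral do rewrite big_ord0 addr0.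
  by rewrite (@Rintegral_cst _ _ R P setT measurableT) /= probability_setT mulr1.
rewrite iterSr -IH; last exact: bmeas_avg.
have [mf [B fB]] := bf.
pose h (p : R * R) := (f (x + (p.1 + p.2)))%:E.
have mh : measurable_fun setT h.
  apply/measurable_EFinP; apply: (measurableT_comp mf).
  apply: (measurableT_comp (measurable_shift x)); exact: measurable_funD.
have mS := measurable_partial_sum n.
have ih : P.-integrable setT (fun t => h (S n t, xi n t)).
  apply: (@le_integrable _ _ _ P setT measurableT _ (EFin \o cst B)).
  - exact: (measurableT_comp mh (measurable_pair mS (mxi n))).
  - by move=> t _ /=; rewrite lee_fin (le_trans (fB _)) // ler_norm.
  - exact: finite_measure_integrable_cst.
have := indep_integral mS (mxi n) (@partial_sum_indep n) mh ih.
have bA := bmeas_avg mu bf; have [mA [B' AB]] := bA.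
rewrite /Rintegral /h /= => H.
have -> : (\int[P]_t (f (x + S n.+1 t))%:E = \int[P]_t (f (x + (S n t + xi n t)))%:E)%E.
  by apply: eq_integral => t _; rewrite /S big_ord_recr.
rewrite H; congr fine.
transitivity (\int[law P mS]_y (avg mu f (x + y))%:E)%E; last first.
  rewrite integral_law //.
    by apply/measurable_EFinP; exact: (measurableT_comp mA (measurable_shift x)).
  apply: (@le_integrable _ _ _ P setT measurableT _ (EFin \o cst B')).
  - apply/measurable_EFinP; apply: (measurableT_comp mA).
    exact: (measurableT_comp (measurable_shift x)).
  - by move=> t _ /=; rewrite lee_fin (le_trans (AB _)) // ler_norm.
  - exact: finite_measure_integrable_cst.
apply: eq_integral => y _; rewrite (EFin_avg mu (x + y) bf).
transitivity (\int[law P (mxi n)]_z (f (x + y + z))%:E)%E.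
  by apply: eq_integral => z _; rewrite addrA.
have mfxy : measurable_fun setT (fun z => (f (x + y + z))%:E).
  by apply/measurable_EFinP; exact: (measurableT_comp mf (measurable_shift _)).
have ixy : P.-integrable setT ((fun z => (f (x + y + z))%:E) \o xi n).
  apply: (@le_integrable _ _ _ P setT measurableT _ (EFin \o cst B)).
  - exact: (measurableT_comp mfxy (mxi n)).
  - by move=> t _ /=; rewrite lee_fin (le_trans (fB _)) // ler_norm.
  - exact: finite_measure_integrable_cst.
rewrite (integral_law (mxi n) mfxy ixy).
rewrite -(@integral_law _ _ T (measurableTypeR R) R P (xi n) (mxi n) _ mfxy ixy).
by apply: eq_measure_integral => C mC _; exact: (lawxi n).
Qed.

End Sums.

(** * The central limit theorem *)

Section CentralLimit.
Variable R : realType.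

(** The slope [e ^- 2] makes the function at most [e] beyond [c + e] and at least [1 - e] before
    [c - e], since logistic (1 / e) <= e. The affine argument is written in the form expected by
    [taylor3_scale]. *)
Definition step (c e x : R) : R := logistic ((e ^- 2) * x + (- (e ^- 2) * c)).

Lemma stepE c e x : step c e x = logistic (e ^- 2 * (x - c)).
Proof. by rewrite /step mulrBr mulNr. Qed.

Lemma step_ge0 c e x : 0 <= step c e x.
Proof. exact/ltW/logistic_gt0. Qed.

Lemma step_le1 c e x : step c e x <= 1.
Proof. exact/ltW/logistic_lt1. Qed.

Lemma taylor3_step c e : taylor3 (3 * `|e ^- 2| ^+ 3) (step c e).
Proof. exact/taylor3_scale/taylor3_logistic. Qed.

Lemma continuous_step c e : continuous (step c e).
Proof.
have clog : continuous (@logistic R).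
  move=> y; apply: differentiable_continuous; apply/derivable1_diffP.
  by have [] := is_derive_logistic y.
move=> x; apply: (@continuous_comp _ _ _ (fun y : R => e ^- 2 * y + (- (e ^- 2) * c)) (@logistic R)).
  by apply: cvgD; [apply: cvgM; [exact: cvg_cst|exact: cvg_id]|exact: cvg_cst].
exact: clog.
Qed.

Lemma step_small c e x : 0 < e -> c + e <= x -> step c e x <= e.
Proof.
move=> e0 ce; rewrite stepE.
have e2 : 0 < e ^- 2 by rewrite invr_gt0 exprn_gt0.
have xc : e <= x - c by rewrite lerBrDl.
have ei : e^-1 <= e ^- 2 * (x - c).
  apply: (@le_trans _ _ (e ^- 2 * e)); last by rewrite ler_wpM2l // ltW.
  by rewrite expr2 invfM -mulrA mulVf ?gt_eqF // mulr1.
apply: (le_trans (logistic_le ei)).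
by have := @logistic_leV R e^-1; rewrite invr_gt0 invrK; exact.
Qed.

Lemma step_big c e x : 0 < e -> x <= c - e -> 1 - step c e x <= e.
Proof.
move=> e0 xc.
have -> : 1 - step c e x = step (- c) e (- x).
  by rewrite !stepE -logisticN; congr logistic; ring.
by apply: step_small => //; lra.
Qed.

(** * Distribution functions squeezed between integrals of smooth steps *)

Section Sandwich.
Context d (T : measurableType d) (Q : probability T R) (Y : T -> R).
Hypothesis mY : measurable_fun setT Y.

Lemma measurable_sublevel c : measurable [set t | Y t <= c].
Proof.
rewrite (_ : [set t | Y t <= c] = setT `&` Y @^-1` `]-oo, c]%classic).
  by apply: mY => //; exact: measurable_itv.
by apply/seteqP; split=> t /=; rewrite in_itv //= => -[].
Qed.

Let ind c t : R := \1_[set t | Y t <= c] t.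

Let integrable_ind c : Q.-integrable setT (EFin \o ind c).
Proof.
by apply: integrable_indic => //; exact: measurable_sublevel.
Qed.

Let Rintegral_ind c : \int[Q]_t ind c t = fine (Q [set t | Y t <= c]).
Proof.
by rewrite /Rintegral integral_indic ?setIT //; exact: measurable_sublevel.
Qed.

Let integrable_step c e : Q.-integrable setT (EFin \o (fun t => step c e (Y t))).
Proof.
have [mf _] := taylor3_bmeas (taylor3_step c e).
apply: (@le_integrable _ _ _ Q setT measurableT _ (EFin \o cst 1)).
- by apply/measurable_EFinP; exact: (measurableT_comp mf).
- by move=> t _ /=; rewrite lee_fin ger0_norm ?step_ge0 // normr1 step_le1.
- exact: finite_measure_integrable_cst.
Qed.

Let integrableDc (f : T -> R) e : Q.-integrable setT (EFin \o f) ->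
  Q.-integrable setT (EFin \o (fun t => f t + e)).
Proof.
move=> fi.
have := integrableD measurableT fi (finite_measure_integrable_cst Q e measurableT).
by apply: eq_integrable.
Qed.

Let RintegralDc (f : T -> R) e : Q.-integrable setT (EFin \o f) ->
  \int[Q]_t (f t + e) = \int[Q]_t f t + e.
Proof.
move=> fi; rewrite RintegralD //; last exact: finite_measure_integrable_cst.
by rewrite (@Rintegral_cst _ _ R Q setT measurableT) /= probability_setT mulr1.
Qed.

Lemma step_lower c e : 0 < e ->
  fine (Q [set t | Y t <= c - e]) <= \int[Q]_t step c e (Y t) + e.
Proof.
move=> e0; rewrite -Rintegral_ind -RintegralDc //.
apply: le_Rintegral => //; first exact: integrableDc.
move=> t _; rewrite /ind indicE.
case: (boolP (t \in _)) => [|_].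
  by rewrite inE /= => /(step_big e0); rewrite lerBlDr addrC.
by rewrite addr_ge0 ?step_ge0 // ltW.
Qed.

Lemma step_upper c e : 0 < e ->
  \int[Q]_t step c e (Y t) <= fine (Q [set t | Y t <= c + e]) + e.
Proof.
move=> e0; rewrite -Rintegral_ind -RintegralDc //.
apply: le_Rintegral => //; first exact: integrableDc.
move=> t _; rewrite /ind indicE.
case: (boolP (t \in _)) => [_|].
  by rewrite (le_trans (step_le1 _ _ _)) // lerDl ltW.
rewrite notin_setE /= => /negP; rewrite -ltNge => /ltW /(step_small e0).
by rewrite add0r.
Qed.

End Sandwich.

Lemma normal_cdf_lip (c e : R) : 0 <= e ->
  fine (normal_prob 0 1 `]-oo, c + e]%classic) <=
  fine (normal_prob 0 1 `]-oo, c]%classic) + e.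
Proof.
move=> e0; have ce : c <= c + e by rewrite lerDl.
rewrite -lee_fin EFinD !fineK ?fin_num_measure //.
have -> : `]-oo, c + e]%classic = `]-oo, c]%classic `|` `]c, (c + e)]%classic :> set R.
  by rewrite -itv_bndbnd_setU.
apply: le_trans (measureU2 _ _ _) _ => //.
rewrite leeD2l //; apply: le_trans (normal_prob_itv_le ce) _.
by rewrite addrAC subrr add0r.
Qed.

Section Clt.
Context d (T : measurableType d) (P : probability T R).
Variable xi : nat -> T -> R.
Hypothesis mxi : forall s, measurable_fun setT (xi s).
Hypothesis indep : mutually_independent_RV P xi.
Hypothesis same : forall s A, measurable A -> P (xi s @^-1` A) = P (xi 0 @^-1` A).
Hypotheses (i1 : P.-integrable setT (EFin \o xi 0))
  (i2 : P.-integrable setT (EFin \o (fun t => xi 0 t ^+ 2)))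
  (i3 : P.-integrable setT (EFin \o (fun t => `|xi 0 t| ^+ 3))).
Hypotheses (m1 : \int[P]_t xi 0 t = 0) (m2 : \int[P]_t (xi 0 t ^+ 2) = 1).

Let eta (r : R) s t := r * xi s t.

Let meta r s : measurable_fun setT (eta r s : T -> measurableTypeR R).
Proof. exact: measurable_funM. Qed.

Let integrableZ (f : T -> R) c : P.-integrable setT (EFin \o f) ->
  P.-integrable setT (EFin \o (fun t => c * f t)).
Proof.
move=> fi; have := integrableZl measurableT c fi.
by apply: eq_integrable => // t _ /=; rewrite EFinM.
Qed.

Let moments_eta r : 0 < r ->
  moments3 (law P (meta r 0)) (r ^+ 2) (\int[P]_t (`|xi 0 t| ^+ 3) * r ^+ 3).
Proof.
move=> r0.
have j1 : P.-integrable setT ((@EFin R) \o eta r 0) := integrableZ r i1.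
have j2 : P.-integrable setT ((fun y : R => (y ^+ 2)%:E) \o eta r 0).
  have := integrableZ (r ^+ 2) i2.
  by apply: eq_integrable => // t _ /=; rewrite /eta exprMn.
have j3 : P.-integrable setT ((fun y : R => (`|y| ^+ 3)%:E) \o eta r 0).
  have := integrableZ (r ^+ 3) i3.
  by apply: eq_integrable => // t _ /=; rewrite /eta normrM exprMn gtr0_norm.
have me1 : measurable_fun setT (@EFin R) by exact/measurable_EFinP.
have me2 : measurable_fun setT (fun y : R => (y ^+ 2)%:E).
  by apply/measurable_EFinP; exact: measurable_funX.
have me3 : measurable_fun setT (fun y : R => (`|y| ^+ 3)%:E).
  by apply/measurable_EFinP; apply: measurable_funX; exact: normr_measurable.
have L1 := @integral_law _ _ T (measurableTypeR R) R P (eta r 0) (meta r 0) _ me1 j1.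
have L2 := @integral_law _ _ T (measurableTypeR R) R P (eta r 0) (meta r 0) _ me2 j2.
have L3 := @integral_law _ _ T (measurableTypeR R) R P (eta r 0) (meta r 0) _ me3 j3.
split; split.
- exact: (@integrable_law _ _ T (measurableTypeR R) R P (eta r 0) (meta r 0) _ me1 j1).
- exact: (@integrable_law _ _ T (measurableTypeR R) R P (eta r 0) (meta r 0) _ me2 j2).
- exact: (@integrable_law _ _ T (measurableTypeR R) R P (eta r 0) (meta r 0) _ me3 j3).
- rewrite /Rintegral L1 -/(Rintegral P setT (eta r 0)).
  by rewrite RintegralZl // m1 mulr0.
- rewrite /Rintegral L2 -/(Rintegral P setT (fun t => eta r 0 t ^+ 2)).
  rewrite (_ : (fun t => _) = (fun t => r ^+ 2 * xi 0 t ^+ 2)).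
    by rewrite RintegralZl // m2 mulr1.
  by apply/funext => t; rewrite exprMn.
- rewrite /Rintegral L3 -/(Rintegral P setT (fun t => `|eta r 0 t| ^+ 3)).
  rewrite (_ : (fun t => `|eta r 0 t| ^+ 3) = (fun t => r ^+ 3 * `|xi 0 t| ^+ 3)).
    by rewrite RintegralZl // mulrC.
  by apply/funext => t; rewrite normrM exprMn gtr0_norm.
Qed.

(** Write N for [n.+1]. Each of the N steps compares laws of variance 1/N whose third moments are of
    order N^(-3/2), so the total error is of order N^(-1/2). [D] depends on [C] only, hence one rank
    suffices for all the translates of a step. *)
Let sum_eta_step C : 0 <= C -> exists D : R, forall f : R -> R,
  continuous f -> taylor3 C f -> (forall y, 0 <= f y) -> forall n,
  `|\int[P]_t f ((Num.sqrt n.+1%:R)^-1 * \sum_(s < n.+1) xi s t) -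
    \int[normal_prob 0 1]_y f y| <= D * (Num.sqrt n.+1%:R)^-1.
Proof.
move=> C0; pose K := \int[P]_t (`|xi 0 t| ^+ 3).
pose K' := 54 * expR (1 / 2) : R.
exists (C * (K + K')) => f cf tf f0 n.
have bf := taylor3_bmeas tf.
set a : R := n.+1%:R^-1; have a0 : 0 < a by rewrite invr_gt0.
pose r := Num.sqrt a; have r0 : 0 < r by rewrite sqrtr_gt0.
have rE : (Num.sqrt n.+1%:R)^-1 = r by rewrite /r /a sqrtrV.
have r2 : r ^+ 2 = a by rewrite sqr_sqrtr // ltW.
have nr : n.+1%:R * r ^+ 3 = r by rewrite exprSr r2 mulrA /a divff // mul1r.
have ind_eta : mutually_independent_RV P (eta r).
  move=> I A uI mA; have mA' s : measurable ((fun y : R => r * y) @^-1` A s).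
    rewrite -[X in measurable X]setTI; apply: (measurable_funM) => //.
  exact: (indep uI mA').
have law_eta s (A : set (measurableTypeR R)) : measurable A ->
    P (eta r s @^-1` A) = law P (meta r 0) A.
  move=> mA; have mA' : measurable ((fun y : R => r * y) @^-1` A).
    rewrite -[X in measurable X]setTI; apply: (measurable_funM) => //.
  exact: (same s mA').
have me s : measurable_fun setT (eta r s) by exact: measurable_funM.
have H := iid_sum_avg me ind_eta law_eta n.+1 0 bf.
have -> : \int[P]_t f ((Num.sqrt n.+1%:R)^-1 * \sum_(s < n.+1) xi s t) =
    iter n.+1 (avg (law P (meta r 0))) f 0.
  rewrite -H; apply: eq_Rintegral => t _.
  by rewrite add0r rE mulr_sumr.
have -> : \int[normal_prob 0 1]_y f y = iter n.+1 (gauss_avg a) f 0.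
  have an : n.+1%:R * a = 1 by rewrite /a divff.
  rewrite (iter_gauss_avg n 0 a0 cf bf f0) an /gauss_avg sqrtr1 /avg.
  by apply: eq_Rintegral => y _; rewrite add0r.
have mn := normal_moments3 r0; have me' := moments_eta r0.
have := iter_avg_diff n.+1 0 C0 tf me' mn.
rewrite rE -[_ * r ^+ 3 + _]mulrDl -/K -/K' [C * (_ * _)]mulrA mulrCA nr.
exact.
Qed.

Theorem central_limit (c e : R) : 0 < e -> \forall n \near \oo,
  `|fine (P [set t | (Num.sqrt n%:R)^-1 * \sum_(s < n) xi s t <= c]) -
    fine (normal_prob 0 1 `]-oo, c]%classic)| <= e.
Proof.
(* The budget 8 h is spent exactly: h for smoothing each of the two laws, 2 h for moving the normal
   distribution function by 2 h, and e / 2 = 4 h for the comparison of the integrals. *)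
move=> e0; pose h := e / 8; have h0 : 0 < h by rewrite divr_gt0.
pose C := 3 * `|h ^- 2| ^+ 3.
have [|D HD] := sum_eta_step (_ : 0 <= C); first by rewrite mulr_ge0 ?exprn_ge0.
(* Beyond (2 |D| / e)^2 the comparison error |D| / sqrt n is at most e / 2. *)
pose N := (Num.truncn ((2 * `|D| / e) ^+ 2)).+1.
exists N.+1 => // -[|n] //= Nn.
pose Y t := (Num.sqrt n.+1%:R)^-1 * \sum_(s < n.+1) xi s t.
have mY : measurable_fun setT Y.
  by apply: measurable_funM => //; exact: measurable_partial_sum.
pose Phi x := fine (normal_prob 0 1 `]-oo, x]%classic) : R.
pose F x := fine (P [set t | Y t <= x]).
pose m x := \int[normal_prob 0 1]_y step x h y.
pose M x := \int[P]_t step x h (Y t).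
have err x : `|M x - m x| <= e / 2.
  have HDx := HD (step x h) (@continuous_step x h) (@taylor3_step x h) (@step_ge0 x h) n.
  rewrite /M /m /Y; apply: le_trans HDx _.
  rewrite ler_pdivrMr ?sqrtr_gt0 //.
  apply: le_trans (ler_norm _) _.
  rewrite -ler_pdivrMl ?divr_gt0 // (_ : _ * `|D| = 2 * `|D| / e); last first.
    by field; rewrite gt_eqF.
  have q0 : 0 <= 2 * `|D| / e by rewrite divr_ge0 ?mulr_ge0 ?(ltW e0).
  rewrite -ler_sqr ?nnegrE ?sqrtr_ge0 // sqr_sqrtr //.
  apply: le_trans (ltW (truncnS_gt _)) _.
  by rewrite ler_nat /N ltnW // ltnS ltnW.
have U x : F x <= M (x + h) + h.
  by have := step_lower P mY (x + h) h0; rewrite addrK.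
have L x : M (x - h) <= F x + h.
  by have := step_upper P mY (x - h) h0; rewrite subrK.
have sub x : [set t : measurableTypeR R | (t : R) <= x] = `]-oo, x]%classic.
  by apply/seteqP; split=> t /=; rewrite in_itv.
have mid : measurable_fun setT (fun t : measurableTypeR R => t : R) by exact: measurable_id.
have U' x : m x <= Phi (x + h) + h.
  by have := step_upper (normal_prob 0 1) mid x h0; rewrite sub.
have L' x : Phi (x - h) <= m x + h.
  by have := step_lower (normal_prob 0 1) mid x h0; rewrite sub.
have Lip x : Phi (x + (h + h)) <= Phi x + (h + h).
  by apply: normal_cdf_lip; rewrite addr_ge0 // ltW.
have := err (c + h); have := err (c - h).
have := U c; have := L c; have := U' (c + h); have := L' (c - h).
have := Lip c; have := Lip (c - h - h).
rewrite (_ : c - h - h + (h + h) = c); last by ring.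
rewrite -[c + h + h]addrA -/(F c) -/(Phi c).
have -> : e = 8 * h by rewrite /h; field.
move: (F c) (Phi c) (M (c + h)) (M (c - h)) (m (c + h)) (m (c - h))
  (Phi (c - h - h)) (Phi (c + (h + h))) => p1 p2 p3 p4 p5 p6 p7 p8.
rewrite !ler_norml; move=> ? ? ? ? ? ? /andP[? ?] /andP[? ?].
by apply/andP; split; lra.
Qed.

End Clt.

End CentralLimit.

(** * Random variables with all moments *)

Section Moments.
Context d (T : measurableType d) (R : realType) (P : probability T R).
Implicit Types f g : T -> R.

(** Finite moments of every order form an algebra stable under polynomials, so the integrability of
    products and powers below follows without tracking exponents. *)
Definition allmom f := measurable_fun setT f /\
  forall k, P.-integrable setT (EFin \o (fun t => f t ^+ k)).

Lemma allmom_integrableX f k : allmom f ->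
  P.-integrable setT (EFin \o (fun t => f t ^+ k)).
Proof. by case. Qed.

Lemma allmom_integrable f : allmom f -> P.-integrable setT (EFin \o f).
Proof. by move=> /(allmom_integrableX 1). Qed.

Lemma integrable_RD f g : P.-integrable setT (EFin \o f) ->
  P.-integrable setT (EFin \o g) ->
  P.-integrable setT (EFin \o (fun t => f t + g t)).
Proof.
move=> fi gi; have := integrableD measurableT fi gi.
by apply: eq_integrable => // t _ /=; rewrite EFinD.
Qed.

Lemma integrable_RZ c f : P.-integrable setT (EFin \o f) ->
  P.-integrable setT (EFin \o (fun t => c * f t)).
Proof.
move=> fi; have := integrableZl measurableT c fi.
by apply: eq_integrable => // t _ /=; rewrite EFinM.
Qed.

Lemma integrable_normX f k : P.-integrable setT (EFin \o (fun t => f t ^+ k)) ->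
  P.-integrable setT (EFin \o (fun t => `|f t| ^+ k)).
Proof.
move=> /integrable_abse; apply: eq_integrable => // t _ /=.
by rewrite normrX.
Qed.

Lemma le_integrableR f g : measurable_fun setT f ->
  (forall t, `|f t| <= g t) -> P.-integrable setT (EFin \o g) ->
  P.-integrable setT (EFin \o f).
Proof.
move=> mf fg; apply: le_integrable => //; first exact/measurable_EFinP.
by move=> t _ /=; rewrite lee_fin (le_trans (fg t)) // ler_norm.
Qed.

Lemma allmom_cst c : allmom (fun=> c).
Proof.
split=> // k; exact: finite_measure_integrable_cst.
Qed.

Lemma allmomD f g : allmom f -> allmom g -> allmom (fun t => f t + g t).
Proof.
move=> [mf fi] [mg gi]; split=> [|k]; first exact: measurable_funD.
apply: (@le_integrableR _ (fun t => 2 ^+ k * (`|f t| ^+ k + `|g t| ^+ k))).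
- by apply: measurable_funX; exact: measurable_funD.
- move=> t; rewrite normrX.
  pose m := Num.max `|f t| `|g t|.
  have fm : `|f t| <= m by rewrite le_max lexx.
  have gm : `|g t| <= m by rewrite le_max lexx orbT.
  have m0 : 0 <= m by exact: le_trans fm.
  apply: (@le_trans _ _ ((2 * m) ^+ k)).
    rewrite lerXn2r ?nnegrE ?mulr_ge0 // (le_trans (ler_normD _ _)) //.
    by rewrite mulr2n mulrDl mul1r lerD.
  rewrite exprMn ler_wpM2l ?exprn_ge0 // /m.
  by case: (leP `|f t| `|g t|) => _; rewrite ?lerDl ?lerDr exprn_ge0.
- by apply: integrable_RZ; apply: integrable_RD; exact: integrable_normX.
Qed.

Lemma allmomM f g : allmom f -> allmom g -> allmom (fun t => f t * g t).
Proof.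
move=> [mf fi] [mg gi]; split=> [|k]; first exact: measurable_funM.
apply: (@le_integrableR _ (fun t => f t ^+ (k * 2) + g t ^+ (k * 2))).
- by apply: measurable_funX; exact: measurable_funM.
- move=> t; rewrite exprMn normrM !exprM.
  rewrite -[f t ^+ k ^+ 2]real_normK ?num_real // -[g t ^+ k ^+ 2]real_normK ?num_real //.
  by have := sqr_ge0 (`|f t ^+ k| - `|g t ^+ k|); 
    have := normr_ge0 (f t ^+ k); have := normr_ge0 (g t ^+ k); nra.
- exact: integrable_RD.
Qed.

Lemma allmomX f k : allmom f -> allmom (fun t => f t ^+ k).
Proof.
move=> af; elim: k => [|k IH].
  by under eq_fun do rewrite expr0; exact: allmom_cst.
by under eq_fun do rewrite exprS; exact: allmomM.
Qed.

Lemma allmomZ c f : allmom f -> allmom (fun t => c * f t).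
Proof. by move=> af; apply: allmomM => //; exact: allmom_cst. Qed.

Lemma allmomB f g : allmom f -> allmom g -> allmom (fun t => f t - g t).
Proof.
move=> af ag; under eq_fun do rewrite -mulN1r.
by apply: allmomD => //; exact: allmomZ.
Qed.

Lemma allmom_sum I (r : seq I) (F : I -> T -> R) :
  (forall i, allmom (F i)) -> allmom (fun t => \sum_(i <- r) F i t).
Proof.
move=> aF; elim: r => [|i r IH].
  by under eq_fun do rewrite big_nil; exact: allmom_cst.
by under eq_fun do rewrite big_cons; exact: allmomD.
Qed.

Lemma allmom_horner (p : {poly R}) f : allmom f -> allmom (fun t => p.[f t]).
Proof.
move=> af; under eq_fun do rewrite horner_coef.
apply: allmom_sum => i.
by apply: allmomZ; exact: allmomX.
Qed.

Lemma Rintegral_const (c : R) : \int[P]_t c = c.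
Proof. by rewrite (@Rintegral_cst _ _ R P setT measurableT) /= probability_setT mulr1. Qed.

Lemma Rintegral_sum I (r : seq I) (F : I -> T -> R) :
  (forall i, P.-integrable setT (EFin \o F i)) ->
  P.-integrable setT (EFin \o (fun t => \sum_(i <- r) F i t)) /\
  \int[P]_t (\sum_(i <- r) F i t) = \sum_(i <- r) \int[P]_t F i t.
Proof.
move=> iF; elim: r => [|i r [IH E]].
  split.
    by under eq_fun do rewrite big_nil; exact: finite_measure_integrable_cst.
  by under eq_Rintegral do rewrite big_nil; rewrite Rintegral_const big_nil.
split; first by under eq_fun do rewrite big_cons; exact: integrable_RD.
under eq_Rintegral do rewrite big_cons.
by rewrite RintegralD // E big_cons.
Qed.

Lemma markov_ineq f (a : R) : 0 < a -> measurable_fun setT f ->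
  (forall t, 0 <= f t) -> P.-integrable setT (EFin \o f) ->
  fine (P [set t | a <= f t]) <= (\int[P]_t f t) / a.
Proof.
move=> a0 mf f0 fi; set A := [set t | a <= f t].
have mA : measurable A.
  rewrite (_ : A = setT `&` f @^-1` `[a, +oo[%classic).
    by apply: mf => //; exact: measurable_itv.
  by apply/seteqP; split=> t /=; rewrite in_itv /= andbT // => -[].
rewrite ler_pdivlMr // mulrC.
have -> : fine (P A) = \int[P]_t (\1_A t).
  by rewrite /Rintegral integral_indic ?setIT.
have iA : P.-integrable setT (EFin \o (\1_A : T -> R)) by exact: integrable_indic.
rewrite -RintegralZl //; apply: le_Rintegral => //; first exact: integrable_RZ.
move=> t _; rewrite indicE; case: (boolP (t \in A)); rewrite ?mulr1 ?mulr0 //.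
by rewrite inE.
Qed.

(** The cross terms vanish, so second moments add up. Only pairwise orthogonality is asked, which
    lets the bound serve both the score and the centred products in the Gram matrix. *)
Lemma sum_square_moment (g : nat -> T -> R) v n :
  (forall s, allmom (g s)) -> (forall s, \int[P]_t (g s t ^+ 2) <= v) ->
  (forall s s', s != s' -> \int[P]_t (g s t * g s' t) = 0) ->
  \int[P]_t ((\sum_(s < n) g s t) ^+ 2) <= n%:R * v.
Proof.
move=> ag gv g0; elim: n => [|n IH].
  under eq_Rintegral do rewrite big_ord0 expr0n /=.
  by rewrite Rintegral_const mul0r.
have aS : allmom (fun t => \sum_(s < n) g s t) by exact: allmom_sum.
have aM := allmomM aS (ag n).
rewrite (_ : \int[P]_t _ = \int[P]_t ((\sum_(s < n) g s t) ^+ 2 +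
    (2 * ((\sum_(s < n) g s t) * g n t) + g n t ^+ 2))); last first.
  by apply: eq_Rintegral => t _; rewrite big_ord_recr /=; ring.
have iX k f : allmom f -> P.-integrable setT (EFin \o (fun t => f t ^+ k)).
  exact: allmom_integrableX.
have iM := allmom_integrable aM.
rewrite RintegralD //; [|exact: iX|]; last first.
  by apply: integrable_RD; [exact: integrable_RZ|exact: iX].
rewrite RintegralD //; [|exact: integrable_RZ|exact: iX].
rewrite RintegralZl // (_ : \int[P]_t ((\sum_(s < n) g s t) * g n t) = 0).
  by rewrite mulr0 add0r -natr1 mulrDl mul1r lerD.
have [_] := @Rintegral_sum _ (index_enum 'I_n) (fun s t => g s t * g n t)
  (fun s => allmom_integrable (allmomM (ag s) (ag n))).
rewrite big1 => [E0|s _]; last by rewrite g0 // ltn_eqF.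
rewrite -[RHS]E0.
by apply: eq_Rintegral => t _ /=; rewrite mulr_suml.
Qed.

End Moments.

(** * Transfer of integrals between variables with the same law *)

Section SameLaw.
Context d d' (T : measurableType d) (E : measurableType d') (R : realType)
  (P : probability T R).
Variables (f g : T -> E) (h : E -> R).
Hypotheses (mf : measurable_fun setT f) (mg : measurable_fun setT g)
  (mh : measurable_fun setT h).
Hypothesis fg : same_law P P f g.

Lemma same_law_integrable : P.-integrable setT (EFin \o (h \o g)) ->
  P.-integrable setT (EFin \o (h \o f)).
Proof.
move=> /integrableP[_ gi]; apply/integrableP; split.
  by apply/measurable_EFinP; exact: (measurableT_comp mh mf).
have ma : measurable_fun setT (fun x => `|(h x)%:E|%E).
  by apply: measurableT_comp => //; exact/measurable_EFinP.
have a0 x : (0 <= `|(h x)%:E|)%E by exact: abse_ge0.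
apply: le_lt_trans gi; rewrite le_eqVlt; apply/orP; left; apply/eqP.
rewrite -(ge0_integral_law P mf ma a0) -(ge0_integral_law P mg ma a0).
by apply: eq_measure_integral => A mA _; exact: fg.
Qed.

Lemma same_law_Rintegral : P.-integrable setT (EFin \o (h \o g)) ->
  \int[P]_t h (f t) = \int[P]_t h (g t).
Proof.
move=> gi; have fi := same_law_integrable gi.
have mh' : measurable_fun setT (EFin \o h) by exact/measurable_EFinP.
rewrite /Rintegral; congr fine.
have -> : (\int[P]_t (h (f t))%:E = \int[law P mf]_x (h x)%:E)%E.
  by rewrite (integral_law mf mh' fi).
have -> : (\int[P]_t (h (g t))%:E = \int[law P mg]_x (h x)%:E)%E.
  by rewrite (integral_law mg mh' gi).
by apply: eq_measure_integral => A mA _; exact: fg.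
Qed.

End SameLaw.

(** * Measurability of matrix functions *)

Section MatrixMeasurability.
Context d (T : measurableType d) (R : realType).

Definition mxmeas m k (A : T -> 'M[R]_(m, k)) :=
  forall i j, measurable_fun setT (fun t => A t i j).

Lemma measurable_det k (A : T -> 'M[R]_k) : mxmeas A ->
  measurable_fun setT (fun t => \det (A t)).
Proof.
move=> mA; rewrite /determinant; apply: measurable_sum => s.
by apply: measurable_funM => //; apply: measurable_prod => i _; exact: mA.
Qed.

Lemma mxmeas_adj k (A : T -> 'M[R]_k) : mxmeas A -> mxmeas (fun t => \adj (A t)).
Proof.
move=> mA i j; under eq_fun do rewrite mxE /cofactor.
apply: measurable_funM => //; apply: measurable_det => p q.
by under eq_fun do rewrite !mxE; exact: mA.
Qed.

(** The inverse is f times the power -1 of f^2, a nonnegative base for which [powR] is the true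
    inverse; at a zero of f both sides are 0. *)
Lemma measurable_funV (f : T -> R) : measurable_fun setT f ->
  measurable_fun setT (fun t => (f t)^-1).
Proof.
move=> mf; rewrite (_ : (fun t => _) = (fun t => f t * powR (f t ^+ 2) (- 1))).
  apply: measurable_funM => //.
  apply: (@measurableT_comp _ _ _ _ _ _ (fun x : R => powR x (- 1))).
    exact: measurable_powR.
  exact: measurable_funX.
apply/funext => t; rewrite powR_inv1 ?sqr_ge0 //.
have [->|f0] := eqVneq (f t) 0; first by rewrite invr0 mul0r.
by rewrite expr2 invfM mulrA divff // mul1r.
Qed.

Lemma mxmeas_inv k (A : T -> 'M[R]_k) : mxmeas A -> mxmeas (fun t => invmx (A t)).
Proof.
move=> mA i j.
(* By convention [invmx] returns a singular matrix unchanged, hence the case distinction on the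
   determinant. *)
rewrite (_ : (fun t => _) = (fun t => if \det (A t) == 0 then A t i j
    else (\det (A t))^-1 * (\adj (A t)) i j)).
  apply: measurable_fun_ifT.
  - by apply: measurable_fun_eqr => //; exact: measurable_det.
  - exact: mA.
  - apply: measurable_funM; last exact: mxmeas_adj.
    exact/measurable_funV/measurable_det.
apply/funext => t; rewrite /invmx unitmxE unitfE.
by case: eqP => //= _; rewrite mxE.
Qed.

Lemma mxmeas_mul m k l (A : T -> 'M[R]_(m, k)) (B : T -> 'M[R]_(k, l)) :
  mxmeas A -> mxmeas B -> mxmeas (fun t => A t *m B t).
Proof.
move=> mA mB i j; under eq_fun do rewrite mxE.
by apply: measurable_sum => h; apply: measurable_funM; [exact: mA|exact: mB].
Qed.

Lemma mxmeas_tr m k (A : T -> 'M[R]_(m, k)) :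
  mxmeas A -> mxmeas (fun t => (A t)^T).
Proof. by move=> mA i j; under eq_fun do rewrite mxE; exact: mA. Qed.

(** The selected index is the first entry of a finite list to pass a measurable test, so the
    composite is a finite cascade of measurable case distinctions, ending in the default index 0. *)
Lemma measurable_least_argmax D (f F : nat -> T -> R) :
  (forall k, measurable_fun setT (f k)) -> (forall k, measurable_fun setT (F k)) ->
  measurable_fun setT (fun t => F (least_argmax D (f ^~ t)) t).
Proof.
move=> mf mF; rewrite /least_argmax.
have mp k : measurable_fun setT (fun t => all (fun j => f j t <= f k t) (iota 1 D)).
  elim: (iota 1 D) => //= j s IH.
  by apply: measurable_and => //; exact: measurable_fun_ler.
pose p k t := all (fun j => f j t <= f k t) (iota 1 D).
rewrite -/(p _ _) in mp *.
change (measurable_fun setT (fun t => F (head 0%N [seq k <- iota 1 D | p k t]) t)).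
elim: (iota 1 D) => [|a s IH] /=; first exact: mF.
rewrite (_ : (fun t => _) = (fun t => if p a t then F a t
    else F (head 0%N [seq k <- s | p k t]) t)).
  by apply: measurable_fun_ifT => //; exact: mp.
by apply/funext => t; case: (p a t).
Qed.

End MatrixMeasurability.

Section QuadraticDensity.
Variable R : realType.

Lemma bilfE k (A : 'M[R]_k) x y :
  bilf A x y = \sum_i \sum_j x i 0 * A i j * y j 0.
Proof.
rewrite /bilf mxE exchange_big /=; apply: eq_bigr => j _.
by rewrite mxE mulr_suml; apply: eq_bigr => i _; rewrite mxE.
Qed.

(** The form is continuous and rational vectors are dense. Their countability is what turns
    semidefiniteness into a countable intersection of events. *)
Lemma psd_rat k (A : 'M[R]_k) :
  (forall q : 'cV[rat]_k, 0 <= bilf A (map_mx ratr q) (map_mx ratr q)) ->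
  forall v, 0 <= bilf A v v.
Proof.
move=> H v; apply/ler_addgt0Pr => e e0.
(* Moving every coordinate of [v] by at most h <= 1 changes the form by at most h * K: a product x y
   moves by at most h |x| + h |y| + h^2, and h^2 <= h. *)
pose K := \sum_i \sum_j `|A i j| * (`|v i 0| + `|v j 0| + 1).
have K0 : 0 <= K.
  by do 2 (apply: sumr_ge0 => ? _); rewrite mulr_ge0 ?addr_ge0.
pose h := Num.min 1 (e / (K + 1)).
have K1 : 0 < K + 1 by rewrite ltr_wpDl.
have h0 : 0 < h by rewrite lt_min ltr01 divr_gt0.
have h1 : h <= 1 by rewrite ge_min lexx.
have hK : h * K <= e.
  apply: (@le_trans _ _ (e / (K + 1) * K)).
    by rewrite ler_wpM2r // ge_min lexx orbT.
  by rewrite mulrAC ler_pdivrMr // ler_wpM2l ?(ltW e0) // lerDl.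
have /choice[q qP] : forall i : 'I_k, exists q : rat, `|ratr q - v i 0| <= h.
  move=> i; have hh : v i 0 - h < v i 0 + h by lra.
  have [q] := rat_in_itvoo hh; rewrite inE /= => /itvP qi.
  by exists q; rewrite ler_distl !ltW // qi.
apply: le_trans (H (\col_i q i)) _.
rewrite -lerBlDl; apply: le_trans hK.
rewrite !bilfE -sumrB /K mulr_sumr; apply: ler_sum => i _.
rewrite -sumrB mulr_sumr; apply: ler_sum => j _; rewrite !mxE.
have := qP i; have := qP j.
set a := ratr (q i); set b := ratr (q j); set x := v i 0; set y := v j 0 => bh ah.
rewrite (_ : _ - _ = A i j * (x * (b - y) + y * (a - x) + (a - x) * (b - y))); last by ring.
apply: le_trans (ler_norm _) _; rewrite normrM [leRHS]mulrCA ler_wpM2l //.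
rewrite [leRHS]mulrDr [in leRHS]mulrDr mulr1.
apply: le_trans (ler_normD _ _) _; rewrite lerD //.
  apply: le_trans (ler_normD _ _) _; rewrite !normrM.
  by rewrite lerD // mulrC ler_wpM2r.
rewrite normrM -[leRHS]mulr1 ler_pM // (le_trans bh) //.
Qed.

End QuadraticDensity.

(** Half-lines closed on the left generate the Borel sets, and r <= lambda_min holds exactly when
    the form of A - r is nonnegative on rational vectors, here enumerated by [unpickle]. *)
Lemma measurable_lambda_min d (T : measurableType d) (R : realType) k
    (A : T -> 'M[R]_k) : (0 < k)%N -> mxmeas A -> (forall t, (A t)^T = A t) ->
  measurable_fun setT (fun t => lambda_min (A t)).
Proof.
move=> k0 mA sA.
apply: (measurability (@RGenCInfty.G R)) => [|/= _ [_] [r] -> <-].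
  exact: RGenCInfty.measurableE.
rewrite setTI.
pose B (q : 'cV[rat]_k) := [set t | 0 <= bilf (A t - r%:M) (map_mx ratr q) (map_mx ratr q)].
have mB q : measurable (B q).
  rewrite (_ : B q = setT `&` (fun t => bilf (A t - r%:M) (map_mx ratr q) (map_mx ratr q)) @^-1` `[0, +oo[%classic).
    apply: (_ : measurable_fun setT _) => //.
    under eq_fun do rewrite bilfE.
    apply: measurable_sum => i; apply: measurable_sum => j.
    apply: measurable_funM => //; apply: measurable_funM => //.
    under eq_fun do rewrite !mxE.
    by apply: measurable_funB => //; exact: mA.
  by apply/seteqP; split=> t /=; rewrite in_itv /= andbT // => -[].
rewrite (_ : _ @^-1` _ = \bigcap_n (if unpickle n is Some q then B q else setT)).
  by apply: bigcapT_measurable => n; case: (unpickle n).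
apply/seteqP; split=> t /=.
  rewrite in_itv /= andbT => /(lambda_minP _ k0 (sA t)) H n _.
  case: (unpickle n) => // q; rewrite /B /= bilfBm bilf_scalar subr_ge0.
  exact: H.
move=> H; rewrite in_itv /= andbT; apply/(lambda_minP _ k0 (sA t)) => v.
rewrite -subr_ge0 -bilf_scalar -bilfBm; apply: psd_rat => q.
by have := H (pickle q) I; rewrite pickleK.
Qed.

(** * The test statistic *)

Section RealProbability.
Context d (T : measurableType d) (R : realType) (P : probability T R).

Definition Pr (A : set T) : R := fine (P A).

Lemma Pr_le A B : measurable A -> measurable B -> A `<=` B -> Pr A <= Pr B.
Proof.
move=> mA mB AB; rewrite /Pr fine_le ?fin_num_measure //.
by rewrite le_measure // inE.
Qed.

Lemma Pr_setU A B : measurable A -> measurable B -> Pr (A `|` B) <= Pr A + Pr B.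
Proof.
move=> mA mB; rewrite /Pr -fineD ?fin_num_measure // fine_le ?fin_num_measure //.
- exact: measurableU.
- by rewrite fin_numD !fin_num_measure.
- exact: measureU2.
Qed.

Lemma measurable_ge_set (f : T -> R) a : measurable_fun setT f ->
  measurable [set t | a <= f t].
Proof.
move=> mf; rewrite (_ : [set t | a <= f t] = setT `&` f @^-1` `[a, +oo[%classic).
  by apply: mf => //; exact: measurable_itv.
by apply/seteqP; split=> t /=; rewrite in_itv /= andbT // => -[].
Qed.

Lemma Pr_setU_disjoint A B : measurable A -> measurable B -> A `&` B = set0 ->
  Pr (A `|` B) = Pr A + Pr B.
Proof.
by move=> mA mB AB; rewrite /Pr -fineD ?fin_num_measure // measureU.
Qed.

Variable Y : T -> R.
Hypothesis mY : measurable_fun setT Y.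

Lemma measurable_abs_le b : measurable [set t | `|Y t| <= b].
Proof.
have mN : measurable_fun setT (fun t => - `|Y t|).
  by apply: measurableT_comp => //; apply: measurableT_comp.
rewrite (_ : [set t | _] = [set t | - b <= - `|Y t|]).
  exact: measurable_ge_set.
by apply/seteqP; split=> t /=; rewrite lerN2.
Qed.

Lemma cdf_abs_lower b :
  Pr [set t | Y t <= b] <= Pr [set t | `|Y t| <= b] + Pr [set t | Y t <= - b].
Proof.
have m1 := measurable_abs_le b; have m2 := measurable_sublevel mY.
apply: le_trans (Pr_setU m1 (m2 (- b))).
apply: Pr_le => //; first exact: measurableU.
move=> t /= Yb; have [Yb'|Yb'] := leP (Y t) (- b); first by right.
by left; rewrite /= ler_norml Yb ltW.
Qed.

(** The shift by [e] keeps the two events on the left disjoint even if [Y] has an atom at [- b]. *)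
Lemma cdf_abs_upper b e : 0 <= b -> 0 < e ->
  Pr [set t | `|Y t| <= b] + Pr [set t | Y t <= - b - e] <= Pr [set t | Y t <= b].
Proof.
move=> b0 e0; have m1 := measurable_abs_le b; have m2 := measurable_sublevel mY.
rewrite -Pr_setU_disjoint //.
  apply: Pr_le => //; first exact: measurableU.
  by move=> t /= [|Yb]; [rewrite ler_norml => /andP[]|lra].
apply/seteqP; split=> t //= [Yb Yb']; move: Yb; rewrite ler_norml => /andP[].
by move=> *; lra.
Qed.

End RealProbability.

Lemma chi2_1_cdf_ge0 (R : realType) (x : R) : 0 <= x ->
  fine (chi2_1 R `]-oo, x]%classic) =
  Pr (normal_prob 0 1) [set y : measurableTypeR R | `|y : R| <= Num.sqrt x].
Proof.
move=> x0; rewrite /Pr; congr fine.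
rewrite /chi2_1 /distribution /pushforward; congr (normal_prob 0 1 _).
apply/seteqP; split=> y /=; rewrite /sqr_fun in_itv /= => h.
  by rewrite -sqrtr_sqr ler_wsqrtr.
have := h; rewrite -(ler_pXn2r (ltn0Sn 1)) ?nnegrE ?sqrtr_ge0 //.
by rewrite sqr_sqrtr // real_normK ?num_real.
Qed.

Lemma chi2_1_cdf_lt0 (R : realType) (x : R) : x < 0 ->
  fine (chi2_1 R `]-oo, x]%classic) = 0.
Proof.
move=> x0; transitivity (fine (normal_prob 0 1 (set0 : set (measurableTypeR R)))); last first.
  by rewrite measure0.
congr fine; rewrite /chi2_1 /distribution /pushforward; congr (normal_prob 0 1 _).
apply/seteqP; split=> y //=; rewrite /sqr_fun in_itv /= => h.
by have := sqr_ge0 (y : R); have := le_lt_trans h x0; rewrite ltNge => /negP.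
Qed.

(** The final bookkeeping of [selected_cdf]: [pA] is the probability under study, [N] its normal
    limit, [Yp] and [Ym] are probabilities for |Y|, the F's are values of the distribution function
    of [Y] and the P's normal ones. Each direction loses 2 h on the exceptional event, 2 h by the
    central limit theorem and 3 h by Lipschitz continuity, 7 h in all. *)
Lemma cdf_arith (R : realFieldType)
    (h pA Yp Ym Fap Fmp Fam Fmm Pap Pmp Pam Pmm N Pa Pn Pnh : R) :
  pA <= h + h + Yp -> Ym <= h + h + pA -> Yp + Fmp <= Fap -> Fam <= Ym + Fmm ->
  `|Fap - Pap| <= h -> `|Fmp - Pmp| <= h -> `|Fam - Pam| <= h ->
  `|Fmm - Pmm| <= h ->
  Pa <= N + Pn -> N + Pnh <= Pa ->
  Pap <= Pa + h -> Pn <= Pmp + (h + h) -> Pa <= Pam + h ->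
  Pmm <= Pnh + (h + h) ->
  `|pA - N| <= 8 * h.
Proof.
rewrite !ler_norml => ? ? ? ? /andP[? ?] /andP[? ?] /andP[? ?] /andP[? ?].
by move=> *; apply/andP; split; lra.
Qed.

(** * Moment bounds and selection for an abstract array of scores *)

Section Statistics.
Context d (T : measurableType d) (R : realType) (P : probability T R).
(** [G s i] stands for P_(i+1)(X_s) - Q_(i+1)(U_s). The array is kept abstract: the moment bounds
    use independence only through the factorisation hypotheses [G_unc] and [G_unc2]. *)
Variable G : nat -> nat -> T -> R.

Definition score n k t : 'cV[R]_k :=
  \col_(i < k) ((Num.sqrt n%:R)^-1 * \sum_(s < n) G s i t).
Definition gram n k t : 'M[R]_k :=
  \matrix_(i < k, j < k) (n%:R^-1 * \sum_(s < n) G s i t * G s j t).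
Definition quad_stat n k t : R :=
  bilf (invmx (gram n k t)) (score n k t) (score n k t).
Definition covm k : 'M[R]_k :=
  \matrix_(i < k, j < k) \int[P]_t (G 0 i t * G 0 j t).

Lemma gram_sym n k t : (gram n k t)^T = gram n k t.
Proof.
apply/matrixP => i j; rewrite !mxE; congr (_ * _).
by apply: eq_bigr => s _; rewrite mulrC.
Qed.

Lemma gram_psd n k t v : 0 <= bilf (gram n k t) v v.
Proof.
rewrite bilfE (_ : \sum_i _ = n%:R^-1 * \sum_(s < n) (\sum_i v i 0 * G s i t) ^+ 2).
  by rewrite mulr_ge0 ?invr_ge0 // sumr_ge0 // => s _; rewrite sqr_ge0.
under eq_bigr => i _ do under eq_bigr => j _ do
  rewrite mxE mulrCA mulr_sumr -mulrA mulr_suml mulr_sumr.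
rewrite mulr_sumr.
transitivity (\sum_(i < k) \sum_(s < n) \sum_(j < k)
    n%:R^-1 * (v i 0 * (G s i t * G s j t) * v j 0)).
  apply: eq_bigr => i _; rewrite exchange_big /=; apply: eq_bigr => s _.
  by apply: eq_bigr => j _.
rewrite exchange_big /=; apply: eq_bigr => s _.
rewrite expr2 mulr_suml mulr_sumr; apply: eq_bigr => i _.
rewrite mulrCA mulr_sumr mulr_sumr; apply: eq_bigr => j _.
by ring.
Qed.

Lemma gram_mxsub n k K t (kK : (k <= K)%N) :
  gram n k t = mxsub (widen_ord kK) (widen_ord kK) (gram n K t).
Proof. by apply/matrixP => i j; rewrite !mxE. Qed.

Lemma nrm2_score_le n k K t : (k <= K)%N ->
  nrm2 (score n k t) <= nrm2 (score n K t).
Proof.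
move=> kK; rewrite !nrm2E.
under eq_bigr do rewrite mxE; under [leRHS]eq_bigr do rewrite mxE.
pose F i := ((Num.sqrt n%:R)^-1 * \sum_(s < n) G s i t) ^+ 2.
rewrite (big_ord_widen K F kK) [leRHS](bigID (fun i : 'I_K => (i < k)%N)) /=.
by rewrite lerDl sumr_ge0 // => i _; rewrite sqr_ge0.
Qed.

(* On this event every statistic of index at least 2 pays a penalty larger
   than its value. *)
Lemma selection_eq1 n K t c : (0 < K)%N -> 0 < c -> 
  (forall v, c * nrm2 v <= bilf (gram n K t) v v) ->
  nrm2 (score n K t) / c < ln n%:R ->
  least_argmax K (fun k => quad_stat n k t - k%:R * ln n%:R) = 1%N.
Proof.
move=> K0 c0 gc small; set f := fun k => _.
have [k1K kmax kmin] := least_argmaxP f K0.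
have bnd k : (k <= K)%N -> 0 <= quad_stat n k t <= nrm2 (score n K t) / c.
  move=> kK.
  have inj : injective (widen_ord kK) by move=> i j /(congr1 val) /= /val_inj.
  have gk v : c * nrm2 v <= bilf (gram n k t) v v.
    by rewrite (gram_mxsub n t kK); exact: bilf_mxsub.
  have /andP[-> /le_trans ->//] := bilf_invmx (gram_sym n k t) c0 gk (score n k t).
  by rewrite ler_pM2r ?invr_gt0 // nrm2_score_le.
set k := least_argmax K f in k1K kmax kmin *.
case: (ltngtP k 1) => // [|k1]; first by rewrite ltnNge; case/andP: k1K => ->.
(* A selected k >= 2 beats index 1 strictly. Since the statistic at 1 is nonnegative, the statistic
   at k would exceed (k - 1) log n >= log n, against the bound in [small]. *)
have H := kmin 1%N k1; rewrite /f in H.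
have /andP[_ kK] := k1K.
have /andP[_ bk] := bnd k kK; have /andP[b1 _] := bnd 1%N K0.
have l0 : 0 <= ln n%:R :> R.
  apply: le_trans (ltW small); rewrite divr_ge0 ?nrm2_ge0 ?(ltW c0) //.
have k2 : 2 * ln n%:R <= k%:R * ln n%:R :> R by rewrite ler_wpM2r // ler_nat.
exfalso; clear -small bk b1 l0 k2 H; lra.
Qed.

Lemma quad_stat1 n t : gram n 1 t 0 0 != 0 ->
  quad_stat n 1 t = score n 1 t 0 0 ^+ 2 / gram n 1 t 0 0.
Proof.
move=> g0; rewrite /quad_stat /bilf.
rewrite [in LHS](mx11_scalar (gram n 1 t)) [in LHS](mx11_scalar (score n 1 t)).
have -> : invmx (gram n 1 t 0 0)%:M = (gram n 1 t 0 0)^-1%:M :> 'M[R]_1.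
  by rewrite invmx_scalar.
by rewrite tr_scalar_mx -!scalar_mxM mxE eqxx mulr1n mulrAC -expr2.
Qed.

Hypothesis aG : forall s i, allmom P (G s i).
Hypothesis G_cov : forall s i j,
  \int[P]_t (G s i t * G s j t) = \int[P]_t (G 0 i t * G 0 j t).
Hypothesis G_4 : forall s i, \int[P]_t (G s i t ^+ 4) = \int[P]_t (G 0 i t ^+ 4).
Hypothesis G_unc : forall s s' i, s != s' -> \int[P]_t (G s i t * G s' i t) = 0.
Hypothesis G_unc2 : forall s s' i j, s != s' ->
  \int[P]_t (G s i t * G s j t * (G s' i t * G s' j t)) =
  \int[P]_t (G s i t * G s j t) * \int[P]_t (G s' i t * G s' j t).
Variable M : R.
Hypothesis M0 : 0 < M.
Hypothesis G_M : forall k, (0 < k)%N ->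
  \sum_(i < k) \int[P]_t (G 0 i t ^+ 4) <= k%:R * M.

Let iX k f : allmom P f -> P.-integrable setT (EFin \o (fun t => f t ^+ k)).
Proof. exact: allmom_integrableX. Qed.
Let i1 f : allmom P f -> P.-integrable setT (EFin \o f).
Proof. exact: allmom_integrable. Qed.

Lemma allmom_score n k (i : 'I_k) : allmom P (fun t => score n k t i 0).
Proof.
under eq_fun do rewrite mxE; apply: allmomZ; exact: allmom_sum.
Qed.

Lemma allmom_gram n k (i j : 'I_k) : allmom P (fun t => gram n k t i j).
Proof.
under eq_fun do rewrite mxE; apply: allmomZ; apply: allmom_sum => s.
exact: allmomM.
Qed.

Lemma allmom_nrm2_score n k : allmom P (fun t => nrm2 (score n k t)).
Proof.
under eq_fun do rewrite nrm2E; apply: allmom_sum => i.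
by apply: allmomX; exact: allmom_score.
Qed.

(** Uncorrelated summands cancel the normalisation, leaving second moments of single observations;
    x^2 <= 1 + x^4 brings them to the fourth moments controlled by [M], whence the factor
    [1 + M]. *)
Lemma nrm2_score_mean n k : (0 < n)%N -> (0 < k)%N ->
  \int[P]_t nrm2 (score n k t) <= k%:R * (1 + M).
Proof.
move=> n0 k0; under eq_Rintegral do rewrite nrm2E.
have [_ ->] := Rintegral_sum (index_enum 'I_k)
  (fun i : 'I_k => iX 2 (allmom_score n i)).
apply: (@le_trans _ _ (\sum_(i < k) (1 + \int[P]_t (G 0 i t ^+ 4)))); last first.
  by rewrite big_split /= sumr_const card_ord mulrDr mulr1 lerD2l G_M.
apply: ler_sum => i _.
rewrite (_ : \int[P]_t _ = \int[P]_t (n%:R^-1 * (\sum_(s < n) G s i t) ^+ 2)); last first.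
  apply: eq_Rintegral => t _; rewrite mxE exprMn exprVn sqr_sqrtr //.
rewrite RintegralZl //; last by apply: iX; exact: allmom_sum.
rewrite ler_pdivrMl ?ltr0n //.
apply: (@sum_square_moment _ T R P (fun s => G s i)) => [s|s|s s' ss'] //; last exact: G_unc.
rewrite -(G_4 s) -(Rintegral_const P 1) -RintegralD //; last exact: iX.
  apply: le_Rintegral => //; first exact: iX.
    by apply: integrable_RD; [exact: finite_measure_integrable_cst|exact: iX].
  by move=> t _; have := sqr_ge0 (G s i t ^+ 2 - 1); have := sqr_ge0 (G s i t); nra.
exact: finite_measure_integrable_cst.
Qed.

Lemma allmom_frob2_gram n k :
  allmom P (fun t => frob2 (gram n k t - covm k)).
Proof.
rewrite /frob2; apply: allmom_sum => i; apply: allmom_sum => j.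
under eq_fun do rewrite mxE; apply: allmomX; apply: allmomD.
  exact: allmom_gram.
exact: allmom_cst.
Qed.

(** Entry (i, j) is a mean of n uncorrelated products, so its variance is at most E (G_i G_j)^2 / n
    <= (q_i + q_j) / (2 n). Summing over i and j gives k / n times the sum of the q_i, hence the
    bound. *)
Lemma frob2_gram_mean n k : (0 < n)%N -> (0 < k)%N ->
  \int[P]_t frob2 (gram n k t - covm k) <= k%:R ^+ 2 * M / n%:R.
Proof.
move=> n0 k0; rewrite /frob2.
have aB (i j : 'I_k) : allmom P (fun t => (gram n k t - covm k) i j).
  under eq_fun do rewrite mxE; apply: allmomD; [exact: allmom_gram|exact: allmom_cst].
have [_ ->] := Rintegral_sum (index_enum 'I_k) (fun i : 'I_k =>
  i1 (allmom_sum (index_enum 'I_k) (fun j : 'I_k => allmomX 2 (aB i j)))).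
pose q i := \int[P]_t (G 0 i t ^+ 4).
apply: (@le_trans _ _ (\sum_(i < k) \sum_(j < k) (n%:R^-1 * ((q i + q j) / 2)))); last first.
  have -> : \sum_(i < k) \sum_(j < k) (n%:R^-1 * ((q i + q j) / 2)) =
      n%:R^-1 * (k%:R * \sum_(i < k) q i).
    under eq_bigr do
      rewrite -mulr_sumr -mulr_suml big_split /= sumr_const card_ord.
    rewrite -mulr_sumr -mulr_suml big_split /= sumr_const card_ord.
    by rewrite sumrMnl -[(\sum_(i < k) q i) *+ k]mulr_natl; congr (_ * _); field.
  by rewrite mulrC ler_pM2r ?invr_gt0 ?ltr0n // expr2 -mulrA ler_wpM2l ?G_M.
apply: ler_sum => i _.
have [_ ->] := Rintegral_sum (index_enum 'I_k) (fun j : 'I_k => iX 2 (aB i j)).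
apply: ler_sum => j _.
pose c := \int[P]_t (G 0 i t * G 0 j t).
pose g s t := G s i t * G s j t - c.
have ag s : allmom P (g s).
  by apply: allmomD; [exact: allmomM|exact: allmom_cst].
have ip s : P.-integrable setT (EFin \o (fun t => G s i t * G s j t)).
  by apply: i1; exact: allmomM.
have ic (a : R) : P.-integrable setT (EFin \o (fun=> a)).
  exact: finite_measure_integrable_cst.
rewrite (_ : \int[P]_t _ = \int[P]_t (n%:R ^- 2 * (\sum_(s < n) g s t) ^+ 2)); last first.
  apply: eq_Rintegral => t _; rewrite !mxE /g sumrB sumr_const card_ord -/c.
  rewrite -exprVn -exprMn mulrBr -[c *+ n]mulr_natl mulKf // pnatr_eq0 -lt0n //.
rewrite RintegralZl //; last by apply: iX; exact: allmom_sum.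
rewrite expr2 invfM -mulrA ler_wpM2l ?invr_ge0 //.
rewrite ler_pdivrMl ?ltr0n //.
apply: (@sum_square_moment _ T R P g) => // [s|s s' ss'].
  apply: (@le_trans _ _ (\int[P]_t (2^-1 * (G s i t ^+ 4 + G s j t ^+ 4)))); last first.
    rewrite RintegralZl //; last by apply: integrable_RD; exact: iX.
    by rewrite RintegralD // ?G_4 -/(q i) -/(q j); [rewrite mulrC|exact: iX|exact: iX].
  rewrite (_ : \int[P]_t _ = \int[P]_t ((G s i t * G s j t) ^+ 2 +
      (- (2 * c) * (G s i t * G s j t) + c ^+ 2))); last first.
    by apply: eq_Rintegral => t _; rewrite /g; ring.
  have i2p : P.-integrable setT (EFin \o (fun t => (G s i t * G s j t) ^+ 2)).
    by apply: iX; exact: allmomM.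
  rewrite RintegralD //; last first.
    by apply: integrable_RD => //; exact: integrable_RZ.
  rewrite RintegralD //; last exact: integrable_RZ.
  rewrite RintegralZl // G_cov -/c Rintegral_const.
  apply: (@le_trans _ _ (\int[P]_t ((G s i t * G s j t) ^+ 2))).
    by have := sqr_ge0 c; lra.
  apply: le_Rintegral => //.
    by apply: integrable_RZ; apply: integrable_RD; exact: iX.
  by move=> t _; have := sqr_ge0 (G s i t ^+ 2 - G s j t ^+ 2); lra.
rewrite (_ : \int[P]_t _ = \int[P]_t ((G s i t * G s j t) * (G s' i t * G s' j t) +
    (- c * (G s i t * G s j t) + (- c * (G s' i t * G s' j t) + c ^+ 2)))); last first.
  by apply: eq_Rintegral => t _; rewrite /g; ring.
have i4 : P.-integrable setT (EFin \o (fun t => (G s i t * G s j t) * (G s' i t * G s' j t))).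
  by apply: i1; apply: allmomM; exact: allmomM.
have iz s0 : P.-integrable setT (EFin \o (fun t => - c * (G s0 i t * G s0 j t))).
  exact: integrable_RZ.
have iz2 := integrable_RD (iz s') (ic (c ^+ 2)).
rewrite RintegralD //; last exact: integrable_RD.
rewrite RintegralD // RintegralD // !RintegralZl // Rintegral_const G_unc2 //.
by rewrite !G_cov -/c; ring.
Qed.

Lemma lambda_min_ge0 n k t : (0 < k)%N -> 0 <= lambda_min (gram n k t).
Proof.
move=> k0; apply/(lambda_minP _ k0 (gram_sym n k t)) => v.
by rewrite mul0r gram_psd.
Qed.

Lemma lambda_min_le n k t v : (0 < k)%N ->
  lambda_min (gram n k t) * nrm2 v <= bilf (gram n k t) v v.
Proof.
move=> k0.
by have /(lambda_minP _ k0 (gram_sym n k t)) := lexx (lambda_min (gram n k t)).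
Qed.

Lemma measurable_gram_lambda_min n k : (0 < k)%N ->
  measurable_fun setT (fun t => lambda_min (gram n k t)).
Proof.
move=> k0; apply: measurable_lambda_min => //; last exact: gram_sym.
by move=> i j; case: (allmom_gram n i j).
Qed.

Lemma allmom_bilf_gram n k (v : 'cV[R]_k) :
  allmom P (fun t => bilf (gram n k t) v v).
Proof.
under eq_fun do rewrite bilfE; apply: allmom_sum => i; apply: allmom_sum => j.
apply: allmomM; last exact: allmom_cst.
by apply: allmomM; [exact: allmom_cst|exact: allmom_gram].
Qed.

(** The smallest eigenvalue lies between 0 and the first diagonal entry, the value of the form at a
    unit vector. *)
Lemma integrable_lambda_min n k : (0 < k)%N ->
  P.-integrable setT (EFin \o (fun t => lambda_min (gram n k t))).
Proof.
move=> k0; pose v : 'cV[R]_k := delta_mx (Ordinal k0) 0.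
apply: (le_integrableR (measurable_gram_lambda_min n k0) _ (i1 (allmom_bilf_gram n v))).
move=> t; rewrite ger0_norm ?lambda_min_ge0 //.
by have := lambda_min_le n t v k0; rewrite nrm2_scale_delta mulr1.
Qed.

Lemma bilf_gram_mean n k (v : 'cV[R]_k) : (0 < n)%N ->
  \int[P]_t bilf (gram n k t) v v = bilf (covm k) v v.
Proof.
move=> n0; rewrite bilfE; under eq_Rintegral do rewrite bilfE.
have ag (i j : 'I_k) : allmom P (fun t => v i 0 * gram n k t i j * v j 0).
  apply: allmomM; last exact: allmom_cst.
  by apply: allmomM; [exact: allmom_cst|exact: allmom_gram].
have [_ ->] := Rintegral_sum (index_enum 'I_k) (fun i : 'I_k =>
  i1 (allmom_sum (index_enum 'I_k) (ag i))).
apply: eq_bigr => i _.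
have [_ ->] := Rintegral_sum (index_enum 'I_k) (fun j : 'I_k => i1 (ag i j)).
apply: eq_bigr => j _.
have igr := i1 (allmom_gram n i j).
rewrite RintegralZr ?RintegralZl //; last exact: integrable_RZ.
congr (_ * _ * _); under eq_Rintegral do rewrite mxE.
have ip s : P.-integrable setT (EFin \o (fun t => G s i t * G s j t)).
  by apply: i1; exact: allmomM.
have [iS E] := Rintegral_sum (index_enum 'I_n) (fun s : 'I_n => ip s).
rewrite RintegralZl // E mxE; under eq_bigr do rewrite G_cov.
by rewrite sumr_const card_ord -[X in _ * X]mulr_natl mulKf // pnatr_eq0 -lt0n.
Qed.

Lemma covm_lower n k (v : 'cV[R]_k) : (0 < n)%N -> (0 < k)%N ->
  (\int[P]_t lambda_min (gram n k t)) * nrm2 v <= bilf (covm k) v v.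
Proof.
move=> n0 k0; rewrite -(bilf_gram_mean v n0) -RintegralZr //; last first.
  exact: integrable_lambda_min.
apply: le_Rintegral => //.
- have := integrable_RZ (nrm2 v) (integrable_lambda_min n k0).
  by apply: eq_integrable => // t _ /=; rewrite mulrC.
- exact: i1 (allmom_bilf_gram n v).
- by move=> t _; exact: lambda_min_le.
Qed.

Lemma gram_lower n k t e : 0 < e ->
  (forall v, e * nrm2 v <= bilf (covm k) v v) ->
  frob2 (gram n k t - covm k) <= (e / 2) ^+ 2 ->
  forall v, e / 2 * nrm2 v <= bilf (gram n k t) v v.
Proof.
move=> e0 ce fe v.
have -> : gram n k t = covm k + (gram n k t - covm k) by rewrite addrC subrK.
set B := gram n k t - covm k in fe *.
have -> : bilf (covm k + B) v v = bilf (covm k) v v + bilf B v v.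
  by rewrite /bilf mulmxDr mulmxDl mxE.
have se : Num.sqrt (frob2 B) <= e / 2.
  by rewrite -[leRHS]ger0_norm ?divr_ge0 ?(ltW e0) // -sqrtr_sqr ler_wsqrtr.
have := ce v; have := bilf_frob B v; rewrite ler_norml => /andP[+ _].
have := ler_wpM2r (nrm2_ge0 v) se.
set q := nrm2 v; set s := Num.sqrt _ * q => h1 h2 h3.
rewrite (_ : e / 2 * q = e * q - e / 2 * q); last by field.
by lra.
Qed.

Lemma measurable_quad_stat n k : measurable_fun setT (quad_stat n k).
Proof.
have mg : mxmeas (fun t => gram n k t).
  by move=> i j; case: (allmom_gram n i j).
have ms : mxmeas (fun t => score n k t).
  by move=> i j; rewrite ord1; case: (allmom_score n i).
have := mxmeas_mul (mxmeas_mul (mxmeas_tr ms) (mxmeas_inv mg)) ms.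
exact.
Qed.

Definition sel D n t : nat :=
  least_argmax D (fun k => quad_stat n k t - k%:R * ln n%:R).

Lemma measurable_sel D n (F : nat -> T -> R) :
  (forall k, measurable_fun setT (F k)) ->
  measurable_fun setT (fun t => F (sel D n t) t).
Proof.
move=> mF.
apply: (@measurable_least_argmax _ _ _ D
  (fun k t => quad_stat n k t - k%:R * ln n%:R)) => // k.
by apply: measurable_funB => //; exact: measurable_quad_stat.
Qed.

Lemma measurable_sel_neq1 D n : measurable [set t | sel D n t != 1%N].
Proof.
have mS : measurable_fun setT (fun t => (sel D n t)%:R : R).
  by apply: (@measurable_sel D n (fun k _ => k%:R)).
rewrite (_ : [set t | _] = setT `&` (fun t => (sel D n t)%:R) @^-1` (~` [set 1 : R])).
  by apply: mS => //; apply: measurableC.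
apply/seteqP; split=> t /=.
  move=> h; split=> // /eqP; rewrite (eqr_nat _ _ 1) => h'.
  by rewrite h' in h.
by move=> [_ h]; apply/eqP => h'; apply: h; rewrite h'.
Qed.

Lemma Pr_sel_neq1 n D e : (0 < n)%N -> (0 < D)%N -> 0 < e -> 0 < ln (n%:R : R) ->
  (forall v, e * nrm2 v <= bilf (covm D) v v) ->
  Pr P [set t | sel D n t != 1%N] <=
  D%:R ^+ 2 * M / n%:R / (e / 2) ^+ 2 + D%:R * (1 + M) / (e / 2 * ln n%:R).
Proof.
move=> n0 D0 e0 l0 ce.
have e20 : 0 < e / 2 by rewrite divr_gt0.
pose A1 := [set t | (e / 2) ^+ 2 <= frob2 (gram n D t - covm D)].
pose A2 := [set t | e / 2 * ln n%:R <= nrm2 (score n D t)].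
have [mf if_] := allmom_frob2_gram n D.
have [ms is_] := allmom_nrm2_score n D.
have mA1 : measurable A1 by exact: measurable_ge_set.
have mA2 : measurable A2 by exact: measurable_ge_set.
have sub : [set t | sel D n t != 1%N] `<=` A1 `|` A2.
  move=> t /= St; have [h1|h1] := leP ((e / 2) ^+ 2) (frob2 (gram n D t - covm D)).
    by left.
  right; rewrite /A2 /= leNgt; apply: contra St => h2.
  apply/eqP/(@selection_eq1 n D t (e / 2)) => //.
    exact: gram_lower (ltW h1).
  by rewrite ltr_pdivrMr // mulrC.
apply: (le_trans (Pr_le P (measurable_sel_neq1 D n) (measurableU _ _ mA1 mA2) sub)).
apply: (le_trans (Pr_setU P mA1 mA2)); rewrite lerD //.
  apply: le_trans (@markov_ineq _ _ _ P _ _ _ mf _ (if_ 1%N)) _.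
  - by rewrite exprn_gt0.
  - by move=> t; exact: frob2_ge0.
  by rewrite ler_pM2r ?invr_gt0 ?exprn_gt0 // frob2_gram_mean.
apply: le_trans (@markov_ineq _ _ _ P _ _ _ ms _ (is_ 1%N)) _.
- by rewrite mulr_gt0.
- by move=> t; exact: nrm2_ge0.
by rewrite ler_pM2r ?invr_gt0 ?mulr_gt0 // nrm2_score_mean.
Qed.

Lemma near_ln_ge (L : R) : \forall n \near \oo, L <= ln (n%:R : R).
Proof.
exists (Num.truncn (expR L)).+1 => // n /= Ln.
have eL : expR L <= n%:R.
  by apply: le_trans (ltW (truncnS_gt _)) _; rewrite ler_nat.
by rewrite -[L]expRK ler_ln ?posrE ?expR_gt0 // (lt_le_trans (expR_gt0 L)).
Qed.

(** With l = log n this is l^3 <= 27 expR l, the cubic case of [normrX_le_expR]. *)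
Lemma ln_sqr_div_le n : 0 < ln (n%:R : R) ->
  ln (n%:R : R) ^+ 2 / n%:R <= 27 / ln n%:R.
Proof.
case: n => [|n] l0; first by rewrite ln0 // ltxx in l0.
have := normrX_le_expR (ln (n.+1%:R : R)) 2.
rewrite gtr0_norm // lnK ?posrE // => H.
rewrite ler_pdivrMr // mulrAC ler_pdivlMr // -exprSr.
by rewrite (_ : 27 = 3%:R ^+ 3) //; ring.
Qed.

(** * Asymptotics of the selection and of the selected statistic *)

Section Limits.
Variable D : nat -> nat.
Hypothesis D0 : forall n, (0 < n)%N -> (0 < D n)%N.
Let lam n := \int[P]_t lambda_min (gram n (D n) t).
Hypothesis lam_gt0 : \forall n \near \oo, 0 < lam n.
Hypothesis lam_large : forall e : R, 0 < e ->
  \forall n \near \oo, (D n)%:R ^+ 2 / lam n <= e * ln n%:R.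

Lemma sel_limit (e : R) : 0 < e ->
  \forall n \near \oo, Pr P [set t | sel (D n) n t != 1%N] <= e.
Proof.
(* The bound h <= 1 gives r <= log n, used for the Gram matrix; the other bound makes the score term
   2 (1 + M) r / log n at most e / 2. *)
move=> e0; pose h := Num.min 1 (e / (4 * (1 + M))).
have M1 : 0 < 1 + M by rewrite addr_gt0.
have h0 : 0 < h by rewrite lt_min ltr01 divr_gt0 // mulr_gt0.
have h1 : h <= 1 by rewrite ge_min lexx.
have he : h <= e / (4 * (1 + M)) by rewrite ge_min lexx orbT.
near=> n.
have n0 : (0 < n)%N by near: n; exists 1%N.
have l0 : 0 < lam n by near: n.
have H : (D n)%:R ^+ 2 / lam n <= h * ln n%:R by near: n; exact: lam_large.
have l1 : 1 <= ln (n%:R : R) by near: n; exact: near_ln_ge.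
(* The Gram term is at most 4 M * 27 / log n, which is at most e / 2 once log n >= 216 M / e. *)
have lM : 216 * M / e <= ln (n%:R : R) by near: n; exact: near_ln_ge.
have lp : 0 < ln (n%:R : R) by exact: lt_le_trans l1.
have k0 := D0 n0.
have n0' : 0 < n%:R :> R by rewrite ltr0n.
apply: le_trans (Pr_sel_neq1 n0 k0 l0 lp (fun v => covm_lower v n0 k0)) _.
have := ln_sqr_div_le lp.
have k1 : 1 <= (D n)%:R :> R by rewrite ler1n.
move: ((D n)%:R : R) (n%:R : R) (lam n) n0' l0 H l1 lM lp k1 => k nn v n0' v0.
move: (ln nn) => l H l1 lM l0 k1 ln2.
have k0' : 0 < k by exact: lt_le_trans k1.
set r := k ^+ 2 / v in H.
have r0 : 0 <= r by rewrite divr_ge0 ?exprn_ge0 ?ltW.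
have rl : r <= l.
  by apply: (le_trans H); rewrite -[leRHS]mul1r ler_wpM2r // ltW.
have -> : e = e / 2 + e / 2 by field.
rewrite lerD //.
  have -> : k ^+ 2 * M / nn / (v / 2) ^+ 2 = 4 * M * (r ^+ 2 / nn) / k ^+ 2.
    by rewrite /r; field; rewrite !gt_eqF.
  have k2 : 1 <= k ^+ 2 by rewrite exprn_ege1.
  rewrite ler_pdivrMr ?exprn_gt0 //.
  apply: (@le_trans _ _ (e / 2)); last by rewrite ler_peMr // divr_ge0 // ltW.
  apply: (@le_trans _ _ (4 * M * (27 / l))).
    rewrite ler_pM2l ?mulr_gt0 //; apply: le_trans ln2.
    by rewrite ler_pM2r ?invr_gt0 // lerXn2r ?nnegrE // ltW.
  rewrite mulrA ler_pdivrMr // (_ : 4 * M * 27 = e / 2 * (216 * M / e)); last first.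
    by field; rewrite gt_eqF.
  by rewrite ler_pM2l // divr_gt0.
have -> : k * (1 + M) / (v / 2 * l) = 2 * (1 + M) * (r / l) / k.
  by rewrite /r; field; rewrite !gt_eqF.
rewrite ler_pdivrMr //.
apply: (@le_trans _ _ (e / 2)); last by rewrite ler_peMr // divr_ge0 // ltW.
have -> : e / 2 = 2 * (1 + M) * (e / (4 * (1 + M))) by field; rewrite gt_eqF.
rewrite ler_pM2l ?mulr_gt0 //; apply: le_trans he.
by rewrite ler_pdivrMr.
Unshelve. all: by end_near.
Qed.

Lemma near_nat_ge (L : R) : \forall n \near \oo, L <= (n%:R : R).
Proof.
exists (Num.truncn L).+1 => // n /= Ln.
by apply: le_trans (ltW (truncnS_gt _)) _; rewrite ler_nat.
Qed.

Let v := \int[P]_t (G 0 0 t * G 0 0 t).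

(** A single large n suffices: the mean smallest eigenvalue is positive and bounds the form of the
    covariance matrix at the first basis vector, which is [v]. *)
Lemma var_gt0 : 0 < v.
Proof.
have n1 : \forall n \near \oo, (0 < n)%N by exists 1%N.
have [n [l0 n0]] := filter_ex (filterI lam_gt0 n1).
have k0 := D0 n0; apply: lt_le_trans l0 _.
have := covm_lower (delta_mx (Ordinal k0) 0) n0 k0.
rewrite nrm2_scale_delta mulr1 /bilf trmx_delta -rowE -colE !mxE.
exact.
Qed.

Let Y n t := (Num.sqrt n%:R)^-1 * \sum_(s < n) ((Num.sqrt v)^-1 * G s 0 t).

Hypothesis Y_clt : forall c e : R, 0 < e -> \forall n \near \oo,
  `|Pr P [set t | Y n t <= c] - fine (normal_prob 0 1 `]-oo, c]%classic)| <= e.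

Let measurable_Y n : measurable_fun setT (Y n).
Proof.
apply: measurable_funM => //; apply: measurable_sum => s.
by apply: measurable_funM => //; case: (aG s 0).
Qed.

Lemma quad_stat1E n t : gram n 1 t 0 0 != 0 ->
  quad_stat n 1 t = v * Y n t ^+ 2 / gram n 1 t 0 0.
Proof.
move=> g0; rewrite quad_stat1 // mxE /Y; congr (_ / _).
rewrite -mulr_sumr !exprMn ![_^-1 ^+ 2]exprVn (@sqr_sqrtr _ v) ?ltW ?var_gt0 //.
by rewrite mulrCA mulVKf // gt_eqF // var_gt0.
Qed.

Lemma gram1_dev n t h : 0 < h ->
  ~~ ((h * v) ^+ 2 <= frob2 (gram n 1 t - covm 1)) ->
  `|gram n 1 t 0 0 - v| < h * v.
Proof.
have E : (gram n 1 t - covm 1) 0 0 = gram n 1 t 0 0 - v.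
  by rewrite [LHS]mxE [X in _ + X]mxE [X in _ - X]mxE.
move=> h0; rewrite -ltNge /frob2 !big_ord1 E => H.
have hv : 0 <= h * v by rewrite mulr_ge0 ?(ltW h0) // ltW // var_gt0.
by rewrite -(ltr_pXn2r (ltn0Sn 1)) ?nnegrE // real_normK ?num_real.
Qed.

Lemma selected_cdf (x e : R) : 0 < e -> \forall n \near \oo,
  `|Pr P [set t | quad_stat n (sel (D n) n t) t <= x] -
    fine (chi2_1 R `]-oo, x]%classic)| <= e.
Proof.
move=> e0; pose h := e / 8; have h0 : 0 < h by rewrite divr_gt0.
have hh : h + h <= e by rewrite /h; lra.
have aux (p q r : R) : r <= q -> q <= p -> - (p * 2) + q <= - r by lra.
have v0 := var_gt0.
pose a := Num.sqrt x; have a0 : 0 <= a by rewrite sqrtr_ge0.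
(* The relative error allowed for the empirical variance: b < 1 and x b <= h^2. Multiplying x by 1 +
   b or 1 - b then moves its root by at most h, because (a + h)^2 >= x + h^2 and, if a >= h, (a -
   h)^2 <= x - h^2. *)
pose b := h ^+ 2 / (`|x| + 1 + h ^+ 2).
have h20 : 0 < h ^+ 2 by rewrite exprn_gt0.
have den0 : 0 < `|x| + 1 + h ^+ 2 by rewrite addr_gt0 // ltr_wpDl.
have b0 : 0 < b by rewrite divr_gt0.
have b1 : b < 1 by rewrite ltr_pdivrMr // mul1r ltrDr ltr_wpDl.
have xb : `|x| * b <= h ^+ 2.
  rewrite mulrCA ler_piMr ?(ltW h20) // ler_pdivrMr // mul1r.
  by rewrite -addrA lerDl addr_ge0 // ltW.
pose c := (b * v) ^+ 2; have c0 : 0 < c by rewrite exprn_gt0 // mulr_gt0.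
near=> n.
have n0 : (0 < n)%N by near: n; exists 1%N.
have n0' : 0 < n%:R :> R by rewrite ltr0n.
have S1 : Pr P [set t | sel (D n) n t != 1%N] <= h.
  by near: n; exact: sel_limit.
have nM : M / (c * h) <= n%:R by near: n; exact: near_nat_ge.
have C1 : `|Pr P [set t | Y n t <= a + h] -
    fine (normal_prob 0 1 `]-oo, (a + h)]%classic)| <= h by near: n; exact: (Y_clt _ h0).
have C2 : `|Pr P [set t | Y n t <= - (a + h) - h] -
    fine (normal_prob 0 1 `]-oo, (- (a + h) - h)]%classic)| <= h by near: n; exact: (Y_clt _ h0).
have C3 : `|Pr P [set t | Y n t <= a - h] -
    fine (normal_prob 0 1 `]-oo, (a - h)]%classic)| <= h by near: n; exact: (Y_clt _ h0).
have C4 : `|Pr P [set t | Y n t <= - (a - h)] -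
    fine (normal_prob 0 1 `]-oo, (- (a - h))]%classic)| <= h by near: n; exact: (Y_clt _ h0).
pose E1 := [set t | sel (D n) n t != 1%N].
pose E2 := [set t | c <= frob2 (gram n 1 t - covm 1)].
pose A := [set t | quad_stat n (sel (D n) n t) t <= x].
have [mf if_] := allmom_frob2_gram n 1.
have mE1 : measurable E1 by exact: measurable_sel_neq1.
have mE2 : measurable E2 by exact: measurable_ge_set.
have mE : measurable (E1 `|` E2) by exact: measurableU.
have mA : measurable A.
  by apply: measurable_sublevel; apply: measurable_sel; exact: measurable_quad_stat.
have S2 : Pr P E2 <= h.
  apply: le_trans (@markov_ineq _ _ _ P _ _ c0 mf _ (if_ 1%N)) _.
    by move=> t; exact: frob2_ge0.
  rewrite ler_pdivrMr //; apply: le_trans (frob2_gram_mean n0 (ltn0Sn 0)) _.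
  move: nM; rewrite (ler_pdivrMr _ _ (mulr_gt0 c0 h0)) => nM.
  rewrite expr1n mul1r ler_pdivrMr // (le_trans nM) //.
  by rewrite [leRHS]mulrC [h * c]mulrC.
have SE : Pr P (E1 `|` E2) <= h + h.
  by apply: le_trans (Pr_setU P mE1 mE2) _; exact: lerD.
(* Off the exceptional event index 1 is selected and the statistic is v Y^2 / g, with the empirical
   variance g within b v of v. *)
have good t : ~ (E1 `|` E2) t -> exists g : R,
    [/\ (1 - b) * v < g, g < (1 + b) * v &
     quad_stat n (sel (D n) n t) t = v * Y n t ^+ 2 / g].
  move=> /not_orP[/negP]; rewrite negbK => /eqP -> /negP /(gram1_dev b0).
  rewrite ltr_distl => /andP[g1 g2]; exists (gram n 1 t 0 0).
  have g0 : 0 < gram n 1 t 0 0.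
    by apply: le_lt_trans g1; rewrite subr_ge0 ler_piMl // ltW.
  by rewrite mulrBl mulrDl mul1r; split=> //; rewrite ?quad_stat1E ?gt_eqF // addrC.
have bv1 : 0 < (1 - b) * v by rewrite mulr_gt0 // subr_gt0.
have [x0|x0] := ltP x 0.
  rewrite chi2_1_cdf_lt0 // subr0 ger0_norm ?fine_ge0 //.
  apply: (@le_trans _ _ (h + h)) => //.
  apply: le_trans SE; apply: Pr_le => // t At; apply: contrapT => /good[g [g1 _ E]].
  have g0 : 0 < g := lt_trans bv1 g1.
  have p : 0 <= v * Y n t ^+ 2 / g.
    by rewrite divr_ge0 ?(ltW g0) // mulr_ge0 ?sqr_ge0 // ltW.
  by have := le_lt_trans At x0; rewrite E ltNge p.
rewrite chi2_1_cdf_ge0 //.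
have x_a : a ^+ 2 = x by rewrite sqr_sqrtr.
rewrite ger0_norm // in xb.
have mY := measurable_Y n; have mabs := measurable_abs_le mY.
have up : A `<=` (E1 `|` E2) `|` [set t | `|Y n t| <= a + h].
  move=> t At; have [?|/good[g [g1 g2 E]]] := pselect ((E1 `|` E2) t); first by left.
  have g0 : 0 < g := lt_trans bv1 g1.
  right; rewrite /= -(ler_pXn2r (ltn0Sn 1)) ?nnegrE ?addr_ge0 ?(ltW h0) //.
  rewrite real_normK ?num_real //.
  move: At; rewrite /A /= E ler_pdivrMr // => At.
  have : v * Y n t ^+ 2 <= x * ((1 + b) * v).
    by apply: le_trans At _; rewrite ler_wpM2l // ltW.
  rewrite [leRHS]mulrA [leRHS]mulrC ler_pM2l // => /le_trans; apply.
  rewrite sqrrD x_a mulrDr mulr1 -addrA lerD2l (le_trans xb) //.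
  by rewrite lerDr mulrn_wge0 // mulr_ge0 // ltW.
have low : [set t | `|Y n t| <= a - h] `<=` (E1 `|` E2) `|` A.
  move=> t /= Yt; have [?|/good[g [g1 g2 E]]] := pselect ((E1 `|` E2) t); first by left.
  have g0 : 0 < g := lt_trans bv1 g1.
  have ah : 0 <= a - h := le_trans (normr_ge0 _) Yt.
  right; rewrite /A /= E ler_pdivrMr //.
  apply: (@le_trans _ _ (x * ((1 - b) * v))); last by rewrite ler_wpM2l // ltW.
  rewrite [leRHS]mulrA [leRHS]mulrC ler_pM2l //.
  have : Y n t ^+ 2 <= (a - h) ^+ 2.
    by rewrite -real_normK ?num_real // lerXn2r ?nnegrE.
  move=> /le_trans; apply; rewrite sqrrB x_a mulrBr mulr1 -addrA lerD2l.
  have : h ^+ 2 <= a * h by rewrite expr2 ler_wpM2r ?(ltW h0) // -subr_ge0.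
  by rewrite -mulr_natr; exact: aux.
have I1 : Pr P A <= (h + h) + Pr P [set t | `|Y n t| <= a + h].
  have mU : measurable ((E1 `|` E2) `|` [set t | `|Y n t| <= a + h]) by exact: measurableU.
  apply: le_trans (Pr_le P mA mU up) _; apply: le_trans (Pr_setU P mE (mabs _)) _.
  by rewrite lerD2r.
have I2 : Pr P [set t | `|Y n t| <= a - h] <= (h + h) + Pr P A.
  have mU : measurable ((E1 `|` E2) `|` A) by exact: measurableU.
  apply: le_trans (Pr_le P (mabs _) mU low) _; apply: le_trans (Pr_setU P mE mA) _.
  by rewrite lerD2r.
have ah0 : 0 <= a + h by rewrite addr_ge0 // ltW.
have I3 := cdf_abs_upper P mY ah0 h0.
have I4 := cdf_abs_lower P mY (a - h).
pose N := normal_prob 0 1 : probability (measurableTypeR R) R.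
have mid : measurable_fun setT (fun t : measurableTypeR R => t : R) by exact: measurable_id.
have sub y : [set t : measurableTypeR R | (t : R) <= y] = `]-oo, y]%classic.
  by apply/seteqP; split=> t /=; rewrite in_itv.
have J1 := cdf_abs_lower N mid a.
have J2 := cdf_abs_upper N mid a0 h0.
rewrite !sub /Pr in J1 J2.
have K1 := normal_cdf_lip a (ltW h0).
have K2 := normal_cdf_lip (- (a + h) - h) (ltW (addr_gt0 h0 h0)).
have K3 := normal_cdf_lip (a - h) (ltW h0).
have K4 := normal_cdf_lip (- a - h) (ltW (addr_gt0 h0 h0)).
rewrite (_ : - (a + h) - h + (h + h) = - a) in K2; last by ring.
rewrite subrK in K3.
rewrite (_ : - a - h + (h + h) = - (a - h)) in K4; last by ring.
have -> : e = 8 * h by rewrite /h; field.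
rewrite /N in J1 J2.
rewrite /A /Pr in I1 I2 I3 I4 C1 C2 C3 C4 *.
move: I1 I2 I3 I4 C1 C2 C3 C4 J1 J2 K1 K2 K3 K4.
exact: cdf_arith.
Unshelve. all: by end_near.
Qed.

End Limits.

End Statistics.

(** * Deconvolution and the main theorem *)

Section Deconvolution.
Context d (T : measurableType d) (R : realType) (P : probability T R).
Variables (Y Z : T -> R) (z : nat -> R).
Hypotheses (aY : allmom P Y) (aZ : allmom P Z) (indep : independent_RV P Y Z).
Hypothesis zE : forall i, \int[P]_t (Z t ^+ i) = z i.

Lemma indep_moment i j :
  \int[P]_t (Y t ^+ i * Z t ^+ j) = \int[P]_t (Y t ^+ i) * z j.
Proof.
rewrite -zE; apply: indep_Rintegral_mul.
- by case: (allmomX i aY).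
- by case: (allmomX j aZ).
- move=> A B mA mB.
  have mX k (C : set R) : measurable C -> measurable ((fun x : R => x ^+ k) @^-1` C).
    move=> mC; rewrite -[X in measurable X]setTI; apply: (measurable_funX) => //.
  exact: (indep (mX i _ mA) (mX j _ mB)).
- exact: allmom_integrableX.
- exact: allmom_integrableX.
Qed.

(** Strong induction: the binomial expansion of E (Y + Z)^i cancels the recursion term by term for j
    < i, and the term j = i remains, with [z 0 = 1] as the moment of order 0. *)
Lemma deconv_poly_mean i :
  \int[P]_t (deconv_poly z i).[Y t + Z t] = \int[P]_t (Y t ^+ i).
Proof.
elim/ltn_ind: i => i IH.
have aX : allmom P (fun t => Y t + Z t) by exact: allmomD.
have iP j : P.-integrable setT (EFin \o (fun t => (deconv_poly z j).[Y t + Z t])).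
  by apply: allmom_integrable; exact: allmom_horner.
have iS (j : 'I_i) : P.-integrable setT
    (EFin \o (fun t => 'C(i, j)%:R * z (i - j)%N * (deconv_poly z j).[Y t + Z t])).
  exact: integrable_RZ.
rewrite (_ : \int[P]_t _ = \int[P]_t ((Y t + Z t) ^+ i -
    \sum_(j < i) 'C(i, j)%:R * z (i - j)%N * (deconv_poly z j).[Y t + Z t])); last first.
  apply: eq_Rintegral => t _; rewrite {1}deconv_polyE hornerD hornerN hornerXn.
  by rewrite horner_sum; congr (_ - _); apply: eq_bigr => j _; rewrite hornerZ.
have [iSum E] := Rintegral_sum (index_enum 'I_i) iS.
rewrite RintegralB //; last exact: allmom_integrableX.
rewrite E.
have iYZ (j : 'I_i.+1) : P.-integrable setT
    (EFin \o (fun t => 'C(i, j)%:R * (Y t ^+ j * Z t ^+ (i - j)))).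
  by apply: integrable_RZ; apply: allmom_integrable; apply: allmomM; exact: allmomX.
have [_ E'] := Rintegral_sum (index_enum 'I_i.+1) iYZ.
have -> : \int[P]_t ((Y t + Z t) ^+ i) =
    \sum_(j < i.+1) 'C(i, j)%:R * (\int[P]_t (Y t ^+ j) * z (i - j)%N).
  transitivity (\int[P]_t (\sum_(j < i.+1) 'C(i, j)%:R * (Y t ^+ j * Z t ^+ (i - j)))).
    apply: eq_Rintegral => t _; rewrite addrC exprDn; apply: eq_bigr => j _.
    by rewrite -mulr_natl mulrC [Z t ^+ _ * _]mulrC mulrC.
  rewrite E'; apply: eq_bigr => j _; rewrite RintegralZl ?indep_moment //.
  by apply: allmom_integrable; apply: allmomM; exact: allmomX.
rewrite big_ord_recr /= binn subnn.
have -> : z 0%N = 1.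
  by rewrite -zE; under eq_Rintegral do rewrite expr0; exact: Rintegral_const.
rewrite mul1r mulr1 addrAC -sumrB big1 ?add0r // => j _.
by rewrite RintegralZl // IH // -mulrA [z _ * _]mulrC subrr.
Qed.

End Deconvolution.

(** * The statistics of the theorem as instances of the abstract ones *)

Section Bridge.
Context (R : realType) (dT : measure_display) (T : measurableType dT).
Variables (z w : nat -> R) (Xs Us : nat -> T -> R).

Definition diff_coord s i t := deconv_diff z w i.+1 (Xs s t) (Us s t).

Lemma J_statE n k t :
  J_stat z w (Xs ^~ t) (Us ^~ t) n k = score diff_coord n k t.
Proof.
apply/matrixP => i j; rewrite ord1 !mxE summxE; congr (_ * _).
by apply: eq_bigr => s _; rewrite mxE.
Qed.

Lemma Sigma_hatE n k t :
  Sigma_hat z w (Xs ^~ t) (Us ^~ t) n k = gram diff_coord n k t.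
Proof.
apply/matrixP => i j; rewrite !mxE summxE; congr (_ * _).
by apply: eq_bigr => s _; rewrite mxE big_ord1 !mxE.
Qed.

Lemma T_statE n k t :
  T_stat z w (Xs ^~ t) (Us ^~ t) n k = quad_stat diff_coord n k t.
Proof. by rewrite /T_stat J_statE Sigma_hatE. Qed.

Lemma S_statE d n t :
  S_stat z w (Xs ^~ t) (Us ^~ t) d n = sel diff_coord (d n) n t.
Proof.
rewrite /S_stat /sel; congr least_argmax; apply/funext => k.
by rewrite T_statE.
Qed.

Lemma measurable_deconv_diff i :
  measurable_fun setT (fun p : R * R => deconv_diff z w i p.1 p.2).
Proof.
have mh (p : {poly R}) : measurable_fun setT (fun x : R => p.[x]).
  under eq_fun do rewrite horner_coef.
  by apply: measurable_sum => j; apply: measurable_funM.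
apply: measurable_funB.
  exact: (measurableT_comp (mh (deconv_poly z i)) measurable_fst).
exact: (measurableT_comp (mh (deconv_poly w i)) measurable_snd).
Qed.

End Bridge.

Lemma posdefmx_lambda_min (R : realType) k (A : 'M[R]_k) : (0 < k)%N ->
  posdefmx A -> 0 < lambda_min A.
Proof.
move=> k0 [sA pA].
have psd v : 0 <= bilf A v v.
  have [->|/pA/ltW//] := eqVneq v 0.
  by rewrite /bilf trmx0 !mul0mx mxE.
have uA : A \in unitmx.
  rewrite -row_free_unit -kermx_eq0; apply/rowV0P => v /sub_kermxP vA.
  apply/eqP; apply: contraT => v0.
  have vT0 : v^T != 0 by rewrite -(inj_eq trmx_inj) trmxK trmx0.
  by have := pA v^T vT0; rewrite trmxK vA mul0mx mxE ltxx.
have [c c0 cA] := posdef_lower_bound sA psd uA.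
by apply: lt_le_trans c0 _; apply/(lambda_minP _ k0 sA).
Qed.

(** The rank from which the matrices are positive definite depends on the sample point. A
    nonnegative variable with mean zero vanishes almost surely, so one point [t0] can be found off
    all these null sets at once; its own rank then works for the means. *)
Lemma near_lambda_min_mean_gt0 (R : realType) (dT : measure_display)
    (T : measurableType dT) (P : probability T R) (G : nat -> nat -> T -> R)
    (D : nat -> nat) :
  (forall s i, allmom P (G s i)) -> (forall n, (0 < n)%N -> (0 < D n)%N) ->
  {ae P, forall t, \forall n \near \oo,
    forall k, (1 <= k <= D n)%N -> posdefmx (gram G n k t)} ->
  \forall n \near \oo, 0 < \int[P]_t lambda_min (gram G n (D n) t).
Proof.
move=> aG D0 pd.
pose lam n t := lambda_min (gram G n (D n) t).
(* Empty unless the mean at n is zero; in that case the set where the eigenvalue does not vanish. It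
   is negligible in both cases. *)
pose N n := if ((0 < n)%N && (\int[P]_t lam n t == 0)) then ~` [set t | lam n t = 0] else set0.
have negN n : P.-negligible (N n).
  rewrite /N; case: ifP => [/andP[n0 /eqP l0]|_]; last exact: negligible_set0.
  have mlam : measurable_fun setT (lam n).
    by apply: (measurable_gram_lambda_min (P := P)) => //; exact: D0.
  have il : P.-integrable setT (EFin \o lam n).
    by apply: integrable_lambda_min => //; exact: D0.
  have lge0 t : 0 <= lam n t by apply: lambda_min_ge0; exact: D0.
  have i0 : (\int[P]_t `|(EFin \o lam n) t| = 0)%E.
    transitivity (\int[P]_t (lam n t)%:E)%E.
      by apply: eq_integral => t _ /=; rewrite ger0_norm.
    by rewrite -[LHS]fineK ?integrable_fin_num // -/(Rintegral P setT (lam n)) l0.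
  have mE : measurable_fun setT (EFin \o lam n) by exact/measurable_EFinP.
  have /(ae_eq_integral_abs P measurableT mE) := i0.
  apply: negligibleS => t /=; apply: contra_not => H.
  by have := H I => -[].
have negU := negligible_bigcup negN.
have negT := negligibleU pd negU.
have [t0 /not_orP[/contrapT pd0 Nt0]] : exists t0, ~ (~` [set t | \forall n \near \oo,
    forall k, (1 <= k <= D n)%N -> posdefmx (gram G n k t)] `|` \bigcup_n N n) t0.
  apply: contrapT => /forallNP H.
  have [B [mB B0 sB]] := negT.
  have : P setT = 0%E.
    apply/eqP; rewrite eq_le measure_ge0 andbT -B0.
    by apply: le_measure; rewrite ?inE // => t _; apply: sB; exact: contrapT (H t).
  by rewrite probability_setT => -[] /eqP; rewrite oner_eq0.
have n1 : \forall n \near \oo, (0 < n)%N by exists 1%N.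
move: pd0 n1; apply: filterS2 => n pdn n0.
have k0 := D0 n n0.
have lp : 0 < lam n t0.
  by apply: posdefmx_lambda_min => //; apply: pdn; rewrite k0 leqnn.
rewrite lt_neqAle Rintegral_ge0 ?andbT; last first.
  by move=> t _; exact: lambda_min_ge0.
apply/negP => /eqP l0; apply: Nt0; exists n => //; rewrite /N n0 /= -/(lam n).
by rewrite -l0 eqxx /= => l0'; rewrite l0' ltxx in lp.
Qed.

Unset Implicit Arguments.

Theorem theorem2 (R : realType) (dT : measure_display) (T : measurableType dT)
    (P : probability T R)
    (X Y Z U V W : {RV P >-> R}) (Xs Us : nat -> {RV P >-> R})
    (z w : nat -> R) (d : nat -> nat)
    (* model *)
    (X_def : forall t, X t = Y t + Z t)
    (U_def : forall t, U t = V t + W t)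
    (indep_YZ : independent_RV P Y Z)
    (indep_VW : independent_RV P V W)
    (indep_ZW : independent_RV P Z W)
    (X_moments : moment_determinate P X) (U_moments : moment_determinate P U)
    (Y_moments : moment_determinate P Y) (Z_moments : moment_determinate P Z)
    (V_moments : moment_determinate P V) (W_moments : moment_determinate P W)
    (z_def : forall i, 'E_P[fun t => (Z t ^+ i)%R]%E = (z i)%:E)
    (w_def : forall i, 'E_P[fun t => (W t ^+ i)%R]%E = (w i)%:E)
    (* i.i.d. observations *)
    (iid_law : forall s,
       same_law P P (fun t => (Xs s t, Us s t)) (fun t => (X t, U t)))
    (iid_indep : mutually_independent_RV P (fun s t => (Xs s t, Us s t)))
    (* maximal dimensions *)
    (d_gt0 : forall n, (0 < n)%N -> (0 < d n)%N)
    (d_nondecr : forall m n, (0 < m)%N -> (m <= n)%N -> (d m <= d n)%N)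
    (d_infty : d n @[n --> \oo] --> \oo)
    (* almost surely, for n large enough, invertibility *)
    (Sigma_posdef : {ae P, forall t, \forall n \near \oo,
       forall k, (1 <= k <= d n)%N ->
       posdefmx (Sigma_hat z w (Xs ^~ t) (Us ^~ t) n k)})
    (* null hypothesis *)
    (H0 : same_law P P Y V)
    (A1 : little_oP P
       (fun n _ => (d n)%:R ^+ 2 /
          fine 'E_P[fun t =>
            lambda_min (Sigma_hat z w (Xs ^~ t) (Us ^~ t) n (d n))]%E)
       (fun n => ln n%:R))
    (A2 : exists2 M : R, 0 < M & forall k, (0 < k)%N ->
       ((k%:R^-1)%:E * \sum_(1 <= i < k.+1)
          'E_P[fun t => (deconv_diff z w i (X t) (U t) ^+ 4)%R] < M%:E)%E) :
  cvg_in_distribution P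
    (fun n t => T_stat z w (Xs ^~ t) (Us ^~ t) n
       (S_stat z w (Xs ^~ t) (Us ^~ t) d n))
    (chi2_1 R).
Proof.
have am (F : {RV P >-> R}) : moment_determinate P F -> allmom P F.
  by move=> [hF _]; split=> //; exact: measurable_funPT.
have aX := am _ X_moments; have aU := am _ U_moments.
have aY := am _ Y_moments; have aV := am _ V_moments.
have aZ := am _ Z_moments; have aW := am _ W_moments.
have EE (f : T -> R) : fine 'E_P[f]%E = \int[P]_t f t by rewrite unlock.
have zE i : \int[P]_t (Z t ^+ i) = z i by rewrite -EE z_def.
have wE i : \int[P]_t (W t ^+ i) = w i by rewrite -EE w_def.
pose g i t := deconv_diff z w i.+1 (X t) (U t).
have ag i : allmom P (g i) by apply: allmomB; exact: allmom_horner.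
(* The null hypothesis enters here: both deconvolved means are moments of order [i.+1], one of [Y]
   and one of [V]. *)
have mean0 i : \int[P]_t g i t = 0.
  rewrite /g /deconv_diff RintegralB //; last 2 first.
  - by apply: allmom_integrable; exact: allmom_horner.
  - by apply: allmom_integrable; exact: allmom_horner.
  under eq_Rintegral do rewrite X_def.
  under [X in _ - X]eq_Rintegral do rewrite U_def.
  rewrite (deconv_poly_mean aY aZ indep_YZ zE) (deconv_poly_mean aV aW indep_VW wE).
  rewrite (same_law_Rintegral (h := fun x : R => x ^+ i.+1) _ _ _ H0) ?subrr //.
  exact: (allmom_integrableX i.+1 aV).
pose zeta s t := (Xs s t, Us s t).
have mzeta s : measurable_fun setT (zeta s).
  exact: measurable_pair.
have mXU : measurable_fun setT (fun t => (X t, U t)) by exact: measurable_pair.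
pose q i (p : R * R) := deconv_diff z w i.+1 p.1 p.2.
have mq i : measurable_fun setT (q i) by exact: measurable_deconv_diff.
pose G := diff_coord z w (fun s => Xs s : T -> R) (fun s => Us s : T -> R).
have aG s i : allmom P (G s i).
  split=> [|k]; first exact: (measurableT_comp (mq i) (mzeta s)).
  have mqk : measurable_fun setT (fun p => q i p ^+ k) by exact: measurable_funX.
  exact: (same_law_integrable (mzeta s) mXU mqk (iid_law s)
    (allmom_integrableX k (ag i))).
(* Every moment of a single observation is computed on the pair (X, U), hence does not depend on
   s. *)
have tr (h : R * R -> R) s : measurable_fun setT h ->
    allmom P (fun t => h (X t, U t)) ->
    \int[P]_t h (zeta s t) = \int[P]_t h (X t, U t).
  move=> mh ah.
  exact: (same_law_Rintegral (mzeta s) mXU mh (iid_law s) (allmom_integrable ah)).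
have G_mean s i : \int[P]_t G s i t = 0.
  by rewrite -(mean0 i); exact: (tr (q i) s (mq i) (ag i)).
have mqq i j : measurable_fun setT (fun p => q i p * q j p) by exact: measurable_funM.
have G_cov0 s i j : \int[P]_t (G s i t * G s j t) = \int[P]_t (g i t * g j t).
  exact: (tr _ s (mqq i j) (allmomM (ag i) (ag j))).
have G_cov s i j :
    \int[P]_t (G s i t * G s j t) = \int[P]_t (G 0 i t * G 0 j t).
  by rewrite !G_cov0.
have G_40 s i : \int[P]_t (G s i t ^+ 4) = \int[P]_t (g i t ^+ 4).
  have mq4 : measurable_fun setT (fun p => q i p ^+ 4) by exact: measurable_funX.
  exact: (tr _ s mq4 (allmomX 4 (ag i))).
have G_4 s i : \int[P]_t (G s i t ^+ 4) = \int[P]_t (G 0 i t ^+ 4).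
  by rewrite !G_40.
have mpre (h : R * R -> R) (C : set R) : measurable_fun setT h -> measurable C ->
    measurable (h @^-1` C).
  by move=> mh mC; rewrite -[X in measurable X]setTI; exact: mh.
have pair_indep (h : R * R -> R) s s' : measurable_fun setT h -> s != s' ->
    independent_RV P (fun t => h (zeta s t)) (fun t => h (zeta s' t)).
  move=> mh ss' A B mA mB.
  pose C k := if k == s then h @^-1` A else h @^-1` B.
  have mC k : measurable (C k) by rewrite /C; case: ifP => _; exact: mpre.
  have us : uniq [:: s; s'] by rewrite /= inE ss'.
  have := iid_indep [:: s; s'] C us mC.
  rewrite big_cons big_seq1 /C eqxx [s' == s]eq_sym (negbTE ss') => <-.
  congr (P _); apply/seteqP; split=> t /=.
    move=> [tA tB] k /=; rewrite !inE => /orP[]/eqP->; first by rewrite eqxx.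
    by rewrite eq_sym (negbTE ss').
  move=> H; split.
    by have := H s; rewrite /= !inE eqxx; apply.
  by have := H s'; rewrite /= !inE eqxx orbT eq_sym (negbTE ss'); apply.
have G_unc s s' i : s != s' -> \int[P]_t (G s i t * G s' i t) = 0.
  move=> ss'; have [ms _] := aG s i; have [ms' _] := aG s' i.
  have H := indep_Rintegral_mul ms ms' (pair_indep (q i) s s' (mq i) ss')
    (allmom_integrable (aG s i)) (allmom_integrable (aG s' i)).
  by apply: etrans H _; rewrite G_mean mul0r.
have aGG s i j : allmom P (fun t => G s i t * G s j t) by exact: allmomM.
have G_unc2 s s' i j : s != s' ->
    \int[P]_t (G s i t * G s j t * (G s' i t * G s' j t)) =
    \int[P]_t (G s i t * G s j t) * \int[P]_t (G s' i t * G s' j t).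
  move=> ss'; have [ms _] := aGG s i j; have [ms' _] := aGG s' i j.
  exact: (indep_Rintegral_mul ms ms' (pair_indep _ s s' (mqq i j) ss')
    (allmom_integrable (aGG s i j)) (allmom_integrable (aGG s' i j))).
have [M M0 AM] := A2.
have G_M k : (0 < k)%N -> \sum_(i < k) \int[P]_t (G 0 i t ^+ 4) <= k%:R * M.
  move=> k0; have k0' : 0 < k%:R :> R by rewrite ltr0n.
  have := AM k k0.
  rewrite (_ : (\sum_(1 <= i < k.+1) _)%E = (\sum_(i < k) \int[P]_t (G 0 i t ^+ 4))%:E).
    by rewrite -EFinM lte_fin ltr_pdivrMl // => /ltW.
  rewrite big_add1 /= big_mkord -sumEFin; apply: eq_bigr => i _.
  rewrite G_40 /Rintegral fineK ?unlock //.
  exact: integrable_fin_num (allmom_integrableX 4 (ag i)).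
pose lam n := \int[P]_t lambda_min (gram G n (d n) t).
have lam_gt0 : \forall n \near \oo, 0 < lam n.
  apply: near_lambda_min_mean_gt0 => //.
  move: Sigma_posdef; apply: filterS => t; apply: filterS => n H k kd.
  by rewrite /G -Sigma_hatE; exact: H.
have lam_large e : 0 < e ->
    \forall n \near \oo, (d n)%:R ^+ 2 / lam n <= e * ln n%:R.
  (* The event in (A1) does not depend on the sample point. Its probability is eventually below 1,
     so it cannot be the whole space, and the reverse inequality holds for the numbers
     themselves. *)
  move=> e0; have /fine_cvgP[_ /cvgrPdist_lt/(_ 1 ltr01) H] := A1 e e0.
  near=> n.
  have l0 : 0 < ln (n%:R : R).
    by apply: (@lt_le_trans _ _ 1) => //; near: n; exact: near_ln_ge.
  have far : ~ e <= `|(d n)%:R ^+ 2 / lam n / ln n%:R|.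
    move=> He; have : `|0 - fine (P setT)| < 1 :> R; last first.
      by rewrite probability_setT sub0r normrN normr1 ltxx.
    have lamE : fine 'E_P[fun t => lambda_min
        (Sigma_hat z w (Xs ^~ t) (Us ^~ t) n (d n))]%E = lam n.
      by rewrite EE; apply: eq_Rintegral => t _; rewrite /G -Sigma_hatE.
    rewrite (_ : [set: T] = [set t | e <= `|(d n)%:R ^+ 2 /
      fine 'E_P[fun t => lambda_min
        (Sigma_hat z w (Xs ^~ t) (Us ^~ t) n (d n))]%E / ln n%:R|]).
      by near: n; exact: H.
    by apply/seteqP; split=> t //= _; rewrite lamE.
  rewrite -ler_pdivrMr //; apply: le_trans (ler_norm _) _.
  by rewrite leNgt; apply/negP => /ltW.
have v0 := var_gt0 aG G_cov d_gt0 lam_gt0.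
set v := \int[P]_t (G 0 0 t * G 0 0 t) in v0.
pose r := (Num.sqrt v)^-1.
have r2v : r ^+ 2 * v = 1.
  by rewrite exprVn sqr_sqrtr ?ltW // mulVf // gt_eqF.
(* The first coordinate scaled to unit variance, to which the central limit theorem applies. *)
pose xi s t := r * G s 0 t.
have axi s : allmom P (xi s) by exact: allmomZ.
have mrq : measurable_fun setT (fun p => r * q 0 p) by exact: measurable_funM.
have xi_indep : mutually_independent_RV P xi.
  move=> I A uI mA.
  exact: (iid_indep I (fun s => (fun p => r * q 0 p) @^-1` A s) uI
    (fun s => mpre _ _ mrq (mA s))).
have xi_same s A : measurable A -> P (xi s @^-1` A) = P (xi 0 @^-1` A).
  move=> mA; have mA' := mpre _ _ mrq mA.
  exact: (etrans (iid_law s _ mA') (esym (iid_law 0 _ mA'))).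
have xi_mean : \int[P]_t xi 0 t = 0.
  by rewrite RintegralZl ?G_mean ?mulr0 //; exact: allmom_integrable.
have xi_var : \int[P]_t (xi 0 t ^+ 2) = 1.
  rewrite (_ : \int[P]_t _ = \int[P]_t (r ^+ 2 * (G 0 0 t * G 0 0 t))).
    by rewrite RintegralZl //; exact: allmom_integrable.
  by apply: eq_Rintegral => t _; rewrite exprMn -expr2.
have clt := central_limit (fun s => (axi s).1) xi_indep xi_same
  (allmom_integrable (axi 0)) (allmom_integrableX 2 (axi 0))
  (integrable_normX (allmom_integrableX 3 (axi 0))) xi_mean xi_var.
have main := selected_cdf aG G_cov G_4 G_unc G_unc2 M0 G_M d_gt0 lam_gt0
  lam_large clt.
have statE n t : T_stat z w (Xs ^~ t) (Us ^~ t) n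
    (S_stat z w (Xs ^~ t) (Us ^~ t) d n) = quad_stat G n (sel G (d n) n t) t.
  by rewrite /G -T_statE -S_statE.
have mstat n : measurable_fun setT (fun t => T_stat z w (Xs ^~ t) (Us ^~ t) n
    (S_stat z w (Xs ^~ t) (Us ^~ t) d n)).
  rewrite (_ : (fun t => _) = (fun t => quad_stat G n (sel G (d n) n t) t)).
    have mk k : measurable_fun setT (quad_stat G n k) by exact: (measurable_quad_stat aG).
    exact: (measurable_sel aG (d n) n mk).
  by apply/funext => t; exact: statE.
split=> [//|x _].
rewrite -[chi2_1 R _]fineK ?fin_num_measure //.
apply/fine_cvgP; split.
  by apply: nearW => n; apply: fin_num_measure; exact: measurable_sublevel.
apply/cvgrPdist_le => e e0; move: (main x e e0); apply: filterS => n.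
rewrite distrC /Pr /= (_ : [set t | _ <= x] = [set t | T_stat z w (Xs ^~ t) (Us ^~ t) n
    (S_stat z w (Xs ^~ t) (Us ^~ t) d n) <= x]) //.
by apply/seteqP; split=> t /=; rewrite statE.
Unshelve. all: by end_near.
Qed.
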